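(* Assume that $\lim_{t\to+\infty}\rho(t)=+\infty$, $\lim_{t\to+\infty}\frac{\dot\rho(t)}{\rho(t)}=k\ge0$, $\Omega_0$ is convex, and $J$ is compactly supported with $\int_{\mathbb R^n}J(x)x\,\mathrm dx=0$. Let $A=-nkI+\mathcal Df(0)$, where $I$ is the identity matrix, and let $s(A)$ be the maximal real part of its eigenvalues. Consider $$\frac{\partial u}{\partial t}=D\int_{\Omega_0}J_{\frac1{\rho(t)}}(y-z)u(t,z)\,\mathrm dz-Du-\frac{n\dot\rho(t)}{\rho(t)}u+f(u),\quad t>0,\ y\in\overline\Omega_0,\qquad u(0,y)=u_0(y).\qquad (\ast)$$ (1) If $s(A)\le0$, then $0$ is globally asymptotically stable for $(\ast)$ in $\hat X_+^v$. (2) If $s(A)>0$, then for each $u_0\in\hat X_+^v\setminus\hat{\mathbf 0}$ the solution $u(t,y;u_0)$ of $(\ast)$ satisfies $\lim_{t\to+\infty}u(t,y;u_0)=w_e$ uniformly for $y$ in any compact subset of $\Omega_0$, where $w_e$ is the unique positive equilibrium in $\mathbb M$ of $\frac{\mathrm dw}{\mathrm dt}=-nkw+f(w)$.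
   Context: Setting. $m,n\ge1$ are integers; $\Omega_0\subset\mathbb R^n$ is a bounded, simply connected domain with smooth boundary; $D=\mathrm{diag}\{d_1,\dots,d_m\}$ with all $d_i>0$; $\rho:[0,\infty)\to(0,\infty)$ is smooth with $\rho(0)=1$; $u=(u_1,\dots,u_m)^T$. For $r>0$, $J_{\frac1r}(y):=r^nJ(ry)$. Inequalities between vectors in $\mathbb R^m$: $a\ge b$ means $a-b\in\mathbb R^m_+$; $a>b$ means $a\ge b$ and $a\ne b$; $a\gg b$ means $a-b\in\mathrm{Int}(\mathbb R^m_+)$. Fix $v\in\mathrm{Int}(\mathbb R^m_+)$ and let $\mathbb M=\{u\in\mathbb R^m:0\le u\le v\}$. A matrix is cooperative if its off-diagonal entries are nonnegative. Assumption on $J$: $J:\mathbb R^n\to\mathbb R$ is continuous and nonnegative, $J(0)>0$, $\int_{\mathbb R^n}J(x)\,\mathrm dx=1$. Assumption on $f$: $f\in C^1(\mathbb R^m,\mathbb R^m)$; the Jacobian $\mathcal Df(u)=(\partial f_i(u)/\partial u_j)_{m\times m}$ is cooperative and irreducible for $u\in\mathbb M$; $f(0)=0$; there is $\sigma>0$ such that for each $1\le i\le m$, $f_i(u)-n\frac{\dot\rho(t)}{\rho(t)}v_i\le-\sigma$ whenever $t\ge0$ and $u\in\mathbb M$ with $u_i=v_i$; and $\alpha f(u)<f(\alpha u)$ for all $u\in\mathbb M\cap\mathrm{Int}(\mathbb R^m_+)$ and $\alpha\in(0,1)$. Spaces. $\|a\|_{\mathbb R^m}=\max_i|a_i|$.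 $\hat X$ is the Banach space of bounded Lebesgue measurable functions $\overline\Omega_0\to\mathbb R^m$ (defined everywhere, not classes) with $\|\varphi\|_{\hat X}=\sup_{x\in\overline\Omega_0}\|\varphi(x)\|_{\mathbb R^m}$; $\hat X_+^v=\{\varphi\in\hat X:0\le\varphi(x)\le v,\ x\in\overline\Omega_0\}$; $\hat{\mathbf 0}=\{\varphi\in\hat X:\varphi=0\text{ a.e. in }\overline\Omega_0\}$. Solutions with data in $\hat X_+^v$ are understood in $C([0,\infty),\hat X)$. If $s(A)>0$, the system $\frac{\mathrm dw}{\mathrm dt}=-nkw+f(w)$ has a unique positive equilibrium $w_e$ in $\mathbb M$, and it attracts all solutions starting in $\mathbb M\setminus\{0\}$. Stability. $0$ is globally asymptotically stable in $S\subset\hat X$ if $\lim_{t\to\infty}\|u(t,\cdot;\varphi)\|_{\hat X}=0$ for all $\varphi\in S$ and, for every $\varepsilon>0$, there is $\delta>0$ such that $\varphi\in S$, $\|\varphi\|_{\hat X}<\delta$ imply $\|u(t,\cdot;\varphi)\|_{\hat X}<\varepsilon$ for all $t\ge0$, where $u(t,\cdot;\varphi)$ is the solution with $u(0,\cdot)=\varphi$. *)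

(* Defs.v *)
From HB Require Import structures.
From mathcomp Require Import all_boot all_order all_algebra.
From mathcomp Require Import all_classical all_reals all_analysis.
From mathcomp.real_closed Require Import complex.

Set Implicit Arguments.
Unset Strict Implicit.
Unset Printing Implicit Defensive.
Import Order.TTheory GRing.Theory Num.Theory.
Import numFieldNormedType.Exports.

Local Open Scope classical_set_scope.
Local Open Scope ring_scope.

(* Points of R^n and vectors of R^m are row vectors.  The library norm of
   'rV[R]_m is the maximum norm. *)

Section LebesgueMeasure.
Context (R : realType) (n : nat).
Local Notation V := 'rV[R]_n.

Definition box (c : V * V) : set V :=
  [set x | forall i, c.1 0 i <= x 0 i <= c.2 0 i].

Definition box_volume (c : V * V) : R :=
  \prod_(i < n) Num.max 0 (c.2 0 i - c.1 0 i).

Definition lebesgue_outer (X : set V) : \bar R :=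
  ereal_inf [set (\esum_(c in C) (box_volume c)%:E)%E | C in
    [set C : set (V * V) | countable C /\ X `<=` \bigcup_(c in C) box c]].

Lemma box_volume_ge0 c : 0 <= box_volume c.
Proof. by apply: prodr_ge0 => i _; rewrite le_max lexx. Qed.

Lemma lebesgue_outer_ge0 X : (0 <= lebesgue_outer X)%E.
Proof.
apply: le_ereal_inf_tmp => _ [C _ <-].
by apply: esum_ge0 => c _; rewrite lee_fin box_volume_ge0.
Qed.

Lemma lebesgue_outer0 : lebesgue_outer set0 = 0%E.
Proof.
apply/eqP; rewrite eq_le lebesgue_outer_ge0 andbT.
apply: ereal_inf_lbound; exists set0; last exact: esum_set0.
by split; [exact: countable0 | exact: sub0set].
Qed.

Lemma le_lebesgue_outer :
  {homo lebesgue_outer : A B / A `<=` B >-> (A <= B)%E}.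
Proof.
move=> A B AB; apply/ereal_inf_le_tmp => _ [C [cC BC] <-].
by exists C => //; split => //; apply: subset_trans AB BC.
Qed.

Lemma lebesgue_outer_sigma_subadditive : sigma_subadditive lebesgue_outer.
Proof.
move=> A; have [[i ioo]|] := pselect (exists i, lebesgue_outer (A i) = +oo%E).
  rewrite (eseries_pinfty _ _ ioo) ?leey// => k _.
  by rewrite -ltNye (lt_le_trans _ (lebesgue_outer_ge0 _)).
rewrite -forallNE => Aoo; apply/lee_addgt0Pr => e e0.
rewrite (le_trans _ (epsilon_trick _ _ (ltW e0)))//; last first.
  by move=> k; exact: lebesgue_outer_ge0.
pose P k (C : set (V * V)) :=
  [/\ countable C, A k `<=` \bigcup_(c in C) box c &
  (\esum_(c in C) (box_volume c)%:E <=
    lebesgue_outer (A k) + (e / (2 ^ k.+1)%:R)%:E)%E].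
have [G PG] : {G : nat -> set (V * V) & forall k, P k (G k)}.
  apply: (@choice _ _ P) => k; rewrite /P.
  have fA : lebesgue_outer (A k) \is a fin_num.
    by rewrite ge0_fin_numE ?lebesgue_outer_ge0// ltey; exact/eqP/Aoo.
  have ek : 0 < e / (2 ^ k.+1)%:R by rewrite divr_gt0// ltr0n expn_gt0.
  have [_ [C [cC AC] <-] lC] := lb_ereal_inf_adherent ek fA.
  by exists C; split => //; exact/ltW.
have v0 c : (0 <= (box_volume c)%:E)%E by rewrite lee_fin box_volume_ge0.
apply: (@le_trans _ _ (\esum_(c in \bigcup_k G k) (box_volume c)%:E)%E).
  apply: ereal_inf_lbound; exists (\bigcup_k G k) => //; split.
    by apply: bigcup_countable => // k _; have [] := PG k.
  move=> x [k _ Akx]; have [_ /(_ _ Akx)[c Gc cx] _] := PG k.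
  by exists c => //; exists k.
rewrite seqDU_bigcup_eq (nneseries_sum_bigcup (trivIset_seqDU G) v0).
apply: lee_nneseries => k _; first by move=> _; exact: esum_ge0.
have [_ _] := PG k; apply: le_trans.
rewrite esum_mkcond [leRHS]esum_mkcond; apply: le_esum => c _.
case: ifPn => [|_]; last by case: ifPn.
by move=> /set_mem Gc; rewrite (mem_set (subset_seqDU Gc)).
Qed.

HB.instance Definition _ := isOuterMeasure.Build R V lebesgue_outer
  lebesgue_outer0 lebesgue_outer_ge0 le_lebesgue_outer
  lebesgue_outer_sigma_subadditive.

Definition lebesgue_outer_measure : {outer_measure set V -> \bar R} :=
  lebesgue_outer.

(* R^n with the sigma-algebra of Lebesgue measurable sets. *)
Definition lebesgueType := caratheodory_type lebesgue_outer_measure.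
HB.instance Definition _ := Measurable.on lebesgueType.

Definition lebesgue_Rn (X : set lebesgueType) : \bar R :=
  lebesgue_outer_measure X.
HB.instance Definition _ := Measure.copy lebesgue_Rn
  (lebesgue_outer_measure :
     set (caratheodory_type lebesgue_outer_measure) -> \bar R).

End LebesgueMeasure.
Arguments lebesgue_Rn {R n}.

Section VectorOrder.
Context (R : realType) (m : nat).
Implicit Types a b : 'rV[R]_m.

Definition vle a b := forall i, a 0 i <= b 0 i.
Definition vlt a b := vle a b /\ a <> b.
Definition vll a b := forall i, a 0 i < b 0 i.

Definition order_interval (v : 'rV[R]_m) : set 'rV[R]_m :=
  [set u | vle 0 u /\ vle u v].

End VectorOrder.

Section Matrices.
Context (R : realType) (m : nat).

Definition cooperative (A : 'M[R]_m) := forall i j, i != j -> 0 <= A i j.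

Definition irreducible_mx (A : 'M[R]_m) :=
  forall S : {set 'I_m}, S != finset.set0 -> S != [set: 'I_m]%SET ->
    exists i j, [/\ i \in S, j \notin S & A i j != 0].

(* The set of eigenvalues is finite, and nonempty when 0 < m, so that this
   supremum is a maximum. *)
Definition spectral_bound (A : 'M[R]_m) : R :=
  sup [set complex.Re z | z in
    [set z : complex.complex R |
      eigenvalue (map_mx (complex.real_complex R) A) z]].

(* Entry (i, j) is the partial derivative of f_i with respect to u_j. *)
Definition Df (f : 'rV[R]_m -> 'rV[R]_m) (u : 'rV[R]_m) : 'M[R]_m :=
  \matrix_(i, j) 'D_(delta_mx 0 j) (fun w => f w 0 i) u.

Definition C1 (f : 'rV[R]_m -> 'rV[R]_m) :=
  (forall u, differentiable f u) /\ continuous (Df f).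

End Matrices.

Section HalfLine.
Context (R : realType).
Implicit Types (g : R -> R) (t : R).

(* Derivative relative to [0, +oo[ : right derivative at 0, and the usual
   derivative at every t > 0.  Values of g on ]-oo, 0[ play no role. *)
Definition half_quotients g t : set_system R :=
  (fun h => h^-1 * (g (t + h) - g t)) @ within [set h | 0 <= t + h] 0^'.

Definition half_derivable g t := cvg (half_quotients g t).
Definition half_derive g t : R := lim (half_quotients g t).

Definition half_smooth g :=
  forall k t, 0 <= t -> half_derivable (iter k half_derive g) t.

End HalfLine.

Section Domains.
Context (R : realType) (n : nat).
Implicit Types A : set 'rV[R]_n.

Definition simply_connected A :=
  (forall x y, A x -> A y -> exists p : R -> 'rV[R]_n,
    [/\ {within `[0, 1], continuous p}, p 0 = x, p 1 = y &
        p @` `[0, 1] `<=` A]) /\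
  (forall p : R -> 'rV[R]_n,
    {within `[0, 1], continuous p} -> p 0 = p 1 -> p @` `[0, 1] `<=` A ->
    exists H : R * R -> 'rV[R]_n,
      [/\ {within `[0, 1] `*` `[0, 1], continuous H},
          H @` (`[0, 1] `*` `[0, 1]) `<=` A,
          forall s, 0 <= s <= 1 -> H (0, s) = p s /\ H (1, s) = p 0 &
          forall t, 0 <= t <= 1 -> H (t, 0) = p 0 /\ H (t, 1) = p 0]).

Fixpoint Ck (k : nat) (q : nat) (g : 'rV[R]_q -> R) : Prop :=
  match k with
  | 0%N => continuous g
  | k'.+1 => continuous g /\ forall i,
      (forall x, derivable g x (delta_mx 0 i)) /\
      Ck k' (fun x => 'D_(delta_mx 0 i) g x)
  end.

Definition smooth q (g : 'rV[R]_q -> R) := forall k, Ck k g.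

(* Near each of its boundary points, A is the strict epigraph of a smooth
   function of the other n - 1 coordinates, after choosing the coordinate
   axis i and its orientation (-1) ^+ s; col' i y is y without its i-th
   coordinate. *)
Definition smooth_boundary A :=
  forall x, (closure A `\` A°) x ->
  exists r (i : 'I_n) (s : bool) (g : 'rV[R]_n.-1 -> R),
    [/\ 0 < r, smooth g & forall y, ball x r y ->
      (A y <-> 0 < (-1) ^+ s * (y 0 i - g (col' i y)))].

Definition smooth_bounded_simply_connected_domain A :=
  [/\ open A, A !=set0 & connected A] /\
  [/\ bounded_set A, simply_connected A & smooth_boundary A].

End Domains.

Section Kernel.
Context (R : realType) (n : nat).
Implicit Types J : 'rV[R]_n -> R.

Definition kernel_assumption J :=
  [/\ continuous J, forall x, 0 <= J x, 0 < J 0 &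
      (\int[lebesgue_Rn]_x (J x)%:E = 1)%E].

Definition compactly_supported J := compact (closure [set x | J x != 0]).

Definition centered J :=
  forall i, \int[lebesgue_Rn]_x (J x * x 0 i) = 0.

(* scaled_kernel J r is J_{1/r}. *)
Definition scaled_kernel J (r : R) (y : 'rV[R]_n) : R := r ^+ n * J (r *: y).

End Kernel.

Section Problem.
Context (R : realType) (m n : nat).
Variables (Om : set 'rV[R]_n) (d : 'rV[R]_m) (rho : R -> R)
  (J : 'rV[R]_n -> R) (f : 'rV[R]_m -> 'rV[R]_m) (v : 'rV[R]_m).
Implicit Types (phi : 'rV[R]_n -> 'rV[R]_m) (u : R -> 'rV[R]_n -> 'rV[R]_m).

Definition dilution (t : R) : R := n%:R * (half_derive rho t / rho t).

Definition reaction_assumption :=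
  [/\ C1 f,
      forall w, order_interval v w ->
        cooperative (Df f w) /\ irreducible_mx (Df f w),
      f 0 = 0,
      exists2 sigma : R, 0 < sigma & forall i (t : R) w,
        0 <= t -> order_interval v w -> w 0 i = v 0 i ->
        f w 0 i - dilution t * v 0 i <= - sigma &
      forall w (alpha : R), order_interval v w -> vll 0 w ->
        0 < alpha -> alpha < 1 -> vlt (alpha *: f w) (f (alpha *: w))].

(* Functions on the closure of Om are represented by total functions, whose
   values outside the closure of Om are ignored throughout. *)
Definition Xhat phi :=
  (exists B : R, forall x, closure Om x -> `|phi x| <= B) /\
  (forall i, measurable_fun (closure Om : set (lebesgueType R n))
     (fun x : lebesgueType R n => phi x 0 i)).

Definition Xnorm phi : R := sup [set `|phi x| | x in closure Om].

Definition Xhat_v phi :=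
  Xhat phi /\ forall x, closure Om x -> order_interval v (phi x).

Definition ae_zero phi :=
  {ae @lebesgue_Rn R n, forall x, closure Om x -> phi x = 0}.

Definition dispersal (t : R) phi (y : 'rV[R]_n) : 'rV[R]_m :=
  \row_i \int[lebesgue_Rn]_(z in (Om : set (lebesgueType R n)))
    (scaled_kernel J (rho t) (y - z) * phi z 0 i).

(* With row vectors, the product D w of the diagonal matrix D = diag d with
   the vector w reads w *m diag_mx d. *)
Definition rhs (t : R) phi (y : 'rV[R]_n) : 'rV[R]_m :=
  dispersal t phi y *m diag_mx d - phi y *m diag_mx d
  - dilution t *: phi y + f (phi y).

Definition solution phi u :=
  [/\ forall t : R, 0 <= t -> Xhat (u t),
      forall t : R, 0 <= t ->
        Xnorm (fun y => u s y - u t y)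
          @[s --> within [set s | 0 <= s] (nbhs t)] --> (0 : R),
      forall y, closure Om y -> u 0 y = phi y &
      forall (t : R) y, 0 < t -> closure Om y ->
        is_derive t (1 : R) (fun s => u s y) (rhs t (u t) y)].

(* Solutions are unique, so quantifying over every solution u starting from
   phi amounts to speaking of u(t, . ; phi). *)
Definition globally_asymptotically_stable0 (S : set ('rV[R]_n -> 'rV[R]_m)) :=
  (forall phi u, S phi -> solution phi u ->
     Xnorm (u t) @[t --> +oo] --> (0 : R)) /\
  (forall eps : R, 0 < eps -> exists2 delta : R, 0 < delta &
     forall phi u, S phi -> Xnorm phi < delta -> solution phi u ->
     forall t : R, 0 <= t -> Xnorm (u t) < eps).

(* Positive equilibria in [0, v] of w' = - n k w + f w. *)
Definition positive_equilibrium (k : R) (w : 'rV[R]_m) :=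
  [/\ order_interval v w, vlt 0 w & - (n%:R * k) *: w + f w = 0].

End Problem.

(* Main.v *)
Require Import Defs.
From HB Require Import structures.
From mathcomp Require Import all_boot all_order all_algebra.
From mathcomp Require Import all_classical all_reals all_analysis.
From mathcomp Require Import measurable_realfun.
From mathcomp Require Import ring lra.
From mathcomp.real_closed Require Import complex.
Set Implicit Arguments.
Unset Strict Implicit.
Unset Printing Implicit Defensive.
Import Order.TTheory GRing.Theory Num.Theory.
Import numFieldNormedType.Exports.
Local Open Scope classical_set_scope.
Local Open Scope ring_scope.


(** Write kap = n k, and let A be the Jacobian of w |-> f w - kap w at 0.  Since rho
    tends to infinity the kernel concentrates, and since the dilution rate tends
    to kap, solutions should eventually follow the system w' = f w - kap w away
    from the boundary.  The proof makes this precise with sub- and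
    supersolutions built from vectors w with f w << kap w or f w >> kap w.

    Everything rests on one comparison principle for families of scalar functions
    ([comparison]).  Dispersal being a bounded operator, no regularity in space
    is needed.  It yields invariance of the order interval
    ([solution_invariant]) and the two barriers below.

    Upper barriers.  Constants are supersolutions for dispersal.  If
    f w << kap w, subhomogeneity makes s(t) w an upper barrier for every s
    decreasing exponentially to 1, once the dilution rate is close to kap
    ([solution_upper]).  When the spectral bound of A is nonpositive, the Perron
    vector of A gives arbitrarily small such w ([small_supersolution]), hence
    attraction to 0; stability follows since solutions grow at most exponentially
    up to the time where the barrier becomes valid.

    Lower barriers.  Constants are not subsolutions, because mass leaks out of the
    domain.  They are replaced by chi(y) w with a bump chi that the concentrated
    kernel lowers by at most a factor 1 - eta ([barrier]).  At the edge of its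
    support such an inequality is delicate: it holds because the kernel is
    centred, so that the linear part of chi is preserved, and because its second
    moment is nondegenerate, so that the convexity of chi near the edge gives a
    gain.  If f w >> kap w, then s(t) chi(y) w with s increasing to 1 is a lower
    barrier ([solution_lower]).  To place a solution above a small multiple of
    chi w at some time, positivity has to spread from the datum to all points,
    by connectedness of the domain, and to all components, by irreducibility
    ([solution_positive]); convexity enters here, as it makes the boundary null.

    When the spectral bound of A is positive there is a unique positive
    equilibrium ([equilibrium_exists], [equilibrium_unique]), and vectors w with
    f w << kap w and with f w >> kap w exist arbitrarily close to it
    ([strict_super_near], [strict_sub_near]); the barriers squeeze solutions
    locally uniformly to the equilibrium ([persistence_cvg]). *)

(** * Cooperative irreducible matrices *)

Section CooperativeMatrices.
Context (R : realType) (m : nat).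
Implicit Types (A B : 'M[R]_m) (x y : 'rV[R]_m) (I : {set 'I_m}).

(** Row vectors stand for points of R^m, so this is the product of A with the
    column of x. *)
Definition act A x : 'rV[R]_m := \row_i \sum_j A i j * x 0 j.

Lemma actE A x i : act A x 0 i = \sum_j A i j * x 0 j.
Proof. by rewrite mxE. Qed.

Lemma actD A x y : act A (x + y) = act A x + act A y.
Proof.
apply/rowP => i; rewrite !mxE -big_split; apply: eq_bigr => j _.
by rewrite mxE mulrDr.
Qed.

Lemma actZ A (c : R) x : act A (c *: x) = c *: act A x.
Proof.
apply/rowP => i; rewrite !mxE mulr_sumr; apply: eq_bigr => j _.
by rewrite mxE mulrCA.
Qed.

Lemma act_shift A (c : R) x : act (A + c%:M) x = act A x + c *: x.
Proof.
apply/rowP => i; rewrite !mxE (bigD1 i)//= [in RHS](bigD1 i)//= !mxE eqxx mulr1n.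
rewrite mulrDl -!addrA; congr (_ + _); rewrite addrC; congr (_ + _).
by apply: eq_bigr => j ji; rewrite !mxE eq_sym (negbTE ji) addr0.
Qed.

Lemma cooperative_shift A (c : R) : cooperative A -> cooperative (A + c%:M).
Proof. by move=> cA i j ij; rewrite !mxE (negbTE ij) addr0 cA. Qed.

Lemma irreducible_shift A (c : R) :
  irreducible_mx A -> irreducible_mx (A + c%:M).
Proof.
move=> iA S S0 S1; have [i [j [iS jS Aij]]] := iA S S0 S1; exists i, j.
split=> //; rewrite !mxE; suff /negbTE-> : i != j by rewrite addr0.
by apply: contraNneq jS => <-.
Qed.

Lemma irreducible_entry A I : cooperative A -> irreducible_mx A ->
  I != finset.set0 -> I != [set: 'I_m]%SET ->
  exists i j, [/\ i \notin I, j \in I & 0 < A i j].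
Proof.
move=> cA iA I0 I1; have [||i [j [iI jI Aij]]] := iA (~: I)%SET.
- by rewrite -finset.setCT; apply: contra I1 => /eqP/finset.setC_inj ->.
- by rewrite -finset.setC0; apply: contra I0 => /eqP/finset.setC_inj ->.
rewrite !inE negbK in iI jI; exists i, j; split => //.
rewrite lt_neqAle eq_sym Aij cA//; by apply: contraNneq iI => ->.
Qed.

(** Irreducibility propagates positivity: a row i outside I sees some j in I
    through A i j > 0, so a large enough multiple of the j-th basis vector makes
    the i-th entry positive, while cooperativity keeps the entries already
    gained.  Induction on the complement of I treats all rows outside I. *)
Lemma positive_off A I : cooperative A -> irreducible_mx A ->
  I != finset.set0 -> exists2 x, vll 0 x & forall i, i \notin I -> 0 < act A x 0 i.
Proof.
move=> cA iA; move: {2}(#|~: I|)%N (leqnn #|~: I|) => k.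
elim: k I => [|k IH] I Ik I0.
  exists (const_mx 1) => [i|i iI]; first by rewrite !mxE.
  move: Ik; rewrite leqn0 => /eqP/cards0_eq/setP/(_ i).
  by rewrite !inE iI.
have [->|I1] := eqVneq I [set: 'I_m]%SET.
  by exists (const_mx 1) => [i|i]; rewrite ?mxE ?inE.
have [i [j [iI jI Aij]]] := irreducible_entry cA iA I0 I1.
have [||x x0 xI] := IH (i |: I)%SET.
- rewrite -ltnS; apply: leq_trans Ik; apply: proper_card.
  rewrite fintype.properE finset.setCS finset.subsetUr /=.
  by rewrite finset.setCS finset.subUset finset.sub1set (negbTE iI).
- by apply/set0Pn; exists i; rewrite !inE eqxx.
pose K := (`|act A x 0 i| + 1) / A i j.
have K0 : 0 < K by rewrite divr_gt0// ltr_wpDl.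
exists (x + K *: delta_mx 0 j) => [l|l lI].
  apply: lt_le_trans (x0 l) _.
  by rewrite !mxE lerDl mulr_ge0 ?(ltW K0)// ler0n.
have aE : act A (x + K *: delta_mx 0 j) 0 l = act A x 0 l + K * A l j.
  rewrite actD actZ !mxE; congr (_ + _ * _).
  rewrite (bigD1 j)//= mxE !eqxx mulr1 big1 ?addr0// => p pj.
  by rewrite mxE (negbTE pj) andbF mulr0.
rewrite aE; have [->|li] := eqVneq l i.
  rewrite /K mulfVK ?gt_eqF// addrA addrC.
  have := ler_norm (- act A x 0 i); rewrite normrN => h.
  by rewrite ltr_pwDl//; lra.
apply: ltr_wpDr; last by apply: xI; rewrite !inE negb_or li lI.
by rewrite mulr_ge0 ?(ltW K0)//; apply: cA; apply: contraNneq lI => ->.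
Qed.

(** Adding a small multiple of the vector given by [positive_off] makes positive
    the entries of A x that vanish, without losing those that were positive. *)
Lemma strict_perturbation A x : cooperative A -> irreducible_mx A ->
  vle 0 x -> vlt 0 (act A x) -> exists2 y, vll 0 y & vll 0 (act A y).
Proof.
move=> cA iA x0 [Ax0 Axn].
have [|y y0 yI] := @positive_off A [set i | 0 < act A x 0 i] cA iA.
  apply/set0Pn; apply: contra_notP Axn => /forallNP h; apply/rowP => i.
  apply/eqP; rewrite eq_le Ax0 leNgt; apply/negP => hi; apply: (h i).
  by rewrite !inE; move: hi; rewrite !mxE.
pose e := \big[Order.min/1]_(i | 0 < act A x 0 i)
  (act A x 0 i / (1 + `|act A y 0 i|)).
have e0 : 0 < e.
  rewrite /e; elim/big_ind: _ => // [a b a0 b0|i hi]; first by rewrite lt_min a0.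
  by rewrite divr_gt0// ltr_pwDl.
exists (x + e *: y) => i.
  by rewrite !mxE; have := x0 i; have := y0 i; rewrite !mxE => h1 h2;
     rewrite ltr_wpDl// mulr_gt0.
rewrite actD actZ; rewrite [X in _ < X]mxE [X in _ < _ + X]mxE mxE.
have [hi|hi] := boolP (0 < act A x 0 i); last first.
  have := Ax0 i; rewrite mxE => h; rewrite ltr_wpDl// mulr_gt0// yI//.
  by rewrite inE.
have le : e <= act A x 0 i / (1 + `|act A y 0 i|) by apply: bigmin_le_cond.
have := ler_norm (- act A y 0 i); rewrite normrN => h.
have h2 : 0 < 1 + `|act A y 0 i| by rewrite ltr_pwDl.
move: le; rewrite ler_pdivlMr// => le.
have : e * - act A y 0 i <= e * `|act A y 0 i| by rewrite ler_pM2l.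
by nra.
Qed.

End CooperativeMatrices.

(** * The Perron-Frobenius theorem *)

Lemma cvg_sumr (R : numFieldType) (V : normedModType R) (I T : Type)
    (r : seq I) (P : pred I) (F : set_system T) (FF : Filter F)
    (h : I -> T -> V) (l : I -> V) :
  (forall i, P i -> h i x @[x --> F] --> l i) ->
  \sum_(i <- r | P i) h i x @[x --> F] --> \sum_(i <- r | P i) l i.
Proof. by move=> hl; apply: cvg_big => //; exact: add_continuous. Qed.

Section PerronFrobenius.
Context (R : realType) (m : nat).
Implicit Types (A B : 'M[R]_m) (x y : 'rV[R]_m) (I : {set 'I_m}).

Lemma continuous_coord i : continuous (fun x => x 0 i).
Proof. exact: coord_continuous. Qed.

(** Collatz and Wielandt: the largest r such that r x <= A x for some x in the
    standard simplex is attained, by compactness.  If the inequality were not an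
    equality, [strict_perturbation] would produce a vector allowing a larger r.
    Positivity of the maximizer then follows from irreducibility. *)
Lemma perron_vector A : (0 < m)%N -> cooperative A -> irreducible_mx A ->
  exists (r : R) p, vll 0 p /\ act A p = r *: p.
Proof.
move=> m0 cA iA; pose c : R := 1 + \sum_i \sum_j `|A i j|.
pose box : set 'rV[R]_m := [set x | forall i, `[0, 1]%classic (x 0 i)].
have cbox : compact box.
  apply: (@rV_compact R m (fun=> `[0, 1]%classic)) => i.
  exact: segment_compact.
pose K : set (R * 'rV[R]_m) := (`[- c, c] `*` box) `&`
  ([set q : R * 'rV[R]_m | \sum_i q.2 0 i = 1] `&`
   (\bigcap_(i in [set: 'I_m]) [set q : R * 'rV[R]_m | 0 <= act A q.2 0 i - q.1 * q.2 0 i])).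
have ccoord i : continuous (fun q : R * 'rV[R]_m => q.2 0 i).
  move=> q; apply: (@cvg_comp _ _ _ snd (fun x : 'rV[R]_m => x 0 i) _
    (nbhs q.2)); first exact: cvg_snd.
  exact: continuous_coord.
have cK : compact K.
  apply: (@subclosed_compact _ _ (`[- c, c] `*` box)); last 2 first.
  - by apply: compact_setX => //; exact: segment_compact.
  - by move=> q [].
  apply: closedI.
    apply: compact_closed; first exact: norm_hausdorff.
    by apply: compact_setX => //; exact: segment_compact.
  apply: closedI.
    apply: (@preimage_closed _ _ (fun q : R * 'rV[R]_m => \sum_i q.2 0 i)
       [set x | x = 1]); last exact: closed_eq.
    move=> q _; apply: (@cvg_sumr _ R^o _ _ _ _ _ _
      (fun i (z : R * 'rV[R]_m) => z.2 0 i) (fun i => q.2 0 i)) => i _.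
    exact: ccoord.
  apply: closed_bigI => i _.
  apply: (@preimage_closed _ _ (fun q : R * 'rV[R]_m =>
    act A q.2 0 i - q.1 * q.2 0 i) [set x | 0 <= x]); last exact: closed_ge.
  move=> q _; apply: cvgB; last by apply: cvgM; [exact: cvg_fst|exact: ccoord].
  rewrite (_ : (fun _ => _) = (fun q : R * 'rV[R]_m => \sum_j A i j * q.2 0 j)).
    rewrite actE; apply: (@cvg_sumr _ R^o _ _ _ _ _ _
      (fun j (z : R * 'rV[R]_m) => A i j * z.2 0 j)
      (fun j => A i j * q.2 0 j)) => j _.
    by apply: cvgM; [exact: cvg_cst|exact: ccoord].
  by apply/funext => z; rewrite actE.
have bnd l x : box x -> \sum_i x 0 i = 1 ->
    (forall i, 0 <= act A x 0 i - l * x 0 i) -> l <= c.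
  move=> bx sx h; rewrite -[l]mulr1 -sx mulr_sumr.
  apply: (@le_trans _ _ (\sum_i \sum_j `|A i j|)); last by rewrite lerDr.
  apply: ler_sum => i _; have := h i; rewrite subr_ge0 => /le_trans; apply.
  rewrite actE; apply: ler_sum => j _.
  have := bx j; rewrite /= in_itv/= => /andP[x0 x1].
  apply: le_trans (ler_norm _) _; rewrite normrM (ger0_norm x0).
  by rewrite -[leRHS]mulr1 ler_wpM2l.
have K0 : K !=set0.
  pose u : 'rV[R]_m := const_mx (m%:R^-1).
  have uE i : u 0 i = m%:R^-1 by rewrite mxE.
  have mR : 0 < m%:R :> R by rewrite ltr0n.
  have c0 : 0 < c.
    by rewrite ltr_pwDl// sumr_ge0// => i _; rewrite sumr_ge0.
  exists (- c, u); split; [|split] => /=.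
  - split=> [/=|i]; first by rewrite in_itv/= lexx/=; lra.
    by rewrite uE /= in_itv/= invr_ge0 (ltW mR)/= invf_le1// ler1n.
  - rewrite (eq_bigr (fun=> m%:R^-1)) => [|i _]; last exact: uE.
    by rewrite sumr_const card_ord -[X in X = _]mulr_natr mulVf// gt_eqF.
  move=> i _ /=; rewrite uE actE.
  under eq_bigr do rewrite uE.
  rewrite -mulr_suml mulNr opprK -mulrDl mulr_ge0// ?invr_ge0 ?(ltW mR)//.
  suff : \sum_j `|A i j| <= c.
    have : - \sum_j A i j <= \sum_j `|A i j|.
      by rewrite -sumrN; apply: ler_sum => j _; rewrite -normrN ler_norm.
    by lra.
  rewrite /c [X in _ <= 1 + X](bigD1 i)//= addrCA lerDl addr_ge0// sumr_ge0// => l _.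
  by rewrite sumr_ge0.
have [[r x]] := @compact_EVT_max _ R (fun q => q.1) K K0 cK
   (continuous_subspaceT (fun q => @cvg_fst _ _ _ _ _)).
rewrite inE => -[[/= rc bx] [/= sx hx]] rmax.
have x0 : vle 0 x.
  by move=> i; have := bx i; rewrite /= in_itv/= mxE => /andP[].
have xn0 : [set i | 0 < x 0 i]%SET != finset.set0.
  apply/set0Pn; apply/not_existsP => h.
  move: sx; rewrite big1 => [/esym/eqP|i _]; first by rewrite oner_eq0.
  have := x0 i; rewrite mxE => xi0.
  apply/eqP; rewrite eq_le xi0 andbT leNgt; apply/negP => hi.
  by apply: (h i); rewrite inE.
have hAx : act (A + (- r)%:M) x = 0.
  apply: contrapT => hn.
  have [||||y y0 Ay0] := @strict_perturbation _ _ (A + (- r)%:M) x.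
  - exact: cooperative_shift.
  - exact: irreducible_shift.
  - exact: x0.
  - split=> [i|]; last by move=> /esym.
    by rewrite act_shift !mxE -actE mulNr; have := hx i Logic.I.
  pose s := \sum_i y 0 i.
  have ys i : y 0 i <= s.
    rewrite /s (bigD1 i)//= lerDl sumr_ge0// => j _.
    by have := y0 j; rewrite mxE => /ltW.
  have s0 : 0 < s.
    by apply: lt_le_trans (ys (Ordinal m0)); have := y0 (Ordinal m0); rewrite mxE.
  pose e := \big[Order.min/1]_i (act (A + (- r)%:M) y 0 i / s).
  have e0 : 0 < e.
    rewrite /e; elim/big_ind: _ => // [a b a0 b0|i _]; first by rewrite lt_min a0.
    by rewrite divr_gt0//; have := Ay0 i; rewrite [X in X < _]mxE.
  pose z := s^-1 *: y.
  have bz : box z.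
    move=> i; rewrite /= in_itv/= !mxE; have := y0 i; rewrite mxE => yi.
    by rewrite mulr_ge0 ?invr_ge0 ?(ltW s0) ?(ltW yi)//= ler_pdivrMl// mulr1.
  have sz : \sum_i z 0 i = 1.
    under eq_bigr do rewrite mxE.
    by rewrite -mulr_sumr mulVf// gt_eqF.
  have hz i : 0 <= act A z 0 i - (r + e) * z 0 i.
    rewrite actZ !mxE -actE mulrCA -mulrBr mulr_ge0// ?invr_ge0 ?(ltW s0)//.
    have : e <= act (A + (- r)%:M) y 0 i / s by apply: bigmin_le_cond.
    rewrite ler_pdivlMr// act_shift [X in _ <= X]mxE [X in _ <= _ + X]mxE => h.
    have : e * y 0 i <= e * s by rewrite ler_pM2l.
    by lra.
  have := rmax (r + e, z); rewrite inE /= => /(_ _)h.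
  suff : r + e <= r by lra.
  apply: h.
  split; [split=> //=|split=> //]; last by move=> i _; exact: hz.
  have := bnd _ _ bz sz hz; move: rc; rewrite /= !in_itv/= => /andP[? ?] ->.
  by rewrite andbT; lra.
have Ax : act A x = r *: x.
  by move/eqP: hAx; rewrite act_shift scaleNr subr_eq0 => /eqP.
exists r, x; split=> // i; rewrite mxE.
have [I1|I1] := eqVneq [set i | 0 < x 0 i]%SET [set: 'I_m]%SET.
  by have := finset.in_setT i; rewrite -I1 inE.
have [k [j [kI jI Akj]]] := irreducible_entry cA iA xn0 I1.
rewrite !inE in kI jI.
have xk : x 0 k = 0.
  by apply/eqP; rewrite eq_le leNgt kI/=; have := x0 k; rewrite mxE.
have : act A x 0 k = 0 by rewrite Ax mxE xk mulr0.
rewrite actE (bigD1 j)//= => /eqP; rewrite gt_eqF// ltr_pwDl ?mulr_gt0//.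
rewrite sumr_ge0// => l _; have [->|lk] := eqVneq l k; first by rewrite xk mulr0.
by rewrite mulr_ge0// ?cA// 1?eq_sym//; have := x0 l; rewrite mxE.
Qed.

(** Adding a multiple of the identity makes A entrywise nonnegative; pairing the
    moduli of a left eigenvector with the positive right eigenvector p gives
    |z + c| <= r + c. *)
Lemma eigenvalue_Re_le A (r : R) p (z : complex R) : cooperative A ->
  vll 0 p -> act A p = r *: p ->
  eigenvalue (map_mx (real_complex R) A) z -> complex.Re z <= r.
Proof.
move=> cA p0 Ap /eigenvalueP[x xA xn0].
pose c : R := \sum_i \sum_j `|A i j|.
have B0 i j : 0 <= (A + c%:M) i j.
  rewrite !mxE; have [->|ij] := eqVneq i j; last first.
    by rewrite addr0 cA.
  have : `|A j j| <= c.
    rewrite /c (bigD1 j)//= (bigD1 j)//= -addrA lerDl addr_ge0// sumr_ge0//.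
    by move=> l _; rewrite sumr_ge0.
  by have := ler_norm (- A j j); rewrite normrN mulr1n; lra.
have Bp j : \sum_i (A + c%:M) j i * p 0 i = (r + c) * p 0 j.
  by rewrite -actE act_shift Ap -scalerDl mxE.
have pC i : 0 < (p 0 i)%:C%C :> complex R.
  by have := p0 i; rewrite mxE -[_ < (_)%:C%C]/((0:R)%:C%C < _) ltcR.
pose s := \sum_j `|x 0 j| * (p 0 j)%:C%C.
have s0 : 0 < s.
  have [j xj] : exists j, x 0 j != 0.
    apply: contrapT => /forallNP h; move/negP: xn0; apply; apply/eqP/rowP => j.
    by have /negP := h j; rewrite negbK => /eqP ->; rewrite mxE.
  rewrite /s (bigD1 j)//= ltr_pwDl ?mulr_gt0 ?normr_gt0// sumr_ge0// => l _.
  by rewrite mulr_ge0// ltW.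
have h : `|z + c%:C%C| * s <= (r + c)%:C%C * s.
  rewrite /s !mulr_sumr.
  apply: (@le_trans _ _ (\sum_j \sum_i (`|x 0 i| * ((A + c%:M) i j)%:C%C) * (p 0 j)%:C%C)).
    apply: ler_sum => j _; rewrite -mulr_suml mulrA ler_wpM2r ?(ltW (pC j))//.
    rewrite -normrM; have -> : (z + c%:C%C) * x 0 j =
        \sum_i x 0 i * ((A + c%:M) i j)%:C%C.
      have /rowP/(_ j) := xA; rewrite !mxE mulrDl => <-.
      under [RHS]eq_bigr do rewrite !mxE rmorphD mulrDr.
      rewrite big_split/=; congr (_ + _).
        by apply: eq_bigr => i _; rewrite !mxE.
      rewrite (bigD1 j)//= eqxx mulr1n mulrC big1 ?addr0// => i ij.
      by rewrite (negbTE ij) mulr0n rmorph0 mulr0.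
    apply: le_trans; first exact: ler_norm_sum.
    apply: ler_sum => i _.
    by rewrite normrM ler_wpM2l// ger0_norm// -[0]/((0:R)%:C%C) lecR.
  rewrite exchange_big/= le_eqVlt; apply/orP; left; apply/eqP/eq_bigr => i _.
  under eq_bigr do rewrite -mulrA.
  rewrite -mulr_sumr mulrCA; congr (_ * _); rewrite -rmorphM -Bp [RHS]rmorph_sum.
  by apply: eq_bigr => j _; rewrite rmorphM.
rewrite ler_pM2r// in h; have := le_trans (normc_ge_Re _) h.
rewrite lecR => /(le_trans (ler_norm _)).
by rewrite raddfD/= lerD2r.
Qed.

Lemma perron_spectral_bound A (r : R) p : (0 < m)%N -> cooperative A ->
  vll 0 p -> act A p = r *: p -> spectral_bound A = r.
Proof.
move=> m0 cA p0 Ap.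
have ub : ubound [set complex.Re z | z in
    [set z : complex.complex R | eigenvalue (map_mx (real_complex R) A) z]] r.
  by move=> _ [z /= zA <-]; exact: eigenvalue_Re_le zA.
have mem : [set complex.Re z | z in
    [set z : complex.complex R | eigenvalue (map_mx (real_complex R) A) z]] r.
  exists (r%:C%C) => //=; rewrite eigenvalue_root_char -map_char_poly fmorph_root.
  rewrite -eigenvalue_root_char /eigenvalue /eigenspace kermx_eq0 row_free_unit.
  apply/negP => hu; have : (A - r%:M) *m p^T = 0.
    have /rowP hp := Ap; apply/matrixP => i j; rewrite ord1 mulmxBl mul_scalar_mx.
    have := hp i; rewrite actE => e; rewrite !mxE -[p 0 i]/(p 0 i).
    apply/eqP; rewrite subr_eq0; apply/eqP.
    by rewrite mxE in e; rewrite -e; apply: eq_bigr => l _; rewrite !mxE.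
  move=> /(congr1 (mulmx (invmx (A - r%:M)))); rewrite mulKmx// mulmx0.
  move=> /matrixP/(_ (Ordinal m0) 0); rewrite !mxE => e.
  by have := p0 (Ordinal m0); rewrite e mxE ltxx.
apply/eqP; rewrite eq_le; apply/andP; split.
  by apply: ge_sup => //; exists r.
by apply: ub_le_sup => //; exists r.
Qed.

(** The only spectral information used later: the spectral bound is an
    eigenvalue with a strictly positive eigenvector. *)
Lemma perron_frobenius A : (0 < m)%N -> cooperative A -> irreducible_mx A ->
  exists2 p, vll 0 p & act A p = spectral_bound A *: p.
Proof.
move=> m0 cA iA; have [r [p [p0 Ap]]] := perron_vector m0 cA iA.
by exists p => //; rewrite (perron_spectral_bound m0 cA p0 Ap).
Qed.

End PerronFrobenius.

(** * Vector order and calculus along segments *)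

Section VectorOrderLemmas.
Context (R : realType) (m : nat).
Implicit Types (a b v w : 'rV[R]_m).

Lemma vll0P a : vll 0 a <-> forall i, 0 < a 0 i.
Proof. by split=> h i; have := h i; rewrite mxE. Qed.

Lemma vle0P a : vle 0 a <-> forall i, 0 <= a 0 i.
Proof. by split=> h i; have := h i; rewrite mxE. Qed.

Lemma order_intervalP v w :
  order_interval v w <-> forall i, 0 <= w 0 i <= v 0 i.
Proof.
split=> [[/vle0P w0 wv] i|h]; first by rewrite w0 wv.
by split; [apply/vle0P => i|move=> i]; have /andP[] := h i.
Qed.

Lemma coord_le_norm a i : `|a 0 i| <= `|a|.
Proof.
rewrite [leRHS]/Num.norm/= mx_normrE; apply: (le_bigmax _ (fun ij => `|a ij.1 ij.2|) (0, i)).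
Qed.

Lemma norm_le_coord a (e : R) : 0 <= e -> (forall i, `|a 0 i| <= e) -> `|a| <= e.
Proof.
move=> e0 h; rewrite [leLHS]/Num.norm/= mx_normrE; apply/bigmax_leP; split=> // -[i j] _.
by rewrite ord1; exact: h.
Qed.

Lemma norm_lt_coord a (e : R) : 0 < e -> (forall i, `|a 0 i| < e) -> `|a| < e.
Proof.
move=> e0 h; rewrite [ltLHS]/Num.norm/= mx_normrE; apply/bigmax_ltP; split=> // -[i j] _.
by rewrite ord1; exact: h.
Qed.

Lemma vlt_exists a b : vlt a b -> exists i, a 0 i < b 0 i.
Proof.
move=> [ab nab]; apply: contra_notP nab => /forallNP h; apply/rowP => i.
by apply/eqP; rewrite eq_le ab leNgt; apply/negP/h.
Qed.

End VectorOrderLemmas.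

Section SegmentCalculus.
Context (R : realType) (m : nat).
Variable f : 'rV[R]_m -> 'rV[R]_m.
Hypothesis fC1 : C1 f.
Implicit Types (a b c w x : 'rV[R]_m).

Lemma differentiable_coord_fun w i : differentiable (fun x => f x 0 i) w.
Proof.
apply: (@differentiable_comp _ _ _ _ f (fun z : 'rV[R]_m => z 0 i)).
  exact: fC1.1.
exact: differentiable_coord.
Qed.

Lemma is_derive_line w c (i : 'I_m) (s : R) :
  is_derive s (1 : R) (fun s => f (w + s *: c) 0 i) (act (Df f (w + s *: c)) c 0 i).
Proof.
have df := differentiable_coord_fun (w + s *: c) i.
have E : (fun h : R => h^-1 *: (((fun s => f (w + s *: c) 0 i) \o shift s) (h *: (1 : R))
     - f (w + s *: c) 0 i)) =
   (fun h => h^-1 *: (((fun x => f x 0 i) \o shift (w + s *: c)) (h *: c)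
     - f (w + s *: c) 0 i)).
  apply/funext => h /=; congr (_ *: (f _ 0 i - _)).
  by rewrite [h *: (1 : R)]mulr1 scalerDl addrCA.
have dE z : 'D_c (fun x => f x 0 i) z = act (Df f z) c 0 i.
  have dz := differentiable_coord_fun z i.
  rewrite deriveE// {1}(row_sum_delta c) linear_sum actE; apply: eq_bigr => j _.
  by rewrite linearZ/= mxE deriveE// mulrC.
split.
  by rewrite /derivable E; exact: diff_derivable.
by rewrite /derive E; exact: dE.
Qed.

Lemma mean_value a b i : exists2 s : R, 0 < s < 1 &
  f b 0 i - f a 0 i = act (Df f (a + s *: (b - a))) (b - a) 0 i.
Proof.
have [||s s01] := @MVT R (fun s => f (a + s *: (b - a)) 0 i)
   (fun s => act (Df f (a + s *: (b - a))) (b - a) 0 i) 0 1 ltr01.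
- by move=> x _; exact: is_derive_line.
- apply: continuous_subspaceT => x.
  apply/differentiable_continuous/derivable1_diffP.
  by have [] := is_derive_line a (b - a) i x.
rewrite scale1r scale0r addr0 subrKC subr0 mulr1 => ->.
by exists s => //; move: s01; rewrite in_itv.
Qed.

Lemma continuous_Df_entry i j : continuous (fun w => Df f w i j).
Proof.
move=> w; apply: (@cvg_comp _ _ _ (Df f) (fun M : 'M[R]_m => M i j) _
  (nbhs (Df f w))); first exact: fC1.2.
exact: coord_continuous.
Qed.

Lemma bounded_closed_ball_compact (B : R) :
  compact [set w : 'rV[R]_m | `|w| <= B].
Proof.
apply: bounded_closed_compact.
  exists B; split; first exact: num_real.
  by move=> x Bx w /= wB; apply: le_trans wB (ltW Bx).
apply: (@preimage_closed _ _ (fun w : 'rV[R]_m => `|w|) [set x | x <= B]).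
  by move=> x _; exact: norm_continuous.
exact: closed_le.
Qed.

Lemma bounded_Df (B : R) : exists2 L : R, 0 < L &
  forall w, `|w| <= B -> forall i j, `|Df f w i j| <= L.
Proof.
have h i j : exists L : R, forall w, `|w| <= B -> `|Df f w i j| <= L.
  have [B0|B0] := leP 0 B; last first.
    by exists 0 => w wB; have := le_trans (normr_ge0 w) wB; lra.
  have [||w _ hw] := @compact_EVT_max _ R (fun w => `|Df f w i j|) _ _
    (@bounded_closed_ball_compact B).
  - by exists 0; rewrite /= normr0.
  - apply: continuous_subspaceT => w.
    apply: (@cvg_comp _ _ _ (fun w => Df f w i j) (fun x : R => `|x|)).
      exact: continuous_Df_entry.
    exact: norm_continuous.
  by exists `|Df f w i j| => x xB; apply: hw; rewrite inE.
have /choice[L hL] : forall q : 'I_m * 'I_m, exists L : R,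
    forall w, `|w| <= B -> `|Df f w q.1 q.2| <= L by move=> q; exact: h.
exists (1 + \sum_q `|L q|); first by rewrite ltr_pwDl// sumr_ge0.
move=> w wB i j; apply: le_trans (hL (i, j) w wB) _.
rewrite (bigD1 (i, j))//=; have := ler_norm (L (i, j)).
suff : 0 <= \sum_(q | q != (i, j)) `|L q| by lra.
by rewrite sumr_ge0.
Qed.

Lemma Lipschitz_ball (B : R) : exists2 L : R, 0 < L &
  forall a b, `|a| <= B -> `|b| <= B -> forall i, `|f a 0 i - f b 0 i| <= L * `|a - b|.
Proof.
have [L L0 hL] := bounded_Df B; exists (m.+1%:R * L).
  by rewrite mulr_gt0// ltr0n.
move=> a b aB bB i; have [s /andP[s0 s1] ->] := mean_value b a i.
set w := _ + _; have wB : `|w| <= B.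
  have -> : w = (1 - s) *: b + s *: a.
    by apply/rowP => l; rewrite !mxE; ring.
  apply: le_trans (ler_normD _ _) _; rewrite !normrZ !gtr0_norm ?subr_gt0//.
  have -> : B = (1 - s) * B + s * B by ring.
  by rewrite lerD// ler_pM2l// subr_gt0.
rewrite actE; apply: le_trans (ler_norm_sum _ _ _) _.
apply: (@le_trans _ _ (\sum_(j < m) L * `|a - b|)).
  apply: ler_sum => j _; rewrite normrM ler_pM// ?hL//.
  exact: coord_le_norm.
rewrite sumr_const card_ord -[leLHS]mulr_natl mulrA ler_wpM2r//.
by rewrite ler_pM2r// ler_nat.
Qed.

Lemma continuous_f : continuous f.
Proof. by move=> w; apply/differentiable_continuous/fC1.1. Qed.

End SegmentCalculus.

(** * Cooperative subhomogeneous reactions *)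

Section Reaction.
Context (R : realType) (m : nat).
Variables (v : 'rV[R]_m) (f : 'rV[R]_m -> 'rV[R]_m).
Hypothesis v0 : vll 0 v.
Hypothesis fC1 : C1 f.
Hypothesis fcoop : forall w, order_interval v w ->
  cooperative (Df f w) /\ irreducible_mx (Df f w).
Hypothesis f0 : f 0 = 0.
Hypothesis fsub : forall w (alpha : R), order_interval v w -> vll 0 w ->
  0 < alpha -> alpha < 1 -> vlt (alpha *: f w) (f (alpha *: w)).
Implicit Types (a b w x : 'rV[R]_m).
Local Notation M := (order_interval v).

Lemma order_interval_segment a b (s : R) : M a -> M b -> 0 <= s <= 1 ->
  M (a + s *: (b - a)).
Proof.
move=> /order_intervalP aM /order_intervalP bM /andP[s0 s1].
apply/order_intervalP => i; rewrite !mxE.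
have /andP[a0 a1] := aM i; have /andP[b0 b1] := bM i.
by apply/andP; split; nra.
Qed.

Lemma order_interval_scale w (s : R) : M w -> 0 <= s <= 1 -> M (s *: w).
Proof.
move=> /order_intervalP wM /andP[s0 s1]; apply/order_intervalP => i.
by rewrite mxE; have /andP[w0 wv] := wM i; apply/andP; split; nra.
Qed.

Lemma order_interval0 : M 0.
Proof.
by apply/order_intervalP => i; rewrite mxE lexx; have /vll0P/(_ i)/ltW := v0.
Qed.

Lemma norm_order_interval w : M w -> `|w| <= `|v|.
Proof.
move=> /order_intervalP wM; apply: norm_le_coord => // i.
have /andP[w0 wv] := wM i; rewrite ger0_norm//; apply: (le_trans wv).
by apply: le_trans (ler_norm _) (coord_le_norm v i).
Qed.

(** The comparison property of cooperative systems (Kamke's condition): along the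
    segment from a to b only off-diagonal entries of the Jacobian contribute to
    the i-th component. *)
Lemma quasi_monotone a b i : M a -> M b -> vle a b -> a 0 i = b 0 i ->
  f a 0 i <= f b 0 i.
Proof.
move=> aM bM ab abi; rewrite -subr_ge0.
have [s /andP[s0 s1] ->] := mean_value fC1 a b i.
have wM := @order_interval_segment a b s aM bM ltac:(by rewrite !ltW).
have [cw _] := fcoop wM.
rewrite actE sumr_ge0// => j _; have [<-|ij] := eqVneq i j.
  by rewrite !mxE abi subrr mulr0.
by rewrite mulr_ge0 ?cw// !mxE subr_ge0.
Qed.

(** Subhomogeneity is assumed only at strictly positive vectors; it extends to
    the whole order interval by moving w towards v and letting the displacement
    tend to 0. *)
Lemma subhomogeneous_le w (s : R) : M w -> 0 <= s <= 1 ->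
  vle (s *: f w) (f (s *: w)).
Proof.
move=> wM /andP[s0 s1] i.
have [->|s0'] := eqVneq s 0; first by rewrite !scale0r f0 mxE.
have [->|s1'] := eqVneq s 1; first by rewrite !scale1r.
have {s0 s0'}s0 : 0 < s by rewrite lt_neqAle eq_sym s0'.
have {s1 s1'}s1 : s < 1 by rewrite lt_neqAle s1'.
pose h (e : R) := f (s *: (w + e *: (v - w))) 0 i - s * f (w + e *: (v - w)) 0 i.
suff : 0 <= h 0 by rewrite /h scale0r addr0 subr_ge0 mxE.
have ch : continuous h.
  move=> e; apply: cvgB; last first.
    apply: cvgM; first exact: cvg_cst.
    apply: differentiable_continuous; apply/derivable1_diffP.
    by have [] := is_derive_line fC1 w (v - w) i e.
  rewrite (_ : (fun _ => _) = fun e => f (s *: w + e *: (s *: (v - w))) 0 i).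
    have -> : f (s *: (w + e *: (v - w))) 0 i = f (s *: w + e *: (s *: (v - w))) 0 i.
      by rewrite scalerDr !scalerA (mulrC s).
    apply: differentiable_continuous; apply/derivable1_diffP.
    by have [] := is_derive_line fC1 (s *: w) (s *: (v - w)) i e.
  by apply/funext => x; rewrite scalerDr !scalerA (mulrC s).
have hpos (e : R) : 0 < e <= 1 -> 0 <= h e.
  move=> /andP[e0 e1]; rewrite /h subr_ge0.
  have vM : M v by apply/order_intervalP => j; rewrite lexx (ltW ((vll0P _).1 v0 j)).
  have wM' := @order_interval_segment w v e wM vM ltac:(by rewrite ltW).
  have w0 : vll 0 (w + e *: (v - w)).
    apply/vll0P => j; rewrite !mxE; have /vll0P/(_ j) := v0.
    by have /order_intervalP/(_ j)/andP[? ?] := wM; nra.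
  by have [+ _] := fsub wM' w0 s0 s1; move=> /(_ i); rewrite mxE.
have cvh : h e @[e --> 0^'+] --> h 0 by apply: cvg_at_right_filter; exact: ch.
apply: (cvgr_to_ge cvh); near=> e.
by apply: hpos; apply/andP; split; near: e; [exact: nbhs_right_gt|exact: nbhs_right_le].
Unshelve. all: by end_near. Qed.

(** Quantitative quasi-monotonicity at the origin.  The coupling constant kappa
    comes from the entries of Df near 0, reached by shrinking w to s w; the
    monotone function w |-> f_i w + C w_i carries the estimate back to w.  It is
    what lets positivity pass from one component to another. *)
Lemma reaction_lower_bound : exists C kappa : R, [/\ 0 <= C, 0 < kappa,
  forall w i, M w -> - C * w 0 i <= f w 0 i &
  forall w i j, M w -> i != j -> 0 < Df f 0 i j ->
    - C * w 0 i + kappa * w 0 j <= f w 0 i].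
Proof.
have [C C0 hC] := bounded_Df fC1 `|v|.
have vM : M v by apply/order_intervalP => j; rewrite lexx (ltW ((vll0P _).1 v0 j)).
have mono a b i : M a -> M b -> vle a b ->
    f a 0 i + C * a 0 i <= f b 0 i + C * b 0 i.
  move=> aM bM ab; rewrite -subr_ge0 opprD addrACA -mulrBr.
  have [s /andP[s0 s1] ->] := mean_value fC1 a b i.
  have wM := @order_interval_segment a b s aM bM ltac:(by rewrite !ltW).
  have [cw _] := fcoop wM.
  have -> : b 0 i - a 0 i = (b - a) 0 i by rewrite !mxE.
  rewrite actE (bigD1 i)//= addrAC -mulrDl addr_ge0//.
    have := hC _ (norm_order_interval wM) i i; rewrite ler_norml => /andP[h _].
    have := ab i; rewrite -subr_ge0 => h2.
    by apply: mulr_ge0; [lra | rewrite !mxE].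
  rewrite sumr_ge0// => j ij.
  by rewrite mulr_ge0 ?cw 1?eq_sym// !mxE subr_ge0.
have lo w i : M w -> - C * w 0 i <= f w 0 i.
  move=> wM; have := mono 0 w i order_interval0 wM wM.1.
  by rewrite f0 !mxE mulr0 addr0; lra.
(* s is chosen so that Df stays within delta of Df f 0 on s times the order
   interval: positive entries of Df f 0 remain at least delta there. *)
pose delta := \big[Order.min/1]_(ij | 0 < Df f 0 ij.1 ij.2) (Df f 0 ij.1 ij.2 / 2).
have delta0 : 0 < delta.
  rewrite /delta; elim/big_ind: _ => // [a b a0 b0|i hi]; first by rewrite lt_min a0.
  by rewrite divr_gt0.
have deltaP i j : 0 < Df f 0 i j -> delta <= Df f 0 i j / 2.
  by move=> h; apply: (@bigmin_le_cond _ _ _ 1 (i, j) (fun ij => 0 < Df f 0 ij.1 ij.2)).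
have [r r0 hr] : exists2 r : R, 0 < r & forall w, `|w| < r -> forall i j,
    0 < Df f 0 i j -> delta <= Df f w i j.
  have : \forall w \near (0 : 'rV[R]_m), `|Df f 0 - Df f w| < delta.
    by have /cvgrPdist_lt/(_ _ delta0) := fC1.2 (0 : 'rV[R]_m).
  move=> /nbhs_ballP[r /= r0 hr]; exists r => // w wr i j hij.
  have /= := hr w; rewrite -ball_normE/= sub0r normrN => /(_ wr).
  move=> /(le_lt_trans _) h; have := deltaP _ _ hij => h2.
  have : `|(Df f 0 - Df f w) i j| < delta.
    apply: h; rewrite [leRHS]/Num.norm/= mx_normrE.
    exact: (le_bigmax _ (fun ij => `|(Df f 0 - Df f w) ij.1 ij.2|) (i, j)).
  by rewrite [X in `|X|]mxE [X in `|_ + X|]mxE ltr_norml => /andP[h3 h4]; lra.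
pose s := Num.min 1 (r / (1 + `|v|) / 2).
have s0 : 0 < s by rewrite lt_min ltr01 !divr_gt0// ltr_pwDl.
have s1 : s <= 1 by rewrite ge_min lexx.
have sr w : M w -> `|s *: w| < r.
  move=> wM; rewrite normrZ gtr0_norm//.
  apply: (@le_lt_trans _ _ (r / (1 + `|v|) / 2 * `|v|)).
    rewrite ler_pM// ?(ltW s0)// ?norm_order_interval//.
    by rewrite ge_min lexx orbT.
  have h : 0 < 1 + `|v| by rewrite ltr_pwDl.
  rewrite mulrAC ltr_pdivrMr// mulrAC ltr_pdivrMr//.
  by have := normr_ge0 v; nra.
exists C, (s * delta); split; [exact: ltW|exact: mulr_gt0|exact: lo|].
move=> w i j wM ij hij.
have sM := @order_interval_scale w s wM ltac:(by rewrite (ltW s0)).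
have := mono (s *: w) w i sM wM; rewrite [X in f _ 0 i + _ * X]mxE.
have /order_intervalP wP := wM.
move=> /(_ _)/= h; have {}h := h ltac:(by move=> l; rewrite mxE;
  have /andP[? ?] := wP l; nra).
have [t /andP[t0 t1]] := mean_value fC1 0 (s *: w) i.
rewrite f0 subr0 add0r [X in _ - X]mxE subr0 => e.
have tM := @order_interval_scale (s *: w) t sM ltac:(by rewrite !ltW).
have [ct _] := fcoop tM.
have tr : `|t *: (s *: w)| < r.
  rewrite normrZ gtr0_norm//; apply: le_lt_trans (sr _ wM).
  by rewrite -[leRHS]mul1r ler_wpM2r// ltW.
have e2 : - C * (s * w 0 i) + delta * (s * w 0 j) <= f (s *: w) 0 i.
  rewrite e actE (bigD1 i)//= (bigD1 j) 1?eq_sym//= addrA.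
  have /andP[wi _] := wP i; have /andP[wj _] := wP j.
  apply: (@le_trans _ _ (Df f (t *: (s *: w)) i i * (s *: w) 0 i +
    Df f (t *: (s *: w)) i j * (s *: w) 0 j)).
    have sE l : (s *: w) 0 l = s * w 0 l by rewrite mxE.
    rewrite !sE lerD//.
      rewrite ler_wpM2r ?mulr_ge0 ?(ltW s0)//.
      have := hC _ (norm_order_interval tM) i i.
      by rewrite ler_norml => /andP[].
    by rewrite ler_wpM2r ?mulr_ge0 ?(ltW s0)// hr.
  rewrite lerDl sumr_ge0// => l /andP[li lj].
  rewrite mulr_ge0// ?ct 1?eq_sym// mxE mulr_ge0// ?(ltW s0)//.
  by have /andP[] := wP l.
by lra.
Qed.

End Reaction.

(** * Equilibria, strict subsolutions and strict supersolutions *)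

Lemma eventually_pos_right (R : realType) (h : R -> R) (l : R) :
  is_derive (0 : R) (1 : R) h l -> 0 < h 0 \/ (h 0 = 0 /\ 0 < l) ->
  \forall e \near 0^'+, 0 < h e.
Proof.
move=> dh [h0|[h0 l0]].
  have ch : h e @[e --> 0^'+] --> h 0.
    apply: cvg_at_right_filter; apply: differentiable_continuous.
    by apply/derivable1_diffP; have [] := dh.
  exact: (cvgr_gt _ ch).
have [dh1 dh2] := dh.
have : (fun e : R => e^-1 *: (h e - h 0)) @ 0^'+ --> l.
  rewrite -dh2 /derive; have := dh1; rewrite /derivable => cv.
  rewrite (_ : (fun e : R => e^-1 *: (h e - h 0)) =
     (fun e : R => e^-1 *: ((h \o shift 0) (e *: (1 : R)) - h 0))).
    exact: (cvg_at_right_filter _) || exact: (cvg_dnbhs_at_right cv).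
  by apply/funext => e /=; rewrite [e *: (1:R)]mulr1 addr0.
move=> /cvgr_gt/(_ _ l0); apply: filterS2 (nbhs_right_gt 0) => e e0.
by rewrite h0 subr0 /= pmulr_rgt0// invr_gt0.
Qed.

Lemma eventually_small_mul (R : realType) (x C : R) : 0 < C ->
  \forall e \near 0^'+, e * x < C.
Proof.
move=> C0; have cv : e * x @[e --> 0^'+] --> (0 * x : R).
  by apply: cvg_at_right_filter; apply: cvgM; [exact: cvg_id|exact: cvg_cst].
by apply: (cvgr_lt _ cv); rewrite mul0r.
Qed.

Section Equilibria.
Context (R : realType) (m : nat).
Variables (v : 'rV[R]_m) (f : 'rV[R]_m -> 'rV[R]_m).
Hypothesis v0 : vll 0 v.
Hypothesis fC1 : C1 f.
Hypothesis fcoop : forall w, order_interval v w ->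
  cooperative (Df f w) /\ irreducible_mx (Df f w).
Hypothesis f0 : f 0 = 0.
Hypothesis fsub : forall w (alpha : R), order_interval v w -> vll 0 w ->
  0 < alpha -> alpha < 1 -> vlt (alpha *: f w) (f (alpha *: w)).
Variable c : R.
Hypothesis face : forall i w, order_interval v w -> w 0 i = v 0 i ->
  f w 0 i < c * v 0 i.
Hypothesis m0 : (0 < m)%N.
Implicit Types (a b w x : 'rV[R]_m).
Local Notation M := (order_interval v).
Local Notation A := (Df f 0 + (- c)%:M).

(** Perturbation of a weak sub- (b = 1) or supersolution (b = -1) w that is
    strict in at least one component into a family strict in all of them: push w
    in a direction x which the linearization at w maps to a vector positive at
    the components where w is not strict. *)
Lemma strict_push w (b : R) : M w -> b = 1 \/ b = -1 ->
  (forall i, 0 <= b * (f w 0 i - c * w 0 i)) ->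
  (exists i, 0 < b * (f w 0 i - c * w 0 i)) ->
  exists2 x, vll 0 x & \forall e \near 0^'+, forall i,
    0 < b * (f (w + e *: (b *: x)) 0 i - c * (w + e *: (b *: x)) 0 i).
Proof.
move=> wM b1 gw [i0 gi0]; have [cw iw] := fcoop wM.
have [|x x0 xI] := @positive_off _ _ (Df f w + (- c)%:M)
    [set i | 0 < b * (f w 0 i - c * w 0 i)]%SET
    (cooperative_shift _ cw) (irreducible_shift _ iw).
  by apply/set0Pn; exists i0; rewrite inE.
exists x => //; apply: filter_forall => i.
pose h (e : R) := b * (f (w + e *: (b *: x)) 0 i - c * (w + e *: (b *: x)) 0 i).
have dh : is_derive (0 : R) (1 : R) h (act (Df f w + (- c)%:M) x 0 i).
  have dl := is_derive_line fC1 w (b *: x) i 0.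
  have dl2 : is_derive (0 : R) (1 : R) (fun e => (w + e *: (b *: x)) 0 i) (b * x 0 i).
    rewrite (_ : (fun _ => _) = (fun e => w 0 i + e * (b * x 0 i))).
      by apply: is_derive_eq; rewrite !add0r mul1r scaler0 add0r [LHS]mulr1.
    by apply/funext => e; rewrite !mxE.
  rewrite /h; apply: is_derive_eq.
  rewrite scale0r addr0 act_shift actZ [in RHS]mxE !(mxE _ _ 0 i) -!actE.
  rewrite /GRing.scale/=.
  by have [->|->] := b1; ring.
apply: (eventually_pos_right dh).
have h0 : h 0 = b * (f w 0 i - c * w 0 i) by rewrite /h scale0r addr0.
rewrite h0; have [hi|hi] := boolP (0 < b * (f w 0 i - c * w 0 i)); first by left.
right; split; last by apply: xI; rewrite inE.
by apply/eqP; rewrite eq_le gw leNgt hi.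
Qed.

(** Sweeping: let t be the largest factor with t a <= b, and suppose t < 1.  If
    t a = b, strict subhomogeneity contradicts that b is a supersolution.  If t a
    touches b in some components only, irreducibility yields one of them in which
    f is larger at b than at t a, again a contradiction. *)
Lemma subequilibrium_le a b : M a -> M b -> vll 0 a -> vll 0 b ->
  (forall i, c * a 0 i <= f a 0 i) -> (forall i, f b 0 i <= c * b 0 i) ->
  vle a b.
Proof.
move=> aM bM /vll0P a0 /vll0P b0 ga gb.
case: (@arg_minP _ _ 'I_m (Ordinal m0) xpredT (fun i => b 0 i / a 0 i) isT) => i _ hi.
pose t := b 0 i / a 0 i.
have tb j : t * a 0 j <= b 0 j by rewrite -ler_pdivlMr// hi.
have ti : t * a 0 i = b 0 i by rewrite /t divfK// gt_eqF.
have t0 : 0 < t by rewrite divr_gt0.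
have [t1|t1] := leP 1 t.
  by move=> j; apply: le_trans (tb j); rewrite ler_peMl// ltW.
have taM : M (t *: a) by apply: order_interval_scale => //; rewrite !ltW.
have ta : vle (t *: a) b by move=> j; rewrite mxE.
have [fta nfta] := fsub aM ((vll0P _).2 a0) t0 t1.
have ftaE j : t * (c * a 0 j) <= f (t *: a) 0 j.
  by have := fta j; rewrite mxE; apply: le_trans; rewrite ler_pM2l.
have [cta ita] := fcoop taM.
pose S := [set j | t * a 0 j == b 0 j]%SET.
have S0 : S != finset.set0 by apply/set0Pn; exists i; rewrite inE ti.
have [S1|S1] := eqVneq S [set: 'I_m]%SET.
  have tab : t *: a = b.
    apply/rowP => j; rewrite mxE; apply/eqP.
    by have := finset.in_setT j; rewrite -S1 inE.
  have [j] := vlt_exists (conj fta nfta); rewrite mxE tab => hj.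
  have := gb j; rewrite -tab mxE tab => h.
  have : t * (c * a 0 j) <= t * f a 0 j by rewrite ler_pM2l.
  by lra.
have [p [q [pS qS Dpq]]] := ita S S0 S1.
rewrite !inE in pS qS; move/eqP in pS.
have pq : p != q by apply: contraNneq qS => <-; apply/eqP.
have {}Dpq : 0 < Df f (t *: a) p q by rewrite lt_neqAle eq_sym Dpq cta.
have bq : t * a 0 q < b 0 q by rewrite lt_neqAle qS tb.
have dl := is_derive_line fC1 (t *: a) (b - t *: a) p 0.
have dl2 : is_derive (0 : R) (1 : R)
    (fun e => f (t *: a + e *: (b - t *: a)) 0 p - f (t *: a) 0 p)
    (act (Df f (t *: a)) (b - t *: a) 0 p).
  by apply: is_derive_eq; rewrite scale0r addr0 subr0.
have dpos : 0 < act (Df f (t *: a)) (b - t *: a) 0 p.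
  rewrite actE (bigD1 q)//= ltr_pwDl//.
    by rewrite mulr_gt0// !mxE subr_gt0.
  rewrite sumr_ge0// => l _; have [->|lp] := eqVneq l p.
    by rewrite !mxE pS subrr mulr0.
  by rewrite mulr_ge0// ?cta 1?eq_sym// !mxE subr_ge0.
have := eventually_pos_right dl2 (or_intror (conj _ dpos)).
rewrite scale0r addr0 subrr => /(_ erefl) ev.
have [e [e0 e1]] : exists e : R, 0 < f (t *: a + e *: (b - t *: a)) 0 p - f (t *: a) 0 p
    /\ 0 <= e <= 1.
  near (0 : R)^'+ => e; exists e; split; first by near: e.
  by apply/andP; split; near: e; [exact: nbhs_right_ge|exact: nbhs_right_le].
have eM := order_interval_segment taM bM e1.
have : f (t *: a + e *: (b - t *: a)) 0 p <= f b 0 p.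
  apply: (quasi_monotone fC1 fcoop) => //.
    move=> j; have /andP[? ?] := e1; rewrite !mxE.
    by have := tb j; nra.
  by rewrite !mxE pS; ring.
have := gb p; have := ftaE p; rewrite -pS.
by lra.
Unshelve. all: by end_near. Qed.

(** A subhomogeneous function lies below its linearization at 0, since
    f (e w) / e >= f w for small e. *)
Lemma reaction_le_linear w i : M w -> f w 0 i <= act (Df f 0) w 0 i.
Proof.
move=> wM; rewrite leNgt; apply/negP => hlt.
have dl := is_derive_line fC1 0 w i 0.
have dl2 : is_derive (0 : R) (1 : R) (fun e => e * f w 0 i - f (0 + e *: w) 0 i)
    (f w 0 i - act (Df f 0) w 0 i).
  by apply: is_derive_eq; rewrite [0 *: w]scale0r addr0 scaler0 add0r [_%:A]mulr1.
have := eventually_pos_right dl2 (or_intror (conj _ _)).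
rewrite mul0r scale0r addr0 f0 mxE subrr => /(_ erefl); rewrite subr_gt0 => /(_ hlt) ev.
have [e [e0 e1]] : exists e : R, 0 < e * f w 0 i - f (0 + e *: w) 0 i /\ 0 <= e <= 1.
  near (0 : R)^'+ => e; exists e; split; first by near: e.
  by apply/andP; split; near: e; [exact: nbhs_right_ge|exact: nbhs_right_le].
have := subhomogeneous_le v0 fC1 f0 fsub wM e1 i.
by rewrite mxE; move: e0; rewrite add0r; lra.
Unshelve. all: by end_near. Qed.

(** A small multiple u of the Perron vector is a weak supersolution because f
    lies below its linearization and the spectral bound is nonpositive.  Strict
    subhomogeneity makes it strict in one component, and [strict_push] in all. *)
Lemma small_supersolution (eps : R) : 0 < eps -> spectral_bound A <= 0 ->
  exists w, [/\ M w, vll 0 w, forall i, w 0 i <= eps &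
    forall i, f w 0 i < c * w 0 i].
Proof.
move=> eps0 sA; have [cA iA] := fcoop (order_interval0 v0).
have [p /vll0P p0 Ap] := perron_frobenius m0 (cooperative_shift (- c) cA) (irreducible_shift (- c) iA).
have /vll0P vp := v0.
have [d [d0 dv de]] : exists d : R, [/\ 0 < d, forall i, d * p 0 i < v 0 i &
    forall i, d * p 0 i < eps].
  near (0 : R)^'+ => d; exists d; split; first by near: d; exact: nbhs_right_gt.
    by near: d; apply: filter_forall => i; exact: eventually_small_mul.
  by near: d; apply: filter_forall => i; exact: eventually_small_mul.
pose u := d *: p.
have uM : M u.
  by apply/order_intervalP => i; rewrite mxE mulr_ge0 ?ltW//=.
have u0 : vll 0 u by apply/vll0P => i; rewrite mxE mulr_gt0.
have lin x i : act (Df f 0) x 0 i = act A x 0 i + c * x 0 i.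
  by rewrite act_shift !(mxE _ _ 0 i) -actE; ring.
have Au i : act A u 0 i <= 0.
  rewrite actZ Ap !mxE mulrCA mulr_le0_ge0// mulr_ge0// ltW//.
have gu i : 0 <= -1 * (f u 0 i - c * u 0 i).
  by have := reaction_le_linear i uM; rewrite lin; have := Au i; lra.
have [i hi] : exists i, 0 < -1 * (f u 0 i - c * u 0 i).
  have h12 : 0 < (2^-1 : R) < 1 by apply/andP; split; lra.
  have /andP[h1 h2] := h12.
  have [i hi] := vlt_exists (fsub uM u0 h1 h2); exists i.
  have uM2 : M (2^-1 *: u) by apply: order_interval_scale => //; rewrite !ltW.
  have := reaction_le_linear i uM2; rewrite lin actZ; move: hi; rewrite !(mxE _ _ 0 i).
  by have := Au i; rewrite -actE; lra.
have [|x /vll0P x0 ev] := strict_push uM (or_intror erefl) gu; first by exists i.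
have [e [e0 eu he]] : exists e : R, [/\ 0 < e, forall i, e * x 0 i < u 0 i &
   forall i, 0 < -1 * (f (u + e *: (-1 *: x)) 0 i - c * (u + e *: (-1 *: x)) 0 i)].
  near (0 : R)^'+ => e; exists e; split; first by near: e; exact: nbhs_right_gt.
    near: e; apply: filter_forall => j; apply: eventually_small_mul.
    by have /vll0P := u0.
  by near: e.
have wE j : (u + e *: (-1 *: x)) 0 j = u 0 j - e * x 0 j by rewrite !mxE; ring.
have ex j : 0 < e * x 0 j by rewrite mulr_gt0.
exists (u + e *: (-1 *: x)); split.
- apply/order_intervalP => j; rewrite wE; have /order_intervalP/(_ j)/andP[_ ?] := uM.
  have h1 := eu j; have h2 := ex j.
  by apply/andP; split; lra.
- by apply/vll0P => j; rewrite wE subr_gt0.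
- by move=> j; rewrite wE; have := de j; have := ex j; rewrite mxE; lra.
- by move=> j; have := he j; lra.
Unshelve. all: by end_near. Qed.

Lemma small_subequilibrium : 0 < spectral_bound A ->
  exists w, [/\ M w, vll 0 w & forall i, c * w 0 i <= f w 0 i].
Proof.
move=> sA; have [cA iA] := fcoop (order_interval0 v0).
have [p /vll0P p0 Ap] := perron_frobenius m0 (cooperative_shift (- c) cA) (irreducible_shift (- c) iA).
have /vll0P vp := v0.
have lin x i : act (Df f 0) x 0 i = act A x 0 i + c * x 0 i.
  by rewrite act_shift !(mxE _ _ 0 i) -actE; ring.
pose h i (e : R) := f (0 + e *: p) 0 i - e * (c * p 0 i).
have dh i : is_derive (0 : R) (1 : R) (h i) (spectral_bound A * p 0 i).
  have dl := is_derive_line fC1 0 p i 0.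
  rewrite /h; apply: is_derive_eq.
  rewrite [0 *: p]scale0r addr0 scaler0 add0r [_%:A]mulr1 lin Ap !(mxE _ _ 0 i).
  by ring.
have [e [e0 ev he]] : exists e : R, [/\ 0 < e, forall i, e * p 0 i < v 0 i &
    forall i, 0 < h i e].
  near (0 : R)^'+ => e; exists e; split; first by near: e; exact: nbhs_right_gt.
    by near: e; apply: filter_forall => i; exact: eventually_small_mul.
  near: e; apply: filter_forall => i; apply: (eventually_pos_right (dh i)); right.
  split; last by rewrite mulr_gt0.
  by rewrite /h scale0r addr0 f0 mxE mul0r subr0.
exists (e *: p); split.
- by apply/order_intervalP => i; rewrite mxE mulr_ge0 ?ltW//=.
- by apply/vll0P => i; rewrite mxE mulr_gt0.
- by move=> i; have := he i; rewrite /h add0r mxE; lra.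
Unshelve. all: by end_near. Qed.

(** The subsolutions in the order interval form a compact set, and a maximizer of the sum of
    components dominates them all, since the componentwise maximum of two
    subsolutions is a subsolution.  A maximizer with a strict component could be
    increased along that component, which stays below v by the face condition. *)
Lemma equilibrium_exists : 0 < spectral_bound A ->
  exists w, [/\ M w, vll 0 w & forall i, f w 0 i = c * w 0 i].
Proof.
move=> sA; have [w0 [w0M w00 gw0]] := small_subequilibrium sA.
pose E : set 'rV[R]_m := [set w | M w /\ forall i, c * w 0 i <= f w 0 i].
have cf i : continuous (fun w => f w 0 i).
  move=> w; apply: (@cvg_comp _ _ _ f (fun x : 'rV[R]_m => x 0 i) _ (nbhs (f w))).
    exact: continuous_f.
  exact: continuous_coord.
have cE : compact E.
  apply: bounded_closed_compact.
    exists `|v|; split; first exact: num_real.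
    by move=> B vB w [/norm_order_interval wv _]; apply: le_trans wv (ltW vB).
  have -> : E = (\bigcap_(i in [set: 'I_m]) [set w : 'rV[R]_m | 0 <= w 0 i]) `&`
     ((\bigcap_(i in [set: 'I_m]) [set w : 'rV[R]_m | w 0 i <= v 0 i]) `&`
     (\bigcap_(i in [set: 'I_m]) [set w : 'rV[R]_m | 0 <= f w 0 i - c * w 0 i])).
    apply/seteqP; split=> w /=.
      move=> [/order_intervalP wM gw]; split; [|split] => i _ /=.
      - by have /andP[] := wM i.
      - by have /andP[] := wM i.
      - by rewrite subr_ge0.
    move=> [h1 [h2 h3]]; split.
      by apply/order_intervalP => i; rewrite h1//= h2.
    by move=> i; rewrite -subr_ge0; exact: h3.
  apply: closedI; [|apply: closedI]; apply: closed_bigI => i _.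
  - apply: (@preimage_closed _ _ (fun w : 'rV[R]_m => w 0 i) [set x | 0 <= x]).
      by move=> w _; exact: continuous_coord.
    exact: closed_ge.
  - apply: (@preimage_closed _ _ (fun w : 'rV[R]_m => w 0 i) [set x | x <= v 0 i]).
      by move=> w _; exact: continuous_coord.
    exact: closed_le.
  - apply: (@preimage_closed _ _ (fun w : 'rV[R]_m => f w 0 i - c * w 0 i)
      [set x | 0 <= x]); last exact: closed_ge.
    move=> w _; apply: cvgB (cf i w) _; apply: cvgM (cvg_cst _) _.
    exact: continuous_coord.
have [||w] := @compact_EVT_max _ R (fun w : 'rV[R]_m => \sum_i w 0 i) E _ cE.
- by exists w0; split.
- apply: continuous_subspaceT => w.
  apply: (@cvg_sumr R R^o _ _ (index_enum 'I_m) xpredT (nbhs w) _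
    (fun i (z : 'rV[R]_m) => z 0 i) (fun i => w 0 i)) => i _.
  exact: continuous_coord.
rewrite inE => -[wM gw] wmax.
have max_le z : E z -> vle z w.
  move=> [zM gz] i; rewrite leNgt; apply/negP => hi.
  pose j : 'rV[R]_m := \row_l Num.max (w 0 l) (z 0 l).
  have wj l : w 0 l <= j 0 l by rewrite mxE le_max lexx.
  have zj l : z 0 l <= j 0 l by rewrite mxE le_max lexx orbT.
  have jM : M j.
    apply/order_intervalP => l; apply/andP; split.
      by apply: le_trans (wj l); have /order_intervalP/(_ l)/andP[] := wM.
    rewrite mxE ge_max; have /order_intervalP/(_ l)/andP[_ ->] := wM.
    by have /order_intervalP/(_ l)/andP[_ ->] := zM.
  have : \sum_i j 0 i <= \sum_i w 0 i.
    apply: wmax; rewrite inE; split=> // l.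
    have [h|h] := leP (w 0 l) (z 0 l).
      have e : z 0 l = j 0 l by rewrite mxE max_r.
      rewrite -e; apply: (le_trans (gz l)); exact: (quasi_monotone fC1 fcoop).
    have e : w 0 l = j 0 l by rewrite mxE max_l// ltW.
    by rewrite -e; apply: (le_trans (gw l)); exact: (quasi_monotone fC1 fcoop).
  apply/negP; rewrite -ltNge (bigD1 i)//= [ltRHS](bigD1 i)//=.
  by rewrite ltr_leD//; [rewrite mxE max_r// ltW|exact: ler_sum].
have wpos : vll 0 w.
  apply/vll0P => i; have /vll0P/(_ i) h := w00; apply: lt_le_trans h _.
  by apply: max_le; split.
exists w; split=> // i; apply/eqP; rewrite eq_le gw andbT leNgt; apply/negP => gi.
have wi : w 0 i < v 0 i.
  have /order_intervalP/(_ i)/andP[_ h] := wM; rewrite lt_neqAle h andbT.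
  by apply/eqP => e; have := face wM e; rewrite -e; lra.
pose z (e : R) : 'rV[R]_m := w + e *: delta_mx 0 i.
have zE e j : z e 0 j = w 0 j + e * (j == i)%:R by rewrite !mxE eqxx.
have dl := is_derive_line fC1 w (delta_mx 0 i) i 0.
have [e [e0 ev ge]] : exists e : R, [/\ 0 < e, e * 1 < v 0 i - w 0 i &
    0 < f (z e) 0 i - c * (w 0 i + e)].
  pose h (e : R) := f (w + e *: delta_mx 0 i) 0 i - c * (w 0 i + e).
  have [l dh] : exists l, is_derive (0 : R) (1 : R) h l.
    by eexists; rewrite /h; apply: is_derive_eq.
  near (0 : R)^'+ => e; exists e; split.
  - by near: e; exact: nbhs_right_gt.
  - by near: e; apply: eventually_small_mul; rewrite subr_gt0.
  near: e; apply: (eventually_pos_right dh); left.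
  by rewrite /h scale0r !addr0 subr_gt0.
have wz j : w 0 j <= z e 0 j by rewrite zE lerDl mulr_ge0 ?(ltW e0)// ler0n.
have zM : M (z e).
  apply/order_intervalP => j; apply/andP; split.
    by apply: le_trans (wz j); have /order_intervalP/(_ j)/andP[] := wM.
  rewrite zE; have [->|ji] := eqVneq j i; first by rewrite mulr1n; lra.
  by rewrite mulr0n mulr0 addr0; have /order_intervalP/(_ j)/andP[_ ->] := wM.
have : z e 0 i <= w 0 i.
  apply: max_le; split=> // j; have [->|ji] := eqVneq j i.
    by rewrite [X in _ * X]zE eqxx mulr1; lra.
  have e1 : w 0 j = z e 0 j by rewrite zE (negbTE ji) mulr0n mulr0 addr0.
  by rewrite -e1; apply: (le_trans (gw j)); exact: (quasi_monotone fC1 fcoop).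
by rewrite zE eqxx mulr1; lra.
Unshelve. all: by end_near. Qed.

Lemma equilibrium_lt_face w : M w -> (forall i, f w 0 i = c * w 0 i) ->
  forall i, w 0 i < v 0 i.
Proof.
move=> wM gw i; have /order_intervalP/(_ i)/andP[_ h] := wM.
rewrite lt_neqAle h andbT; apply/eqP => e.
by have := face wM e; rewrite gw e ltxx.
Qed.

(** A component vanishing at a nonzero equilibrium would receive a positive
    contribution from a nonvanishing one, by irreducibility. *)
Lemma equilibrium_positive w : M w -> (forall i, f w 0 i = c * w 0 i) ->
  vlt 0 w -> vll 0 w.
Proof.
move=> wM gw w0.
have [i0] := vlt_exists w0; rewrite mxE => hi0.
have /order_intervalP wP := wM.
have [C [kap [C0 k0 lo1 lo2]]] := reaction_lower_bound v0 fC1 fcoop f0.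
have [cA iA] := fcoop (order_interval0 v0).
have I0 : [set i | 0 < w 0 i]%SET != finset.set0 by apply/set0Pn; exists i0; rewrite inE.
have [I1|I1] := eqVneq [set i | 0 < w 0 i]%SET [set: 'I_m]%SET.
  by apply/vll0P => i; have := finset.in_setT i; rewrite -I1 inE.
have [i [j [iI jI Aij]]] := irreducible_entry cA iA I0 I1.
rewrite !inE in iI jI.
have wi : w 0 i = 0 by apply/eqP; rewrite eq_le leNgt iI/=; have /andP[] := wP i.
have := lo2 w i j wM _ Aij; rewrite gw wi !mulr0 add0r => /(_ _)/=h.
have : kap * w 0 j <= 0 by apply: h; apply: contraNneq iI => ->.
by rewrite leNgt mulr_gt0.
Qed.

Lemma equilibrium_unique a b : M a -> M b -> vlt 0 a -> vlt 0 b ->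
  (forall i, f a 0 i = c * a 0 i) -> (forall i, f b 0 i = c * b 0 i) -> a = b.
Proof.
move=> aM bM a0 b0 ga gb.
have a1 := equilibrium_positive aM ga a0; have b1 := equilibrium_positive bM gb b0.
have le x y : M x -> M y -> vll 0 x -> vll 0 y ->
    (forall i, f x 0 i = c * x 0 i) -> (forall i, f y 0 i = c * y 0 i) -> vle x y.
  by move=> xM yM x0 y0 gx gy; apply: subequilibrium_le => // i; rewrite ?gx ?gy.
by apply/rowP => i; apply/eqP; rewrite eq_le !le.
Qed.

(** Slightly below an equilibrium, (1 - d) w is a weak subsolution by
    subhomogeneity, then made strict by [strict_push]; [strict_super_near] is the
    same argument above the equilibrium. *)
Lemma strict_sub_near w (eps : R) : 0 < eps -> M w -> vll 0 w ->
  (forall i, f w 0 i = c * w 0 i) ->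
  exists z, [/\ M z, vll 0 z, forall i, w 0 i - eps <= z 0 i &
    forall i, c * z 0 i < f z 0 i].
Proof.
move=> eps0 wM /vll0P w0 gw; have /order_intervalP wP := wM.
have [d [d0 d1 dw]] : exists d : R, [/\ 0 < d, d < 1 & forall i, d * w 0 i < eps].
  near (0 : R)^'+ => d; exists d; split; [near: d; exact: nbhs_right_gt|near: d; exact: nbhs_right_lt|].
  by near: d; apply: filter_forall => i; exact: eventually_small_mul.
have t0 : 0 < 1 - d by lra.
have t1 : 1 - d < 1 by lra.
pose u := (1 - d) *: w.
have uM : M u by apply: order_interval_scale => //; rewrite !ltW.
have su := fsub wM ((vll0P _).2 w0) t0 t1.
have uE i : u 0 i = (1 - d) * w 0 i by rewrite mxE.
have gu i : 0 <= 1 * (f u 0 i - c * u 0 i).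
  by have := su.1 i; rewrite mxE gw uE -/u; lra.
have [|x /vll0P x0 ev] := strict_push uM (or_introl erefl) gu.
  have [l] := vlt_exists su; rewrite mxE gw -/u => hl; exists l.
  by rewrite uE; lra.
have [e [e0 eu he]] : exists e : R, [/\ 0 < e, forall i, e * x 0 i < d * w 0 i &
   forall i, 0 < 1 * (f (u + e *: (1 *: x)) 0 i - c * (u + e *: (1 *: x)) 0 i)].
  near (0 : R)^'+ => e; exists e; split; first by near: e; exact: nbhs_right_gt.
    near: e; apply: filter_forall => j; apply: eventually_small_mul.
    by rewrite mulr_gt0.
  by near: e.
have wE j : (u + e *: (1 *: x)) 0 j = (1 - d) * w 0 j + e * x 0 j by rewrite !mxE; ring.
have ex j : 0 < e * x 0 j by rewrite mulr_gt0.
have tw j : 0 < (1 - d) * w 0 j by rewrite mulr_gt0.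
exists (u + e *: (1 *: x)); split.
- apply/order_intervalP => j; rewrite wE; have /andP[_ h] := wP j.
  have h1 := eu j; have h2 := ex j; have h3 := tw j.
  by apply/andP; split; lra.
- by apply/vll0P => j; rewrite wE addr_gt0.
- by move=> j; rewrite wE; have := dw j; have := ex j; lra.
- by move=> j; have := he j; lra.
Unshelve. all: by end_near. Qed.

Lemma strict_super_near w (eps : R) : 0 < eps -> M w -> vll 0 w ->
  (forall i, f w 0 i = c * w 0 i) ->
  exists z, [/\ M z, vll 0 z, forall i, z 0 i <= w 0 i + eps &
    forall i, f z 0 i < c * z 0 i].
Proof.
move=> eps0 wM /vll0P w0 gw; have /order_intervalP wP := wM.
have wv := equilibrium_lt_face wM gw.
have [d [d0 d1 dw]] : exists d : R, [/\ 0 < d, forall i, d * w 0 i < v 0 i - w 0 i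
    & forall i, d * w 0 i < eps].
  near (0 : R)^'+ => d; exists d; split; first by near: d; exact: nbhs_right_gt.
    by near: d; apply: filter_forall => i; apply: eventually_small_mul; rewrite subr_gt0.
  by near: d; apply: filter_forall => i; exact: eventually_small_mul.
have t0 : 0 < 1 + d by lra.
pose u := (1 + d) *: w.
have uE i : u 0 i = (1 + d) * w 0 i by rewrite mxE.
have uM : M u.
  apply/order_intervalP => i; rewrite uE; have := d1 i; have := w0 i => h1 h2.
  by apply/andP; split; nra.
have u0 : vll 0 u by apply/vll0P => i; rewrite uE mulr_gt0.
have s0 : 0 < (1 + d)^-1 by rewrite invr_gt0.
have s1 : (1 + d)^-1 < 1 by rewrite invf_lt1// ltrDl.
have su := fsub uM u0 s0 s1.
have uw : (1 + d)^-1 *: u = w by rewrite /u scalerA mulVf ?scale1r// gt_eqF.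
rewrite uw in su.
have gu i : 0 <= -1 * (f u 0 i - c * u 0 i).
  have := su.1 i; rewrite mxE gw ler_pdivrMl// uE; lra.
have [|x /vll0P x0 ev] := strict_push uM (or_intror erefl) gu.
  have [l] := vlt_exists su; rewrite mxE gw ltr_pdivrMl// => hl; exists l.
  by rewrite uE; lra.
have [e [e0 eu he]] : exists e : R, [/\ 0 < e, forall i, e * x 0 i < w 0 i &
   forall i, 0 < -1 * (f (u + e *: (-1 *: x)) 0 i - c * (u + e *: (-1 *: x)) 0 i)].
  near (0 : R)^'+ => e; exists e; split; first by near: e; exact: nbhs_right_gt.
    by near: e; apply: filter_forall => j; apply: eventually_small_mul.
  by near: e.
have wE j : (u + e *: (-1 *: x)) 0 j = (1 + d) * w 0 j - e * x 0 j by rewrite !mxE; ring.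
have ex j : 0 < e * x 0 j by rewrite mulr_gt0.
have dwp j : 0 < d * w 0 j by rewrite mulr_gt0.
exists (u + e *: (-1 *: x)); split.
- apply/order_intervalP => j; rewrite wE.
  have h1 := eu j; have h2 := ex j; have h3 := d1 j; have h4 := dwp j.
  by apply/andP; split; lra.
- by apply/vll0P => j; rewrite wE; have := eu j; have := dwp j; lra.
- by move=> j; rewrite wE; have := dw j; have := ex j; lra.
- by move=> j; have := he j; lra.
Unshelve. all: by end_near. Qed.

End Equilibria.

(** * Lebesgue measurable subsets of R^n *)

Section EsumComplements.
Context (R : realType).

Lemma esum_subset (T : choiceType) (A B : set T) (a : T -> \bar R) :
  (forall i, 0 <= a i)%E -> A `<=` B ->
  (\esum_(i in A) a i <= \esum_(i in B) a i)%E.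
Proof.
move=> a0 AB; rewrite esum_mkcond [leRHS]esum_mkcond; apply: le_esum => i _.
case: ifPn => [/set_mem Ai|_]; last by case: ifPn.
by rewrite (mem_set (AB _ Ai)).
Qed.

Lemma esum_image_le (T T' : choiceType) (C : set T) (e : T -> T')
    (a : T' -> \bar R) : (forall i, 0 <= a i)%E ->
  (\esum_(j in e @` C) a j <= \esum_(i in C) a (e i))%E.
Proof.
move=> a0; have [t0|nt] := pselect (C !=set0); last first.
  have -> : C = set0 by apply/seteqP; split=> // x Cx; case: nt; exists x.
  by rewrite image_set0 !esum_set0.
case: t0 => t0 _.
have /choice[h hP] : forall j, exists i, (e @` C) j -> C i /\ e i = j.
  move=> j; have [[i Ci <-]|nj] := pselect ((e @` C) j); last by exists t0.
  by exists i.
have inj : set_inj (h @` (e @` C)) e.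
  move=> x y /set_mem[j jC <-] /set_mem[k kC <-].
  by rewrite (hP _ jC).2 (hP _ kC).2 => ->.
have -> : e @` C = e @` (h @` (e @` C)).
  apply/seteqP; split=> [j jC|_ [_ [j jC <-] <-]]; last first.
    by rewrite (hP _ jC).2.
  by exists (h j); [exists j|rewrite (hP _ jC).2].
rewrite (esum_image _ _ _ inj); apply: esum_subset => // _ [j jC <-].
exact: (hP _ jC).1.
Qed.

Lemma esumZl_le (T : choiceType) (C : set T) (k : R) (a : T -> \bar R) :
  0 <= k -> (forall i, 0 <= a i)%E ->
  (\esum_(i in C) (k%:E * a i) <= k%:E * \esum_(i in C) a i)%E.
Proof.
move=> k0 a0; apply: ge_ereal_sup => _ [X XC <-].
rewrite -ge0_mule_fsumr//; apply: lee_wpmul2l; first by rewrite lee_fin.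
by apply: esum_ge; exists X.
Qed.

End EsumComplements.

Lemma exists_natSinv_lt (R : realType) (r : R) : 0 < r ->
  exists k : nat, k.+1%:R^-1 < r.
Proof.
move=> r0; near \oo => k; exists k; near: k.
exact: (near_infty_natSinv_lt (PosNum r0)).
Unshelve. all: by end_near. Qed.

Section LebesgueRn.
Context (R : realType) (n : nat).
Local Notation V := 'rV[R]_n.
Local Notation outer := (@lebesgue_outer R n).
Implicit Types (c : V * V) (X A : set V).

(** The two pieces cut out of a box by the hyperplane x_i = a.  A piece may be
    empty, with a negative side, whence the truncation in [box_volume]. *)
Definition box_cap_le (i : 'I_n) (a : R) c : V * V :=
  (c.1, \row_j if j == i then Num.min (c.2 0 j) a else c.2 0 j).
Definition box_cap_ge (i : 'I_n) (a : R) c : V * V :=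
  (\row_j if j == i then Num.max (c.1 0 j) a else c.1 0 j, c.2).

Lemma box_volume_split i a c :
  box_volume (box_cap_le i a c) + box_volume (box_cap_ge i a c) = box_volume c.
Proof.
rewrite /box_volume (bigD1 i)//= [X in _ + X](bigD1 i)//= [RHS](bigD1 i)//=.
rewrite !mxE eqxx.
have E1 : \prod_(j < n | j != i) Num.max 0 ((box_cap_le i a c).2 0 j - c.1 0 j) =
    \prod_(j < n | j != i) Num.max 0 (c.2 0 j - c.1 0 j).
  by apply: eq_bigr => j /negbTE ji; rewrite mxE ji.
have E2 : \prod_(j < n | j != i) Num.max 0 (c.2 0 j - (box_cap_ge i a c).1 0 j) =
    \prod_(j < n | j != i) Num.max 0 (c.2 0 j - c.1 0 j).
  by apply: eq_bigr => j /negbTE ji; rewrite mxE ji.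
rewrite E1 E2 -mulrDl; congr (_ * _).
rewrite /Order.max /Order.min.
by repeat case: ifPn => //; rewrite ?subr_gt0 -?leNgt; lra.
Qed.

Lemma countable_cover_outer X (C : set (V * V)) : countable C ->
  X `<=` \bigcup_(c in C) box c ->
  (outer X <= \esum_(c in C) (box_volume c)%:E)%E.
Proof. by move=> cC XC; apply: ereal_inf_lbound; exists C. Qed.

Lemma volE_ge0 c : (0 <= (box_volume c)%:E)%E.
Proof. by rewrite lee_fin box_volume_ge0. Qed.

(** Cutting every box of a cover by the hyperplane yields covers of both parts
    with the same total volume. *)
Lemma caratheodory_halfspace i a :
  (@lebesgue_outer_measure R n).-caratheodory [set x : V | x 0 i <= a].
Proof.
apply: le_caratheodory_measurable => X.
apply: le_ereal_inf_tmp => _ [C [cC XC] <-].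
apply: (@le_trans _ _ (\esum_(c in C) (box_volume (box_cap_le i a c))%:E +
    \esum_(c in C) (box_volume (box_cap_ge i a c))%:E)%E); last first.
  rewrite -esumD; [|by move=> *; exact: volE_ge0|by move=> *; exact: volE_ge0].
  by apply: le_esum => c _; rewrite -EFinD box_volume_split.
apply: leeD.
  apply: le_trans (esum_image_le _ _ volE_ge0).
  apply: countable_cover_outer; first exact: sub_countable (card_image_le _ _) cC.
  move=> x [/XC[c Cc cx] /= xa]; exists (box_cap_le i a c); first by exists c.
  move=> j /=; have /andP[h1 h2] := cx j; rewrite mxE h1/=.
  by case: eqP => // ->; rewrite le_min xa andbT; have /andP[] := cx i.
apply: le_trans (esum_image_le _ _ volE_ge0).
apply: countable_cover_outer; first exact: sub_countable (card_image_le _ _) cC.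
move=> x [/XC[c Cc cx] /= xa]; exists (box_cap_ge i a c); first by exists c.
move=> j /=; have /andP[h1 h2] := cx j; rewrite mxE h2 andbT.
case: eqP => // ->; rewrite ge_max; have /andP[-> _] /= := cx i.
by move/negP: xa; rewrite -ltNge => /ltW.
Qed.

Lemma measurable_le_coord i a :
  measurable ([set x : V | x 0 i <= a] : set (lebesgueType R n)).
Proof. exact: caratheodory_halfspace. Qed.

Lemma measurable_lt_coord i a :
  measurable ([set x : V | x 0 i < a] : set (lebesgueType R n)).
Proof.
rewrite (_ : mkset _ = \bigcup_(k : nat) [set x : V | x 0 i <= a - k.+1%:R^-1]).
  by apply: bigcupT_measurable => k; exact: measurable_le_coord.
apply/seteqP; split=> x /=.
  move=> xa; have d0 : 0 < a - x 0 i by rewrite subr_gt0.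
  by have [k hk] := exists_natSinv_lt d0; exists k => //;
     rewrite /mkset lerBrDr -lerBrDl ltW.
move=> [k _ /= h]; apply: (le_lt_trans h).
by rewrite ltrBlDr ltrDl invr_gt0.
Qed.

Lemma ball_coord (x y : V) (r : R) : ball x r y <-> 0 < r /\ forall i, `|x 0 i - y 0 i| < r.
Proof.
split=> [[r0 h]|[r0 h]]; first by split=> // i; exact: h.
by split=> // i j; rewrite ord1; exact: h.
Qed.

Lemma measurable_rVball (x : V) (r : R) :
  measurable (ball x r : set (lebesgueType R n)).
Proof.
have [r0|r0] := leP r 0.
  rewrite (_ : ball x r = set0); first exact: measurable0.
  by apply/seteqP; split=> // y /ball_coord[]; rewrite ltNge r0.
rewrite (_ : ball x r = \bigcap_(i : 'I_n)
   ([set y : V | y 0 i < x 0 i + r] `\` [set y : V | y 0 i <= x 0 i - r])).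
  apply: fin_bigcap_measurable => [|i _]. 
    exact: (@finite_finset 'I_n).
  by apply: measurableD; [exact: measurable_lt_coord|exact: measurable_le_coord].
apply/seteqP; split=> y.
  move=> /ball_coord[_ h] i _ /=; have := h i; rewrite ltr_distlC => /andP[h1 h2].
  by split=> //; apply/negP; rewrite -ltNge.
move=> h; apply/ball_coord; split=> // i; have [/= h1 h2] := h i Logic.I.
by move/negP: h2; rewrite -ltNge => h2; rewrite ltr_distlC h1 h2.
Qed.

Lemma rational_ball (x : V) (r : R) : 0 < r ->
  exists q : 'rV[rat]_n, ball (map_mx ratr q : V) r x.
Proof.
move=> r0; have /choice[q hq] : forall i, exists q : rat, `|ratr q - x 0 i| < r.
  move=> i; have [|q] := @rat_in_itvoo R (x 0 i - r) (x 0 i + r).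
    by rewrite ltrD2l (lt_trans _ r0)// oppr_lt0.
  by rewrite in_itv/= => h; exists q; rewrite ltr_distl.
exists (\row_i q i); apply/ball_coord; split=> // i.
by rewrite !mxE.
Qed.

(** Balls of the maximum norm are intersections of half-spaces, and every open
    set is a countable union of balls with rational centres and radii 1/(k+1). *)
Lemma measurable_open A : open A -> measurable (A : set (lebesgueType R n)).
Proof.
move=> oA.
pose B (q : 'rV[rat]_n * nat) : set V := ball (map_mx ratr q.1 : V) q.2.+1%:R^-1.
rewrite (_ : A = \bigcup_(q in [set q | B q `<=` A]) B q).
  rewrite bigcup_mkcond; apply: countable_bigcupT_measurable => [|q].
    exact: countableP.
  by case: ifPn => // _; exact: measurable_rVball.
apply/seteqP; split=> [x Ax|x [q qA qx]]; last exact: qA.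
have /nbhs_ballP[r /= r0 rA] : nbhs x A by apply: open_nbhs_nbhs.
have r20 : 0 < r / 2 by rewrite divr_gt0.
have [k hk] := exists_natSinv_lt r20.
have k0 : 0 < k.+1%:R^-1 :> R by rewrite invr_gt0.
have [q hq] := rational_ball x k0.
exists (q, k) => // y qy; apply: rA; have := ball_triangle (ball_sym hq) qy.
by apply: le_ball; move: hk; move: (k.+1%:R^-1) => e; lra.
Qed.

Lemma measurable_closed A : closed A -> measurable (A : set (lebesgueType R n)).
Proof.
by move=> cA; rewrite -[A]setCK; apply: measurableC; apply: measurable_open; rewrite openC.
Qed.

Lemma measurable_continuous (g : V -> R) (D : set (lebesgueType R n)) :
  measurable D -> continuous g -> measurable_fun D (g : lebesgueType R n -> R).
Proof.
move=> mD cg; apply: (measurability _ (RGenOInfty.measurableE R)) => //.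
move=> _ [_ [a ->] <-]; apply: measurableI => //; apply: measurable_open.
by apply: open_comp => [x _|]; [exact: cg|exact: interval_open].
Qed.

End LebesgueRn.

(** * Affine changes of variables *)

Section AffineChange.
Context (R : realType) (n : nat).
Local Notation V := 'rV[R]_n.
Local Notation outer := (@lebesgue_outer R n).
Local Notation mu := (@lebesgue_Rn R n).
Implicit Types (c : V * V) (X A : set V) (b : V) (s : R).

Definition affine s b (x : V) : V := s *: x + b.

Definition box_affine s b c : V * V :=
  if 0 <= s then (affine s b c.1, affine s b c.2)
  else (affine s b c.2, affine s b c.1).

Lemma box_volume_affine s b c :
  box_volume (box_affine s b c) = `|s| ^+ n * box_volume c.
Proof.
have -> : `|s| ^+ n = \prod_(i < n) `|s| by rewrite prodr_const card_ord.
rewrite /box_volume -big_split/=.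
apply: eq_bigr => i _; rewrite maxr_pMr// mulr0 /box_affine; case: ifPn => s0.
  by rewrite !mxE (ger0_norm s0); congr (Num.max _ _); ring.
rewrite -ltNge in s0; rewrite !mxE (ltr0_norm s0); congr (Num.max _ _); ring.
Qed.

Lemma affine_box s b c : affine s b @` box c `<=` box (box_affine s b c).
Proof.
move=> _ [x cx <-] i; have /andP[h1 h2] := cx i; rewrite /box_affine.
case: ifPn => s0; rewrite !mxE !lerD2r; first by rewrite !ler_wpM2l.
by rewrite -ltNge in s0; rewrite !ler_wnM2l// ltW.
Qed.

Lemma affineK s b : s != 0 -> cancel (affine s b) (affine s^-1 (- (s^-1 *: b))).
Proof. by move=> s0 x; rewrite /affine scalerDr scalerA mulVf// scale1r addrK. Qed.

Lemma affineKV s b : s != 0 -> cancel (affine s^-1 (- (s^-1 *: b))) (affine s b).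
Proof.
move=> s0 x; rewrite /affine scalerDr scalerN !scalerA mulfV// !scale1r.
by rewrite subrK.
Qed.

Lemma outer_affine_le s b X : s != 0 ->
  (outer (affine s b @` X) <= (`|s| ^+ n)%:E * outer X)%E.
Proof.
move=> s0; have sn0 : 0 < `|s| ^+ n by rewrite exprn_gt0// normr_gt0.
rewrite -lee_pdivrMl//; apply: le_ereal_inf_tmp => _ [C [cC XC] <-].
rewrite lee_pdivrMl//.
apply: (@le_trans _ _ (\esum_(c in C) ((`|s| ^+ n)%:E * (box_volume c)%:E))%E); last first.
  by apply: esumZl_le; [exact: ltW|exact: volE_ge0].
apply: (@le_trans _ _ (\esum_(c in C) (box_volume (box_affine s b c))%:E)%E); last first.
  by apply: le_esum => c _; rewrite box_volume_affine.
apply: le_trans (esum_image_le _ _ (@volE_ge0 R n)).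
apply: countable_cover_outer; first exact: sub_countable (card_image_le _ _) cC.
move=> _ [x /XC[c Cc cx] <-]; exists (box_affine s b c); first by exists c.
by apply: affine_box; exists x.
Qed.

(** Affine maps send boxes to boxes, which gives one inequality; the inverse
    affine map gives the other. *)
Lemma outer_affine s b X : s != 0 ->
  outer (affine s b @` X) = ((`|s| ^+ n)%:E * outer X)%E.
Proof.
move=> s0; have sn0 : 0 < `|s| ^+ n by rewrite exprn_gt0// normr_gt0.
apply/eqP; rewrite eq_le outer_affine_le//= -lee_pdivlMl//.
have := @outer_affine_le s^-1 (- (s^-1 *: b)) (affine s b @` X).
rewrite invr_eq0 => /(_ s0); rewrite image_comp -exprVn normfV.
rewrite [X in outer X](_ : _ = X)//.
by rewrite -[RHS]image_id; apply: eq_imagel => x _ /=; rewrite affineK.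
Qed.

Lemma affine_preimage s b X : s != 0 ->
  affine s b @^-1` X = affine s^-1 (- (s^-1 *: b)) @` X.
Proof.
move=> s0; apply/seteqP; split=> [x Xx|_ [x Xx <-] /=]; last by rewrite affineKV.
by exists (affine s b x) => //; rewrite affineK.
Qed.

Lemma outer_affine_preimage s b X : s != 0 ->
  outer (affine s b @^-1` X) = ((`|s|^-1 ^+ n)%:E * outer X)%E.
Proof.
by move=> s0; rewrite affine_preimage// outer_affine ?invr_eq0// normfV.
Qed.

Lemma caratheodory_affine_preimage s b A : s != 0 ->
  outer.-caratheodory A -> outer.-caratheodory (affine s b @^-1` A).
Proof.
move=> s0 cA X.
have key Y : outer Y = ((`|s|^-1 ^+ n)%:E * outer (affine s b @` Y))%E.
  rewrite outer_affine// muleA -EFinM -exprMn mulVf ?expr1n ?mul1e//.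
  by rewrite normr_eq0.
rewrite key (cA (affine s b @` X)) ge0_muleDr ?lebesgue_outer_ge0//.
congr (_ + _)%E; rewrite [RHS]key; congr (_ * outer _)%E.
  apply/seteqP; split=> [_ [[x Xx <-] Ax]|_ [x [Xx Ax] <-]]; first by exists x.
  by split=> //; exists x.
apply/seteqP; split=> [_ [[x Xx <-] Ax]|_ [x [Xx Ax] <-]]; first by exists x.
by split=> //; exists x.
Qed.

Lemma measurable_affine s b : s != 0 ->
  measurable_fun setT (affine s b : lebesgueType R n -> lebesgueType R n).
Proof.
move=> s0 _ A mA; rewrite setTI.
have h : outer.-caratheodory (affine s b @^-1` A).
  by apply: caratheodory_affine_preimage.
exact: h.
Qed.

Lemma ge0_integral_affine s b (G : V -> \bar R) : s != 0 ->
  measurable_fun setT (G : lebesgueType R n -> \bar R) ->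
  (forall x, 0 <= G x)%E ->
  (\int[mu]_x G (affine s b x) = (`|s|^-1 ^+ n)%:E * \int[mu]_x G x)%E.
Proof.
move=> s0 mG G0.
have sn0 : 0 <= `|s|^-1 ^+ n by rewrite exprn_ge0// invr_ge0.
rewrite -[X in (X * _)%E]/((NngNum sn0)%:num%:E) -ge0_integral_mscale//.
transitivity (\int[pushforward mu (affine s b : lebesgueType R n -> lebesgueType R n)]_x
    (G : lebesgueType R n -> \bar R) x)%E.
  by rewrite (ge0_integral_pushforward (measurable_affine b s0) mu measurableT).
apply: eq_measure_integral; first exact: measurable_affine.
by move=> mT A mA _; exact: outer_affine_preimage.
Qed.

Lemma Rintegral_affine s b (G : V -> R) : s != 0 ->
  mu.-integrable setT (EFin \o G) ->
  \int[mu]_x G (affine s b x) = `|s|^-1 ^+ n * \int[mu]_x G x.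
Proof.
move=> s0 iG; have mGE := measurable_int _ iG.
have e1 := ge0_integral_affine b s0 (measurable_funepos mGE) (fun x => funepos_ge0 _ x).
have e2 := ge0_integral_affine b s0 (measurable_funeneg mGE) (fun x => funeneg_ge0 _ x).
rewrite /Rintegral [in RHS]integralE.
transitivity (fine ((`|s|^-1 ^+ n)%:E * (\int[mu]_x (EFin \o G)^\+ x) -
    (`|s|^-1 ^+ n)%:E * (\int[mu]_x (EFin \o G)^\- x))%E).
  by rewrite integralE -e1 -e2; congr (fine (_ - _)%E); apply: eq_integral => x _; rewrite ?funeposE ?funenegE.
have [p q] := (integrable_pos_fin_num measurableT iG, integrable_neg_fin_num measurableT iG).
rewrite -[X in _ = _ * fine X]/(\int[mu]_x (EFin \o G)^\+ x - \int[mu]_x (EFin \o G)^\- x)%E.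
rewrite -muleBr//; first by rewrite fineM// fin_numB p q.
by rewrite fin_num_adde_defr.
Qed.

End AffineChange.

(** * Null sets *)

Section NullSets.
Context (R : realType) (n : nat).
Local Notation V := 'rV[R]_n.
Local Notation outer := (@lebesgue_outer R n).
Local Notation mu := (@lebesgue_Rn R n).
Implicit Types (X A : set V) (x y : V) (r : R).

Lemma outer_bigcup0 (F : nat -> set V) : (forall k, outer (F k) = 0%E) ->
  outer (\bigcup_k F k) = 0%E.
Proof.
move=> F0; apply/eqP; rewrite eq_le lebesgue_outer_ge0 andbT.
apply: le_trans (lebesgue_outer_sigma_subadditive F) _.
by rewrite eseries0.
Qed.

Lemma outer_subset0 X A : X `<=` A -> outer A = 0%E -> outer X = 0%E.
Proof.
move=> XA A0; apply/eqP; rewrite eq_le lebesgue_outer_ge0 andbT -A0.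
exact: le_lebesgue_outer.
Qed.

Lemma bounded_finite_measure A : bounded_set A -> (outer A < +oo)%E.
Proof.
move=> [M [_ hM]]; pose B := `|M| + 1.
have AB x : A x -> `|x| <= B.
  by apply: hM; rewrite /B (le_lt_trans (ler_norm _))// ltrDl.
pose c : V * V := (const_mx (- B), const_mx B).
apply: (@le_lt_trans _ _ (\esum_(c in [set c]) (box_volume c)%:E)%E); last first.
  by rewrite esum_set1 ?ltry//; exact: volE_ge0.
apply: countable_cover_outer; first exact: countable1.
move=> x Ax; exists c => // i; rewrite !mxE -ler_norml.
exact: le_trans (coord_le_norm x i) (AB _ Ax).
Qed.

(** Otherwise X would be covered by countably many rational balls, each meeting X
    in a null set. *)
Lemma nonnull_local X r : 0 < r -> outer X != 0%E ->
  exists2 y, X y & outer (X `&` ball y r) != 0%E.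
Proof.
move=> r0 X0; apply: contrapT => h.
have r20 : 0 < r / 2 by rewrite divr_gt0.
pose F k : set V := if unpickle k is Some q
  then X `&` ball (map_mx ratr (q : 'rV[rat]_n) : V) (r / 2) else set0.
move/negP: X0; apply; apply/eqP; apply: outer_subset0 (outer_bigcup0 (F := F) _).
  move=> x Xx; have [q hq] := rational_ball x r20; exists (pickle q) => //.
  by rewrite /F pickleK.
move=> k; rewrite /F; case: unpickle => [q|]; last exact: lebesgue_outer0.
have [[y [Xy qy]]|ne] := pselect ((X `&` ball (map_mx ratr q : V) (r / 2)) !=set0); last first.
  rewrite (_ : _ `&` _ = set0) ?lebesgue_outer0//.
  by apply/seteqP; split=> // z Xz; case: ne; exists z.
apply: contrapT => /eqP h0; apply: h; exists y => //.
apply: contra h0 => /eqP h0; apply/eqP; apply: outer_subset0 h0.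
move=> z [Xz qz]; split=> //.
by rewrite [r]splitr; apply: ball_triangle qz; exact: ball_sym.
Qed.

(** Scaling reduces the claim to the whole space: were one ball null, R^n would
    be a countable union of null dilates, and no function could have integral 1. *)
Lemma ball_measure_gt0 (J : V -> R) x r : kernel_assumption J -> 0 < r ->
  (0 < mu (ball x r))%E.
Proof.
move=> [cJ J0 _ J1] r0; rewrite lt_neqAle lebesgue_outer_ge0 andbT eq_sym.
apply/negP => /eqP b0.
have T0 : outer setT = 0%E.
  pose F k : set V := affine k.+1%:R (- (k.+1%:R *: x)) @` ball x r.
  apply: outer_subset0 (outer_bigcup0 (F := F) _) => [y _|k]; last first.
    by rewrite outer_affine ?pnatr_eq0// [outer _]b0 mule0.
  near \oo => k.
  exists k => //; exists (affine k.+1%:R^-1 x y).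
    rewrite -ball_normE/= /affine opprD addrCA subrr addr0 normrN normrZ.
    rewrite ger0_norm ?invr_ge0// ltr_pdivrMl// mulrC -ltr_pdivrMl//.
    rewrite (lt_trans (_ : _ < k%:R))// ?ltr_nat//.
    by near: k; exact: nbhs_infty_gtr.
  by rewrite /affine scalerDr scalerA mulfV// scale1r addrK.
have := J1; rewrite (_ : (\int[mu]_x (J x)%:E)%E = 0%E) => [/esym/eqP|].
  by rewrite eqe oner_eq0.
apply: null_set_integral => //.
by apply/measurable_EFinP; exact: measurable_continuous.
Unshelve. all: by end_near. Qed.

Lemma convex_combination A x y (t : R) : convex_set A -> A x -> A y ->
  0 <= t <= 1 -> A (t *: x + (1 - t) *: y).
Proof.
move=> cA Ax Ay /andP[t0 t1].
by have := cA x y (Itv01 t0 t1); rewrite !inE => /(_ Ax Ay).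
Qed.

(** Dilating a convex open set from an interior point by any factor 1 + e
    swallows its closure. *)
Lemma convex_closure_shrink A x (e : R) : open A -> convex_set A -> A x -> 0 < e ->
  closure A `<=` affine (1 + e) (- (e *: x)) @` A.
Proof.
move=> oA cA Ax e0 y cy.
have e1 : 0 < 1 + e by rewrite addr_gt0.
have /nbhs_ballP[r /= r0 rA] : nbhs x A by apply: open_nbhs_nbhs.
have [z [Az yz]] := cy (ball y (e * r)) (nbhsx_ballx _ _ (mulr_gt0 e0 r0)).
pose t : R := (1 + e)^-1.
have t01 : 0 <= t <= 1 by rewrite /t invr_ge0 invf_le1// ltW//= lerDl ltW.
pose w := x + e^-1 *: (y - z).
have Aw : A w.
  apply: rA; rewrite -ball_normE/= /w opprD addrA subrr sub0r normrN normrZ.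
  rewrite gtr0_norm ?invr_gt0// ltr_pdivrMl//.
  by move: yz; rewrite -ball_normE.
exists (t *: z + (1 - t) *: w); first exact: convex_combination.
apply/rowP => i; rewrite !mxE /t; field.
by rewrite !gt_eqF.
Qed.

(** By [convex_closure_shrink] the measure of the closure is at most (1 + e)^n
    times that of A.  This is needed because data are compared with 0 on the
    closure of the domain, whereas dispersal integrates over the domain. *)
Lemma convex_boundary_null A : open A -> convex_set A -> bounded_set A ->
  outer (closure A `\` A) = 0%E.
Proof.
move=> oA cA bA; have [[x Ax]|ne] := pselect (A !=set0); last first.
  rewrite (_ : A = set0) ?closure0 ?set0D ?lebesgue_outer0//.
  by apply/seteqP; split=> // z Xz; case: ne; exists z.
have fA := bounded_finite_measure bA.
have nA : outer A \is a fin_num by rewrite ge0_fin_numE ?lebesgue_outer_ge0.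
have le e : 0 < e -> (outer (closure A) <= ((1 + e) ^+ n)%:E * outer A)%E.
  move=> e0; apply: le_trans (le_lebesgue_outer (convex_closure_shrink oA cA Ax e0)) _.
  have e1 : 0 < 1 + e by rewrite addr_gt0.
  by rewrite outer_affine ?gt_eqF// gtr0_norm.
have fcA : (outer (closure A) < +oo)%E.
  by apply: le_lt_trans (le 1 ltr01) _; rewrite -(fineK nA) -EFinM ltry.
have ncA : outer (closure A) \is a fin_num by rewrite ge0_fin_numE ?lebesgue_outer_ge0.
have le1 : fine (outer (closure A)) <= fine (outer A).
  have cv : (1 + e) ^+ n * fine (outer A) @[e --> (0:R)^'+] --> (1 + 0) ^+ n * fine (outer A).
    apply: cvg_at_right_filter; apply: cvgM; last exact: cvg_cst.
    have c1 : continuous (fun e : R => 1 + e).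
      by move=> e; apply: cvgD; [exact: cvg_cst|exact: cvg_id].
    exact: (continuous_comp (c1 0) (@exprn_continuous R n (1 + 0))).
  rewrite addr0 expr1n mul1r in cv.
  apply: (cvgr_to_ge cv); apply: filterS (nbhs_right_gt 0) => e e0.
  by have := le _ e0; rewrite -(fineK nA) -(fineK ncA) -EFinM lee_fin.
have mA := measurable_open oA.
have mcA : measurable (closure A : set (lebesgueType R n)).
  by apply: measurable_closed; exact: closed_closure.
have e : (mu (closure A `\` A) = mu (closure A) - mu (closure A `&` A))%E.
  exact: measureD.
rewrite (_ : closure A `&` A = A) in e; last by apply/setIidPr; exact: subset_closure.
transitivity (outer (closure A) - outer A)%E; first exact: e.
rewrite -(fineK nA) -(fineK ncA) -EFinB.
congr (_%:E); apply/eqP; rewrite eq_le subr_le0 le1 subr_ge0/=.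
by apply: fine_le => //; apply: le_lebesgue_outer; exact: subset_closure.
Qed.

End NullSets.

(** * Integrals of bounded functions *)

Section BoundedSupportIntegrals.
Context (R : realType) (n : nat).
Local Notation V := 'rV[R]_n.
Local Notation mu := (@lebesgue_Rn R n).

Lemma integrable_bounded (D : set (lebesgueType R n)) (F : V -> R) (C : R) :
  measurable D -> bounded_set (D : set V) ->
  measurable_fun D (F : lebesgueType R n -> R) ->
  (forall z, D z -> `|F z| <= C) -> mu.-integrable D (EFin \o F).
Proof.
move=> mD bD mF FC; apply: measurable_bounded_integrable => //.
  exact: bounded_finite_measure.
exists C; split; first exact: num_real.
by move=> x Cx z Dz; apply: le_trans (FC _ Dz) (ltW Cx).
Qed.

Lemma integrable_bounded_support (F : V -> R) (C S : R) (y : V) :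
  measurable_fun setT (F : lebesgueType R n -> R) ->
  (forall z, `|F z| <= C) -> (forall z, F z != 0 -> `|y - z| < S) ->
  mu.-integrable setT (EFin \o F).
Proof.
move=> mF FC FS; have mB := @measurable_rVball R n y S.
have iB : mu.-integrable (ball y S) (EFin \o F).
  apply: (@integrable_bounded _ _ C) => //; last exact: measurable_funTS.
  exists (`|y| + S); split; first exact: num_real.
  move=> B hB z; rewrite -ball_normE/= => yz; apply: ltW.
  apply: lt_trans hB; rewrite -[z]opprK -(subKr y z) opprK.
  by apply: le_lt_trans (ler_normB _ _) _; rewrite ltrD2l.
move: iB; rewrite integrable_mkcond//; apply: eq_integrable => // z _.
rewrite /patch; case: ifPn => // /negP zB; rewrite /= .
have [->//|/FS] := eqVneq (F z) 0; move=> yz; case: zB; apply/mem_set.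
by rewrite -ball_normE.
Qed.

Lemma Rintegral_ge_on (D E : set (lebesgueType R n)) (F : V -> R) (c : R) :
  measurable D -> measurable E -> E `<=` D -> (mu E < +oo)%E ->
  mu.-integrable D (EFin \o F) -> (forall z, D z -> 0 <= F z) ->
  (forall z, E z -> c <= F z) ->
  c * fine (mu E) <= \int[mu]_(z in D) F z.
Proof.
move=> mD mE ED fE iF F0 Fc; rewrite -Rintegral_cst//.
have -> : \int[mu]_(z in E) c = \int[mu]_(z in D) ((cst c) \_ E) z.
  by rewrite -Rintegral_mkcondr (proj2 (@setIidPr _ _ _) ED).
apply: le_Rintegral => //.
  rewrite (_ : EFin \o _ = (EFin \o cst c) \_ E); last by rewrite restrict_EFin.
  apply: (integrableS measurableT mD) => //; apply/(integrable_mkcond _ mE).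
  apply: measurable_bounded_integrable => //.
  by exists `|c|; split=> [|x cx z _]; [exact: num_real|exact: ltW].
move=> z Dz; rewrite /patch; case: ifPn => [/set_mem/Fc//|_].
exact: F0.
Qed.

End BoundedSupportIntegrals.

(** * The profile of the barrier *)

Section ContinuityCombinators.
Context (R : realType) (T : topologicalType).
Implicit Types f g : T -> R.

Lemma continuous_mulR f g : continuous f -> continuous g ->
  continuous (fun x => f x * g x).
Proof. by move=> cf cg x; apply: cvgM; [exact: cf|exact: cg]. Qed.

Lemma continuous_addR f g : continuous f -> continuous g ->
  continuous (fun x => f x + g x).
Proof. by move=> cf cg x; apply: cvgD; [exact: cf|exact: cg]. Qed.

Lemma continuous_cstR (a : R) : continuous (fun _ : T => a).
Proof. by move=> x; exact: cvg_cst. Qed.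

Lemma continuous_compR (U : topologicalType) (g : U -> R) (f : T -> U) :
  continuous f -> continuous g -> continuous (fun x => g (f x)).
Proof. by move=> cf cg x; apply: (@continuous_comp _ _ _ f g x); [exact: cf|exact: cg]. Qed.

Lemma continuous_sumR (I : finType) (h : I -> T -> R) :
  (forall i, continuous (h i)) -> continuous (fun x => \sum_i h i x).
Proof.
move=> ch x; apply: (@cvg_sumr R R^o _ _ (index_enum I) xpredT (nbhs x) _
  h (fun i => h i x)) => i _; exact: ch.
Qed.

End ContinuityCombinators.

Section BarrierProfile.
Context (R : realType).
Implicit Types t u X tau : R.

(** The function min 1 (p t / (8 tau^2)) with p t = t (2 tau + t) for t >= 0 and 0
    for t <= 0.  It leaves 0 with a positive slope and is convex until it reaches
    the plateau 1 at t = 2 tau.  Composed with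
    1 - |z - c|^2 / R0^2 it gives the barrier below. *)
Definition profile tau t : R :=
  Num.min 1 (Num.max 0 t * (2 * tau + Num.max 0 t) / (8 * tau ^+ 2)).

Lemma profile01 tau t : 0 < tau -> 0 <= profile tau t <= 1.
Proof.
move=> tau0; rewrite /profile ge_min lexx andbT le_min ler01/=.
have m0 : 0 <= Num.max 0 t by rewrite le_max lexx.
apply: divr_ge0; last by rewrite mulr_ge0 ?sqr_ge0.
by apply: mulr_ge0 => //; apply: addr_ge0 => //; lra.
Qed.

Lemma profile_le0 tau t : t <= 0 -> profile tau t = 0.
Proof. by move=> t0; rewrite /profile max_l// !mul0r min_r. Qed.

Lemma profile_plateau tau t : 0 < tau -> 2 * tau <= t -> profile tau t = 1.
Proof.
move=> tau0 ht; have t0 : 0 <= t by lra.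
rewrite /profile max_r// min_l// ler_pdivlMr ?mulr_gt0 ?exprn_gt0//.
by rewrite mul1r; nra.
Qed.

Lemma continuous_profile tau : continuous (profile tau).
Proof.
have cm : continuous (fun t : R => Num.max 0 t).
  by move=> t; apply: continuous_max; [exact: cvg_cst|exact: cvg_id].
have cp : continuous (fun t : R =>
    Num.max 0 t * (2 * tau + Num.max 0 t) / (8 * tau ^+ 2)).
  apply: continuous_mulR; last exact: continuous_cstR.
  apply: continuous_mulR => //; apply: continuous_addR => //.
  exact: continuous_cstR.
move=> t; apply: (@continuous_min _ _ (cst 1) (fun t : R =>
    Num.max 0 t * (2 * tau + Num.max 0 t) / (8 * tau ^+ 2)) t).
  exact: cvg_cst.
exact: cp.
Qed.

(** Where t >= tau the profile is bounded away from 0 and a small change X of t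
    costs at most a factor 1 - eta. *)
Lemma profile_interior tau t X eta : 0 < tau -> 0 <= eta <= 1 -> tau <= t ->
  `|X| <= eta / 2 * tau -> (1 - eta) * profile tau t <= profile tau (t - X).
Proof.
move=> tau0 /andP[e0 e1] ht; rewrite ler_norml => /andP[X1 X2].
have t0 : 0 < t by lra.
have lt : (1 - eta / 2) * t <= t - X.
  have : eta / 2 * tau <= eta / 2 * t by rewrite ler_wpM2l// divr_ge0.
  by lra.
have ltp : 0 < (1 - eta / 2) * t by rewrite mulr_gt0//; lra.
have tX : 0 < t - X by lra.
rewrite /profile !max_r ?(ltW t0) ?(ltW tX)//.
have K0 : 0 < 8 * tau ^+ 2 by rewrite mulr_gt0// exprn_gt0.
set p := t * (2 * tau + t) / (8 * tau ^+ 2).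
have p0 : 0 < p by rewrite divr_gt0// mulr_gt0// addr_gt0// mulr_gt0.
have mp0 : 0 <= Num.min 1 p by rewrite le_min ler01 ltW.
rewrite le_min; apply/andP; split.
  have h : Num.min 1 p <= 1 by rewrite ge_min lexx.
  by nra.
apply: (@le_trans _ _ ((1 - eta) * p)).
  by rewrite ler_wpM2l ?subr_ge0// ge_min lexx orbT.
rewrite /p mulrA ler_pdivrMr// divfK ?gt_eqF//.
apply: (@le_trans _ _ ((1 - eta / 2) * t * (2 * tau + (1 - eta / 2) * t))); last first.
  by rewrite ler_pM ?addr_ge0 ?(ltW ltp)// ?lerD2l// mulr_ge0// ltW.
have h1 : 0 <= t * tau by rewrite mulr_ge0// ltW.
have h2 : 0 <= t * t by rewrite mulr_ge0// ltW.
have h3 : 0 <= eta * (t * tau) by rewrite mulr_ge0.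
have h4 : 0 <= eta ^+ 2 * (t * t) by rewrite mulr_ge0// sqr_ge0.
by lra.
Qed.

(** Near the edge of the support a relative loss cannot be afforded; here the
    exact quadratic expansion of the profile is a lower bound, because the
    quadratic is nonpositive where it is truncated and stays below 1. *)
Lemma profile_edge tau t X : 0 < tau -> 0 < t <= tau -> `|X| <= tau ->
  profile tau t + (X ^+ 2 - X * (2 * t + 2 * tau)) / (8 * tau ^+ 2)
    <= profile tau (t - X).
Proof.
move=> tau0 /andP[t0 ht]; rewrite ler_norml => /andP[X1 X2].
have K0 : 0 < 8 * tau ^+ 2 by rewrite mulr_gt0// exprn_gt0.
have E1 : profile tau t = t * (2 * tau + t) / (8 * tau ^+ 2).
  rewrite /profile max_r ?(ltW t0)// min_r// ler_pdivrMr// mul1r.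
  by nra.
rewrite E1 -mulrDl.
have -> : t * (2 * tau + t) + (X ^+ 2 - X * (2 * t + 2 * tau)) =
    (t - X) * (2 * tau + (t - X)) by ring.
have [tX|tX] := leP (t - X) 0.
  rewrite profile_le0// pmulr_lle0 ?invr_gt0//.
  by rewrite mulr_le0_ge0//; lra.
rewrite /profile max_r ?(ltW tX)// le_min lexx andbT ler_pdivrMr// mul1r.
by nra.
Qed.

Lemma edge_balance (P Q U G H X2 L : R) : G - H <= X2 -> H <= Q -> U <= P ->
  - (P + Q) + L + G <= X2 - (U - L).
Proof. by move=> h1 h2 h3; lra. Qed.

Lemma edge_gap (q tau : R) : 1 - q < tau -> tau <= 1 / 4 -> 3 / 4 <= q.
Proof. by move=> h1 h2; lra. Qed.

Lemma edge_margin (a b kap : R) : 0 < kap -> a <= kap / 4 -> b <= kap ->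
  a + b <= 3 / 2 * kap.
Proof. by move=> h0 h1 h2; lra. Qed.

Lemma sum_thresholds (p q r : R) : 0 <= p -> 0 <= q -> 1 + p + q <= r ->
  [/\ 1 <= r, p <= r & q <= r].
Proof. by move=> p0 q0 h; split; lra. Qed.

End BarrierProfile.

(** * The rescaled kernel and the barrier *)

Section Kernel.
Context (R : realType) (n : nat).
Local Notation V := 'rV[R]_n.
Local Notation mu := (@lebesgue_Rn R n).
Variables (J : V -> R) (B S : R).
Hypothesis cJ : continuous J.
Hypothesis J0 : forall x, 0 <= J x.
Hypothesis J1 : (\int[mu]_x (J x)%:E = 1)%E.
Hypothesis JB : forall x, J x <= B.
Hypothesis S0 : 0 < S.
Hypothesis JS : forall x, J x != 0 -> `|x| < S.
Hypothesis Jcent : centered J.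
Hypothesis J00 : 0 < J 0.
Hypothesis n0 : (0 < n)%N.

Definition ker (r : R) (y z : V) : R := scaled_kernel J r (y - z).

Lemma ker_ge0 r y z : 0 <= r -> 0 <= ker r y z.
Proof. by move=> r0; rewrite /ker /scaled_kernel mulr_ge0// exprn_ge0. Qed.

Lemma ker_le r y z : 0 <= r -> ker r y z <= r ^+ n * B.
Proof. by move=> r0; rewrite /ker /scaled_kernel ler_wpM2l// exprn_ge0. Qed.

Lemma ker_support r y z : 0 < r -> ker r y z != 0 -> `|r *: (y - z)| < S.
Proof.
by move=> r0; rewrite /ker /scaled_kernel mulf_eq0 negb_or => /andP[_ /JS].
Qed.

Lemma ker_affine r y z : ker r y z = r ^+ n * J (affine (- r) (r *: y) z).
Proof.
by rewrite /ker /scaled_kernel /affine scalerBr addrC scaleNr.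
Qed.

Lemma continuous_affine s (b : V) : continuous (affine s b).
Proof.
by move=> x; exact: cvgD (@scaler_continuous _ _ s x) (cvg_cst b).
Qed.

Lemma continuous_ker r y : continuous (ker r y).
Proof.
rewrite (_ : ker r y = fun z => r ^+ n * J (affine (- r) (r *: y) z)); last first.
  by apply/funext => z; rewrite ker_affine.
apply: continuous_mulR; first exact: continuous_cstR.
by apply: continuous_compR => //; exact: continuous_affine.
Qed.

Lemma measurable_ker r y (D : set (lebesgueType R n)) : measurable D ->
  measurable_fun D (ker r y : lebesgueType R n -> R).
Proof. by move=> mD; apply: measurable_continuous => //; exact: continuous_ker. Qed.

Lemma integrable_ker_mul r y (h : V -> R) (C : R) : 0 < r ->
  measurable_fun setT (h : lebesgueType R n -> R) ->
  (forall z, `|r *: (y - z)| < S -> `|h z| <= C) ->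
  mu.-integrable setT (EFin \o (fun z => ker r y z * h z)).
Proof.
move=> r0 mh hC; apply: (@integrable_bounded_support _ _ _ (r ^+ n * B * `|C|) (S / r) y).
- exact: (@measurable_funM _ (lebesgueType R n) R setT (ker r y) h
    (measurable_ker r y measurableT) mh).
- move=> z; have [->|k0] := eqVneq (ker r y z) 0.
    rewrite mul0r normr0 mulr_ge0// mulr_ge0 ?exprn_ge0 ?(ltW r0)//.
    exact: le_trans (J0 0) (JB 0).
  rewrite normrM ger0_norm ?ker_ge0 ?(ltW r0)//.
  rewrite ler_pM ?ker_ge0 ?ker_le ?(ltW r0)//.
  by apply: le_trans (hC z _) (ler_norm _); exact: ker_support.
move=> z; rewrite mulf_eq0 negb_or => /andP[/(ker_support r0)].
by rewrite normrZ gtr0_norm// ltr_pdivlMr// mulrC.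
Qed.

Lemma integral_ker_change r y (G : V -> R) (C : R) : 0 < r -> continuous G ->
  (forall x, `|x| < S -> `|G x| <= C) ->
  \int[mu]_z (ker r y z * G (r *: (y - z))) = \int[mu]_x (J x * G x).
Proof.
move=> r0 cG GC.
have iJG : mu.-integrable setT (EFin \o (fun x => J x * G x)).
  apply: (@integrable_bounded_support _ _ _ (B * `|C|) S 0).
  - apply: measurable_continuous => //.
    exact: continuous_mulR.
  - move=> x; have [->|Jx] := eqVneq (J x) 0.
      by rewrite mul0r normr0 mulr_ge0// (le_trans (J0 0)).
    rewrite normrM ger0_norm// ler_pM//.
    by apply: le_trans (GC x _) (ler_norm _); exact: JS.
  by move=> x; rewrite mulf_eq0 negb_or sub0r normrN => /andP[/JS].
have r1 : - r != 0 by rewrite oppr_eq0 gt_eqF.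
transitivity (\int[mu]_z (r ^+ n * (J (affine (- r) (r *: y) z) * G (affine (- r) (r *: y) z)))).
  apply: eq_Rintegral => z _; rewrite ker_affine mulrA; congr (_ * G _).
  by rewrite /affine scalerBr addrC scaleNr.
rewrite RintegralZl//.
  rewrite (Rintegral_affine (G := fun x => J x * G x) _ r1)//.
  by rewrite normrN gtr0_norm// mulrA -exprMn divff ?gt_eqF// expr1n mul1r.
have h := @integrable_ker_mul r y (fun z => G (r *: (y - z)) / r ^+ n) (C / r ^+ n) r0.
rewrite (_ : _ \o _ = EFin \o (fun z : V => ker r y z * (G (r *: (y - z)) / r ^+ n))).
  apply: h.
    apply: measurable_continuous => //.
    rewrite (_ : (fun z => _) = fun z => G (affine (- r) (r *: y) z) / r ^+ n); last first.
      by apply/funext => x /=; rewrite /affine scalerBr addrC scaleNr.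
    apply: continuous_mulR; last exact: continuous_cstR.
    by apply: continuous_compR => //; exact: continuous_affine.
  move=> z zS; rewrite normrM normfV (gtr0_norm (exprn_gt0 _ r0)).
  by rewrite ler_pM2r ?invr_gt0 ?exprn_gt0// GC.
apply/funext => z /=; rewrite ker_affine; congr (_%:E).
rewrite [RHS]mulrC mulrA mulfVK ?expf_neq0 ?gt_eqF// mulrC; congr (_ * G _).
by rewrite /affine scalerBr addrC scaleNr.
Qed.

Lemma continuous_dot (Y : V) : continuous (fun x : V => \sum_i Y 0 i * x 0 i).
Proof.
apply: continuous_sumR => i; apply: continuous_mulR; first exact: continuous_cstR.
exact: continuous_coord.
Qed.

Lemma dot_le (Y x : V) : `|x| < S -> `|\sum_i Y 0 i * x 0 i| <= \sum_i `|Y 0 i| * S.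
Proof.
move=> xS; apply: le_trans; first exact: ler_norm_sum.
apply: ler_sum => i _; rewrite normrM ler_wpM2l//.
exact: le_trans (coord_le_norm x i) (ltW xS).
Qed.

Lemma integral_ker1 r y : 0 < r -> \int[mu]_z ker r y z = 1.
Proof.
move=> r0; transitivity (\int[mu]_z (ker r y z * cst 1 (r *: (y - z)))).
  by apply: eq_Rintegral => z _; rewrite mulr1.
rewrite (@integral_ker_change _ _ _ 1)//; last 2 first.
- exact: continuous_cstR.
- by move=> x _; rewrite normr1.
transitivity (\int[mu]_x J x); first by apply: eq_Rintegral => z _; rewrite mulr1.
by rewrite /Rintegral J1.
Qed.

Lemma integral_ker_dot r y (Y : V) : 0 < r ->
  \int[mu]_z (ker r y z * \sum_i Y 0 i * (r *: (y - z)) 0 i) = 0.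
Proof.
move=> r0; rewrite (integral_ker_change _ r0 (@continuous_dot Y) (@dot_le Y)).
have iJ i : mu.-integrable setT (EFin \o (fun x => J x * x 0 i)).
  apply: (@integrable_bounded_support _ _ _ (B * S) S 0).
  - apply: measurable_continuous => //; apply: continuous_mulR => //.
    exact: continuous_coord.
  - move=> x; have [->|Jx] := eqVneq (J x) 0.
      by rewrite mul0r normr0 mulr_ge0 ?(ltW S0)// (le_trans (J0 0)).
    rewrite normrM ger0_norm// ler_pM//.
    by apply: le_trans (coord_le_norm x i) (ltW (JS Jx)).
  by move=> x; rewrite mulf_eq0 negb_or sub0r normrN => /andP[/JS].
have key (s : seq 'I_n) :
  mu.-integrable setT (EFin \o (fun x => \sum_(i <- s) Y 0 i * (J x * x 0 i))) /\
  \int[mu]_x (\sum_(i <- s) Y 0 i * (J x * x 0 i)) = 0.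
  elim: s => [|i s [IH1 IH2]].
    under [in X in _ /\ X]eq_Rintegral do rewrite big_nil.
    rewrite Rintegral_cst// mul0r; split=> //.
    rewrite (_ : _ \o _ = cst 0%E); last by apply/funext => x /=; rewrite big_nil.
    exact: integrable0.
  have iY : mu.-integrable setT (EFin \o (fun x => Y 0 i * (J x * x 0 i))).
    rewrite (_ : _ \o _ = (fun x : V => (Y 0 i)%:E * (EFin \o (fun x : V => (J x * x 0 i)%R)) x)%E).
      exact: integrableZl.
    by apply/funext => x.
  under [in X in _ /\ X]eq_Rintegral do rewrite big_cons.
  rewrite RintegralD// RintegralZl// Jcent mulr0 IH2 addr0; split=> //.
  rewrite (_ : _ \o _ = (fun x : V => (EFin \o (fun x : V => (Y 0 i * (J x * x 0 i))%R)) x +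
    (EFin \o (fun x : V => (\sum_(i <- s) Y 0 i * (J x * x 0 i))%R)) x)%E).
    exact: integrableD.
  by apply/funext => x /=; rewrite big_cons EFinD.
rewrite -[RHS](key (index_enum 'I_n)).2; apply: eq_Rintegral => x _.
by rewrite mulr_sumr; apply: eq_bigr => i _; rewrite mulrCA.
Qed.

Lemma integrable_second_moment (Y : V) :
  mu.-integrable setT (EFin \o (fun x => J x * (\sum_i Y 0 i * x 0 i) ^+ 2)).
Proof.
pose C := \sum_i `|Y 0 i| * S.
apply: (@integrable_bounded_support _ _ _ (B * C ^+ 2) S 0).
- apply: measurable_continuous => //; apply: continuous_mulR => //.
  by apply: continuous_mulR; exact: continuous_dot.
- move=> x; have [->|Jx] := eqVneq (J x) 0.
    by rewrite mul0r normr0 mulr_ge0 ?sqr_ge0// (le_trans (J0 0)).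
  rewrite normrM ger0_norm// ler_pM// normrX.
  rewrite ler_sqr ?nnegrE//; first exact: dot_le (JS Jx).
  by rewrite /C sumr_ge0// => i _; rewrite mulr_ge0// ltW.
by move=> x; rewrite mulf_eq0 negb_or sub0r normrN => /andP[/JS].
Qed.

(** J exceeds J 0 / 2 near the origin, so a small ball centred on the axis where
    Y has its largest coordinate already contributes a multiple of |Y|^2. *)
Lemma second_moment_ge : exists2 kap : R, 0 < kap & forall Y : V,
  kap * \sum_i Y 0 i ^+ 2 <= \int[mu]_x (J x * (\sum_i Y 0 i * x 0 i) ^+ 2).
Proof.
have [dl dl0 hd] : exists2 d : R, 0 < d & forall x, `|x| < d -> J 0 / 2 <= J x.
  have h2 : 0 < J 0 / 2 by rewrite divr_gt0.
  have : \forall x \near (0 : V), `|J 0 - J x| < J 0 / 2.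
    by have /cvgrPdist_lt/(_ _ h2) := @cJ (0 : V).
  move=> /nbhs_ballP[d /= d0 h]; exists d => // x xd.
  have /= := h x; rewrite -ball_normE/= sub0r normrN => /(_ xd).
  by rewrite ltr_norml => /andP[_]; lra.
have nR : 0 < n%:R :> R by rewrite ltr0n.
(* The ball of centre dl/2 on the i-th axis has radius e, so small that the
   n - 1 other coordinates contribute at most dl/8 to the scalar product. *)
pose e := dl / (8 * n%:R).
have e0 : 0 < e by rewrite divr_gt0// mulr_gt0.
have ne : n%:R * e = dl / 8 by rewrite /e; field; rewrite gt_eqF.
have n1 : 1 <= n%:R :> R by rewrite ler1n.
have ed : e <= dl / 8 by rewrite -ne ler_peMl// ltW.
pose ctr (i : 'I_n) : V := (dl / 2) *: delta_mx 0 i.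
have ctrE i j : ctr i 0 j = dl / 2 * (j == i)%:R by rewrite !mxE eqxx.
have kJ : kernel_assumption J by split.
have /choice[mm mmP] : forall i, exists q : R, 0 < q /\ (mu (ball (ctr i) e) = q%:E)%E.
  move=> i; have h0 := ball_measure_gt0 (ctr i) kJ e0.
  have hf : (mu (ball (ctr i) e) < +oo)%E.
    apply: bounded_finite_measure; exists (`|ctr i| + e); split; first exact: num_real.
    move=> M hM z; rewrite -ball_normE/= => yz; apply: ltW; apply: lt_trans hM.
    rewrite -[z]opprK -(subKr (ctr i) z) opprK.
    by apply: le_lt_trans (ler_normB _ _) _; rewrite ltrD2l.
  exists (fine (mu (ball (ctr i) e))); split; first by rewrite fine_gt0// h0.
  by rewrite fineK// ge0_fin_numE// ltW.
pose mmin := \big[Order.min/1]_i mm i.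
have mmin0 : 0 < mmin.
  rewrite /mmin; elim/big_ind: _ => // [a b a0 b0|i _]; first by rewrite lt_min a0.
  by have [] := mmP i.
have mminP i : mmin <= mm i by apply: bigmin_le_cond.
exists (J 0 / 2 * (dl / 4) ^+ 2 * mmin / n%:R).
  by rewrite divr_gt0// !mulr_gt0// ?divr_gt0// exprn_gt0// divr_gt0.
move=> Y.
case: (@arg_maxP _ _ 'I_n (Ordinal n0) xpredT (fun i => `|Y 0 i|) isT) => i _ hi.
have sumY : \sum_j Y 0 j ^+ 2 <= n%:R * Y 0 i ^+ 2.
  rewrite mulr_natl -[X in _ *+ X](card_ord n) -sumr_const.
  apply: ler_sum => j _; rewrite -(real_normK (num_real (Y 0 j))).
  by rewrite -(real_normK (num_real (Y 0 i))) ler_sqr ?nnegrE//; exact: hi.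
apply: (@le_trans _ _ (J 0 / 2 * ((dl / 4) ^+ 2 * Y 0 i ^+ 2) * mm i)).
  rewrite mulrAC ler_pdivrMr//.
  have a0 : 0 <= J 0 / 2 * (dl / 4) ^+ 2 by rewrite mulr_ge0 ?sqr_ge0// divr_ge0// ltW.
  apply: (@le_trans _ _ (J 0 / 2 * (dl / 4) ^+ 2 * mm i * (n%:R * Y 0 i ^+ 2))).
    apply: ler_pM => //; [by rewrite mulr_ge0// ltW|by rewrite sumr_ge0// => j _; rewrite sqr_ge0|].
    by rewrite ler_wpM2l.
  by rewrite le_eqVlt; apply/orP; left; apply/eqP; ring.
have [mi0 miE] := mmP i; rewrite -[mm i]/(fine (mm i)%:E) -miE.
apply: Rintegral_ge_on => //.
- exact: measurable_rVball.
- by rewrite miE ltry.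
- exact: integrable_second_moment.
- by move=> z _; rewrite mulr_ge0// sqr_ge0.
move=> z /ball_coord[_ hz].
have zi : `|dl / 2 - z 0 i| < e by have := hz i; rewrite ctrE eqxx mulr1.
have zj j : j != i -> `|z 0 j| < e.
  by move=> /negbTE ji; have := hz j; rewrite ctrE ji mulr0 sub0r normrN.
have zd : `|z| < dl.
  apply: norm_lt_coord => // j; have [->|ji] := eqVneq j i.
    by move: zi; rewrite ltr_norml => /andP[? ?]; rewrite ltr_norml; apply/andP; split; lra.
  by apply: lt_le_trans (zj _ ji) _; lra.
apply: ler_pM (hd _ zd) _; [by rewrite divr_ge0// ltW|by rewrite mulr_ge0// sqr_ge0|].
rewrite -exprMn -(real_normK (num_real (dl / 4 * Y 0 i))) -(real_normK (num_real (\sum_j _))).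
rewrite ler_sqr ?nnegrE// normrM (gtr0_norm (divr_gt0 dl0 _))//.
rewrite (bigD1 i)//=; set rest := \sum_(j | _) _.
have restle : `|rest| <= `|Y 0 i| * (n%:R * e).
  apply: le_trans; first exact: ler_norm_sum.
  apply: (@le_trans _ _ (\sum_(j < n) `|Y 0 i| * e)).
    rewrite [leRHS](bigD1 i)//= ler_wpDl ?(mulr_ge0 _ (ltW e0))//.
    apply: ler_sum => j ji; rewrite normrM ler_pM//; first exact: hi.
    by rewrite ltW// zj.
  by rewrite sumr_const card_ord -[leLHS]mulr_natl mulrCA.
have yz : `|Y 0 i| * (3 * dl / 8) <= `|Y 0 i * z 0 i|.
  rewrite normrM ler_wpM2l//; apply: le_trans (ler_norm _).
  by move: zi; rewrite ltr_norml => /andP[? ?]; lra.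
have := lerB_normD (Y 0 i * z 0 i) rest.
rewrite ne in restle.
have Yi := normr_ge0 (Y 0 i).
by nra.
Qed.

Lemma ker_mono r y (h1 h2 : V -> R) (C : R) : 0 < r ->
  measurable_fun setT (h1 : lebesgueType R n -> R) ->
  measurable_fun setT (h2 : lebesgueType R n -> R) ->
  (forall z, `|r *: (y - z)| < S -> `|h1 z| <= C) ->
  (forall z, `|r *: (y - z)| < S -> `|h2 z| <= C) ->
  (forall z, `|r *: (y - z)| < S -> h1 z <= h2 z) ->
  \int[mu]_z (ker r y z * h1 z) <= \int[mu]_z (ker r y z * h2 z).
Proof.
move=> r0 mh1 mh2 h1C h2C le12; apply: le_Rintegral => //.
- exact: integrable_ker_mul mh1 h1C.
- exact: integrable_ker_mul mh2 h2C.
move=> z _; have [->|k0] := eqVneq (ker r y z) 0; first by rewrite !mul0r.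
by rewrite ler_wpM2l ?ker_ge0 ?(ltW r0)// le12//; exact: ker_support k0.
Qed.

(** The kernel has mass 1 and first moment 0, so averaging a quadratic
    polynomial in r (y - z) only leaves the constant term and the second moment. *)
Lemma integral_ker_quadratic r y (Y : V) (a b c : R) : 0 < r ->
  \int[mu]_z (ker r y z * (a + b * (\sum_i Y 0 i * (r *: (y - z)) 0 i) +
      c * (\sum_i Y 0 i * (r *: (y - z)) 0 i) ^+ 2)) =
  a + c * \int[mu]_x (J x * (\sum_i Y 0 i * x 0 i) ^+ 2).
Proof.
move=> r0; pose dt (x : V) := \sum_i Y 0 i * x 0 i.
pose C := \sum_i `|Y 0 i| * S.
have C0 : 0 <= C by rewrite /C sumr_ge0// => i _; rewrite mulr_ge0// ltW.
have cdt : continuous dt by exact: continuous_dot.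
have cdta : continuous (fun z : V => dt (r *: (y - z))).
  rewrite (_ : (fun z : V => _) = fun z : V => dt (affine (- r) (r *: y) z)).
    by apply: continuous_compR => //; exact: continuous_affine.
  by apply/funext => z; rewrite /affine scalerBr addrC scaleNr.
have mfun (h : V -> R) : continuous h ->
    measurable_fun setT (h : lebesgueType R n -> R).
  exact: measurable_continuous.
have b1 z : `|r *: (y - z)| < S -> `|dt (r *: (y - z))| <= C by exact: dot_le.
have b2 z : `|z| < S -> `|dt z ^+ 2| <= C ^+ 2.
  by move=> zS; rewrite normrX ler_sqr ?nnegrE//; exact: dot_le.
have c2 : continuous (fun z : V => dt (r *: (y - z)) ^+ 2) by exact: continuous_mulR.
have i0 := @integrable_ker_mul r y (fun=> 1) 1 r0 (mfun _ (@continuous_cstR _ _ 1))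
  (fun z _ => eq_ind_r (fun x => x <= 1) (lexx 1) (normr1 R)).
have i1' := @integrable_ker_mul r y _ C r0 (mfun _ cdta) b1.
have i2' := @integrable_ker_mul r y _ (C ^+ 2) r0 (mfun _ c2) (fun z => b2 _).
have iZ (k : R) (h : V -> R) : mu.-integrable setT (EFin \o (fun z : V => ker r y z * h z)) ->
    mu.-integrable setT (EFin \o (fun z : V => ker r y z * (k * h z))).
  move=> ih; rewrite (_ : _ \o _ = (fun z : V => k%:E * (EFin \o (fun z : V => (ker r y z * h z)%R)) z)%E).
    exact: integrableZl.
  by apply/funext => z /=; rewrite -EFinM mulrCA.
have i1 : mu.-integrable setT (EFin \o (fun z : V => ker r y z * a)).
  by have := iZ a _ i0; rewrite mulr1.
have i2 := iZ b _ i1'.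
have i3 := iZ c _ i2'.
have i12 : mu.-integrable setT
    (EFin \o (fun z : V => ker r y z * a + ker r y z * (b * dt (r *: (y - z))))).
  rewrite (_ : _ \o _ = (fun z : V => (EFin \o (fun z : V => ker r y z * a)%R) z +
    (EFin \o (fun z : V => (ker r y z * (b * dt (r *: (y - z))))%R)) z)%E).
    exact: integrableD.
  by apply/funext => z /=; rewrite EFinD.
transitivity (\int[mu]_z ((ker r y z * a + ker r y z * (b * dt (r *: (y - z)))) +
   ker r y z * (c * dt (r *: (y - z)) ^+ 2))).
  by apply: eq_Rintegral => z _; rewrite !mulrDr.
rewrite RintegralD// RintegralD//; congr (_ + _).
- transitivity (a + 0); last by rewrite addr0.
  congr (_ + _).
    transitivity (\int[mu]_z (a * ker r y z)).
      by apply: eq_Rintegral => z _; rewrite mulrC.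
    rewrite RintegralZl// ?integral_ker1 ?mulr1//.
    rewrite (_ : EFin \o _ = EFin \o (fun z : V => ker r y z * 1))//.
    by apply/funext => z /=; rewrite mulr1.
  transitivity (\int[mu]_z (b * (ker r y z * dt (r *: (y - z))))).
    by apply: eq_Rintegral => z _; rewrite mulrCA.
  by rewrite (RintegralZl _ measurableT i1') integral_ker_dot ?mulr0.
transitivity (\int[mu]_z (c * (ker r y z * dt (r *: (y - z)) ^+ 2))).
  by apply: eq_Rintegral => z _; rewrite mulrCA.
rewrite (RintegralZl _ measurableT i2').
by rewrite (@integral_ker_change r y (fun z => dt z ^+ 2) (C ^+ 2))//; exact: continuous_mulR.
Qed.

(** A bump that averaging by the concentrated kernel lowers by at most a factor
    1 - eta, up to the very edge of its support.  In the interior this is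
    continuity of the profile.  Near the edge, chi is bounded below by a
    quadratic polynomial in y - z; its average is chi y plus a positive multiple
    of the second moment in the direction y - c, of order 1/r^2, minus error
    terms of the same order with the small factor tau and of order 1/r^4. *)
Lemma barrier (c : V) (R0 : R) : 0 < R0 -> exists chi : V -> R,
  [/\ continuous chi, forall z, 0 <= chi z <= 1,
      forall z, chi z != 0 -> ball c R0 z,
      exists2 d : R, 0 < d & forall z, ball c d z -> chi z = 1 &
      forall eta : R, 0 < eta -> exists2 r0 : R, 0 < r0 & forall r y, r0 <= r ->
        (1 - eta) * chi y <= \int[mu]_z (ker r y z * chi z)].
Proof.
move=> R00; have [kap kap0 hkap] := second_moment_ge.
have nR : 0 < n%:R :> R by rewrite ltr0n.
have R2 : 0 < R0 ^+ 2 by rewrite exprn_gt0.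
(* N bounds the squared Euclidean norm on the support of J; tau is so small that
   the terms of order 1/r^2 with factor tau cost less than the second moment. *)
pose N := n%:R * S ^+ 2.
have N0 : 0 < N by rewrite mulr_gt0// exprn_gt0.
pose tau := Num.min (1 / 4) (kap / (16 * N)).
have tau0 : 0 < tau by rewrite lt_min divr_gt0// divr_gt0// mulr_gt0.
have tau4 : tau <= 1 / 4 by rewrite ge_min lexx.
have tauN : 4 * tau * N <= kap / 4.
  have : tau <= kap / (16 * N) by rewrite ge_min lexx orbT.
  by rewrite ler_pdivlMr ?mulr_gt0//; lra.
pose q (z : V) := (\sum_i (z 0 i - c 0 i) * (z 0 i - c 0 i)) / R0 ^+ 2.
pose chi (z : V) := profile tau (1 - q z).
have cq : continuous q.
  apply: continuous_mulR; last exact: continuous_cstR.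
  have h i : continuous (fun z : V => z 0 i - c 0 i).
    by apply: continuous_addR; [exact: continuous_coord|exact: continuous_cstR].
  by apply: continuous_sumR => i; apply: continuous_mulR.
have cchi : continuous chi.
  apply: continuous_compR; last exact: continuous_profile.
  apply: continuous_addR; first exact: continuous_cstR.
  rewrite (_ : (fun x => - q x) = fun x => -1 * q x).
    by apply: continuous_mulR => //; exact: continuous_cstR.
  by apply/funext => x; rewrite mulN1r.
have chi01 z : 0 <= chi z <= 1 by exact: profile01.
have qlt z : q z < 1 -> forall i, `|z 0 i - c 0 i| < R0.
  move=> qz i; rewrite -(ltr_pXn2r (_ : (0 < 2)%N)) ?nnegrE ?(ltW R00)//.
  rewrite real_normK ?num_real//; apply: le_lt_trans (_ : q z * R0 ^+ 2 < _); last first.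
    by rewrite -[ltRHS]mul1r ltr_pM2r.
  rewrite /q divfK ?gt_eqF// (bigD1 i)//= expr2 lerDl sumr_ge0// => j _.
  by rewrite -expr2 sqr_ge0.
exists chi; split => //.
- move=> z cz; have qz : q z < 1.
    by rewrite ltNge; apply: contra cz => h; rewrite /chi profile_le0//; lra.
  by apply/ball_coord; split=> // i; rewrite distrC; exact: qlt.
- exists (R0 / (2 * n%:R)); first by rewrite divr_gt0// mulr_gt0.
  move=> z /ball_coord[_ hz]; apply: profile_plateau => //.
  suff : q z <= 1 / 4 by lra.
  rewrite ler_pdivrMr//; apply: (@le_trans _ _ (\sum_(i < n) (R0 / (2 * n%:R)) ^+ 2)).
    apply: ler_sum => i _; rewrite -expr2 -real_normK ?num_real//.
    rewrite ler_sqr ?nnegrE// ?divr_ge0 ?mulr_ge0 ?(ltW R00) ?(ltW nR)//.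
    by rewrite distrC ltW.
  rewrite sumr_const card_ord -[leLHS]mulr_natl.
  have -> : n%:R * (R0 / (2 * n%:R)) ^+ 2 = (1 / 4 * R0 ^+ 2) / n%:R.
    by field; rewrite gt_eqF.
  rewrite ler_pdivrMr// ler_peMr ?ler1n// mulr_ge0// ltW//.
move=> eta' eta'0; pose eta := Num.min 1 eta'.
have eta0 : 0 < eta by rewrite lt_min ltr01.
have eta1 : eta <= 1 by rewrite ge_min lexx.
have etale : eta <= eta' by rewrite ge_min lexx orbT.
pose t' := eta / 2 * tau.
have t'0 : 0 < t' by rewrite mulr_gt0// divr_gt0.
have t'tau : t' <= tau.
  by rewrite /t' ler_piMl// ?(ltW tau0)// ler_pdivrMr// mul1r; lra.
pose D := 2 * (n%:R * R0 * S) + N.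
have D0 : 0 < D by rewrite addr_gt0// !mulr_gt0.
have p1 : 0 <= D / (R0 ^+ 2 * t').
  by rewrite divr_ge0 ?(ltW D0)// ltW// mulr_gt0.
have p2 : 0 <= N ^+ 2 / (kap * R0 ^+ 2).
  by rewrite divr_ge0 ?sqr_ge0// ltW// mulr_gt0.
(* The second summand makes the increments of q at most t', the third one
   absorbs the terms of order 1/r^4 into the second moment. *)
exists (1 + D / (R0 ^+ 2 * t') + N ^+ 2 / (kap * R0 ^+ 2)).
  by rewrite -addrA ltr_pwDl// addr_ge0.
move=> r y /(sum_thresholds p1 p2)[r1 rD rN].
have r0 : 0 < r := lt_le_trans ltr01 r1.
have {}rD : D <= r * (R0 ^+ 2 * t') by rewrite -ler_pdivrMr// mulr_gt0.
have {}rN : N ^+ 2 <= kap * R0 ^+ 2 * r by rewrite mulrC -ler_pdivrMr// mulr_gt0.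
have mchi : measurable_fun setT (chi : lebesgueType R n -> R) by exact: measurable_continuous.
have chiy := chi01 y; have /andP[chiy0 chiy1] := chiy.
apply: (@le_trans _ _ ((1 - eta) * chi y)); first by rewrite ler_wpM2r// lerD2l lerN2.
have chiabs z : `|r *: (y - z)| < S -> `|chi z| <= 1.
  by move=> _; have /andP[h1 h2] := chi01 z; rewrite ger0_norm.
have [q1|q1] := leP 1 (q y).
  rewrite {1}/chi profile_le0 ?subr_le0// mulr0.
  apply: Rintegral_ge0 => z _; rewrite mulr_ge0 ?ker_ge0 ?(ltW r0)//.
  by have /andP[] := chi01 z.
pose Y : V := y - c.
have YE i : Y 0 i = y 0 i - c 0 i by rewrite !mxE.
have YR i : `|Y 0 i| <= R0 by rewrite YE ltW// qlt.
pose dt z := \sum_i Y 0 i * (r *: (y - z)) 0 i.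
pose sq z := \sum_i (r *: (y - z)) 0 i ^+ 2.
have sqN z : `|r *: (y - z)| < S -> 0 <= sq z <= N.
  move=> zS; rewrite /sq sumr_ge0/= => [|i _]; last exact: sqr_ge0.
  rewrite /N mulr_natl -[X in _ *+ X](card_ord n) -sumr_const; apply: ler_sum => i _.
  rewrite -real_normK ?num_real// ler_sqr ?nnegrE ?(ltW S0)//.
  exact: le_trans (coord_le_norm _ i) (ltW zS).
have dtN z : `|r *: (y - z)| < S -> `|dt z| <= n%:R * R0 * S.
  move=> zS; apply: le_trans (dot_le Y zS) _.
  rewrite -mulr_suml ler_wpM2r ?(ltW S0)// mulr_natl -[X in _ *+ X](card_ord n) -sumr_const.
  exact: ler_sum.
(* X is the increment of q between y and z, of order 1/r on the support of the
   kernel. *)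
pose X z := (sq z / r ^+ 2 - 2 * dt z / r) / R0 ^+ 2.
have qX z : q z = q y + X z.
  rewrite /q /X -mulrDl; congr (_ / _).
  rewrite /sq /dt mulr_suml -mulrA [X in 2 * X]mulr_suml mulr_sumr -sumrB -big_split/=.
  by apply: eq_bigr => i _; rewrite !mxE; field; rewrite gt_eqF.
have rinv : r^-1 <= 1 by rewrite invf_le1.
have rinv0 : 0 < r^-1 by rewrite invr_gt0.
have Xle z : `|r *: (y - z)| < S -> `|X z| <= t'.
  move=> zS; have /andP[s0 sN] := sqN z zS; have dN := dtN z zS.
  rewrite /X normrM normfV (gtr0_norm R2) ler_pdivrMr//.
  apply: (@le_trans _ _ (D / r)); last first.
    by rewrite ler_pdivrMr//; move: rD; rewrite mulrC (mulrC (R0 ^+ 2)).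
  apply: le_trans (ler_normB _ _) _; rewrite addrC /D [leRHS]mulrDl; apply: lerD.
    by rewrite normrM normrM normfV (gtr0_norm r0) (gtr0_norm (ltr0n _ 2)) ler_wpM2r ?(ltW rinv0)// ler_wpM2l.
  rewrite ger0_norm ?divr_ge0 ?sqr_ge0// expr2 invfM mulrA.
  rewrite -[leRHS]mulr1 ler_pM ?divr_ge0 ?(ltW r0)// ?(ltW rinv0)//.
  by rewrite ler_wpM2r// ltW.
have chiX z : chi z = profile tau (1 - q y - X z) by rewrite /chi qX opprD addrA.
have [tq|tq] := leP tau (1 - q y).
  have e2 : 0 <= 1 - eta by rewrite subr_ge0.
  have e3 : 1 - eta <= 1 by rewrite gerBl ltW.
  have e4 : `|(1 - eta) * chi y| <= 1.
    by rewrite ger0_norm ?mulr_ge0//; apply: mulr_ile1.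
  have e5 (k : R) : k = \int[mu]_z (ker r y z * k).
    rewrite RintegralZr// ?integral_ker1 ?mul1r//.
    rewrite (_ : EFin \o _ = EFin \o (fun z : V => ker r y z * cst 1 z)).
      apply: (@integrable_ker_mul r y _ 1 r0); first exact: measurable_cst.
      by move=> z _; rewrite normr1.
    by apply/funext => z /=; rewrite mulr1.
  rewrite [leLHS]e5.
  apply: (@ker_mono r y (fun=> (1 - eta) * chi y) chi 1 r0 _ mchi _ chiabs) => //.
  move=> z zS; rewrite [leRHS]chiX; apply: profile_interior => //; first by rewrite (ltW eta0).
  exact: Xle.
have T0 : 0 < 1 - q y by rewrite subr_gt0.
apply: (@le_trans _ _ (chi y)); first by rewrite ler_piMl// gerBl ltW.
pose K := (8 * tau ^+ 2).
have K0 : 0 < K by rewrite mulr_gt0// exprn_gt0.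
(* Coefficients of the quadratic lower bound for K (chi z - chi y), in the
   variable dt z: a2 dt^2 is the gain, a1 dt averages to 0, a0 is the loss. *)
pose a2 := 2 / (R0 ^+ 2 * R0 ^+ 2 * r ^+ 2).
pose a1 := (2 * (1 - q y) + 2 * tau) * 2 / (R0 ^+ 2 * r).
pose a0 := 4 * tau * N / (R0 ^+ 2 * r ^+ 2) + N ^+ 2 / (R0 ^+ 2 * R0 ^+ 2 * (r ^+ 2 * r ^+ 2)).
have lower z : `|r *: (y - z)| < S ->
    chi y + - a0 / K + a1 / K * dt z + a2 / K * dt z ^+ 2 <= chi z.
  move=> zS; rewrite [leRHS]chiX; apply: le_trans (profile_edge tau0 _ (le_trans (Xle z zS) t'tau)); last first.
    by rewrite T0 ltW.
  rewrite -!addrA lerD2l -/K.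
  have -> : - a0 / K + (a1 / K * dt z + a2 / K * dt z ^+ 2) = (- a0 + a1 * dt z + a2 * dt z ^+ 2) / K.
    by field; rewrite gt_eqF.
  rewrite ler_pM2r ?invr_gt0//.
  have /andP[s0 sN] := sqN z zS.
  set T := 1 - q y; set d := dt z; set s := sq z.
  have e1 : X z ^+ 2 = (s / r ^+ 2 - 2 * d / r) ^+ 2 / (R0 ^+ 2 * R0 ^+ 2).
    by rewrite /X -/s -/d; field; rewrite !gt_eqF.
  have e2 : 2 * (d / r) ^+ 2 - (s / r ^+ 2) ^+ 2 <= (s / r ^+ 2 - 2 * d / r) ^+ 2.
    rewrite -subr_ge0 -mulrA.
    have -> : (s / r ^+ 2 - 2 * (d / r)) ^+ 2 - (2 * (d / r) ^+ 2 - (s / r ^+ 2) ^+ 2) =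
      2 * (d / r - s / r ^+ 2) ^+ 2 by ring.
    by rewrite mulr_ge0 ?sqr_ge0.
  have e3 : (2 * (d / r) ^+ 2 - (s / r ^+ 2) ^+ 2) / (R0 ^+ 2 * R0 ^+ 2) <= X z ^+ 2.
    by rewrite e1 ler_pM2r ?invr_gt0 ?mulr_gt0.
  have e4 : (s / r ^+ 2) ^+ 2 / (R0 ^+ 2 * R0 ^+ 2) <= N ^+ 2 / (R0 ^+ 2 * R0 ^+ 2 * (r ^+ 2 * r ^+ 2)).
    have -> : (s / r ^+ 2) ^+ 2 / (R0 ^+ 2 * R0 ^+ 2) = s ^+ 2 / (R0 ^+ 2 * R0 ^+ 2 * (r ^+ 2 * r ^+ 2)).
      by field; rewrite !gt_eqF.
    by rewrite ler_pM2r ?invr_gt0 ?mulr_gt0 ?exprn_gt0// ler_sqr ?nnegrE// ltW.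
  have e5 : (2 * T + 2 * tau) * (s / (R0 ^+ 2 * r ^+ 2)) <= 4 * tau * N / (R0 ^+ 2 * r ^+ 2).
    rewrite mulrA ler_pM2r ?invr_gt0 ?mulr_gt0 ?exprn_gt0//.
    apply: ler_pM => //.
      by rewrite addr_ge0 ?mulr_ge0 ?(ltW T0) ?(ltW tau0).
    have -> : 4 * tau = 2 * tau + 2 * tau by ring.
    by rewrite lerD2r ler_pM2l ?ltr0n // ltW.
  have e6 : X z * (2 * T + 2 * tau) = (2 * T + 2 * tau) * (s / (R0 ^+ 2 * r ^+ 2)) - a1 * d.
    by rewrite /X /a1 -/s -/d -/T; field; rewrite !gt_eqF.
  have e7 : a2 * d ^+ 2 = (2 * (d / r) ^+ 2) / (R0 ^+ 2 * R0 ^+ 2).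
    by rewrite /a2; field; rewrite !gt_eqF.
  rewrite mulrBl in e3; rewrite e6 e7 /a0.
  exact: edge_balance e3 e4 e5.
have quad := @integral_ker_quadratic r y Y (chi y + - a0 / K) (a1 / K) (a2 / K) r0.
have : chi y <= chi y + - a0 / K + a2 / K * \int[mu]_x (J x * (\sum_i Y 0 i * x 0 i) ^+ 2).
  rewrite -addrA lerDl; have -> : forall Q, - a0 / K + a2 / K * Q = (a2 * Q - a0) / K.
    by move=> Q; field; rewrite gt_eqF.
  rewrite divr_ge0 ?(ltW K0)// subr_ge0.
  have qY : q y * R0 ^+ 2 = \sum_i Y 0 i ^+ 2.
    by rewrite /q divfK ?gt_eqF//; apply: eq_bigr => i _; rewrite YE expr2.
  have := hkap Y; rewrite -qY; set Q := \int[mu]_x _ => hQ.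
  have hQ2 : kap * (3 / 4 * R0 ^+ 2) <= Q.
    apply: le_trans hQ; rewrite ler_pM2l// ler_pM2r//.
    exact: edge_gap tq tau4.
  apply: (@le_trans _ _ (a2 * (kap * (3 / 4 * R0 ^+ 2)))); last first.
    by rewrite ler_pM2l// divr_gt0// !mulr_gt0// exprn_gt0.
  have -> : a2 * (kap * (3 / 4 * R0 ^+ 2)) = (3 / 2 * kap) / (R0 ^+ 2 * r ^+ 2).
    by rewrite /a2; field; rewrite !gt_eqF.
  have -> : a0 = (4 * tau * N + N ^+ 2 / (R0 ^+ 2 * r ^+ 2)) / (R0 ^+ 2 * r ^+ 2).
    by rewrite /a0; field; rewrite !gt_eqF.
  rewrite ler_pM2r ?invr_gt0 ?mulr_gt0 ?exprn_gt0//.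
  suff : N ^+ 2 / (R0 ^+ 2 * r ^+ 2) <= kap.
    exact: edge_margin kap0 tauN.
  rewrite ler_pdivrMr ?mulr_gt0 ?exprn_gt0//; apply: (le_trans rN).
  have kR : 0 < kap * R0 ^+ 2 by rewrite mulr_gt0.
  by rewrite [leRHS]mulrA ler_pM2l// expr2 ler_peMr// ltW.
move=> /le_trans; apply; rewrite -quad.
pose Cq := 1 + `|chi y + - a0 / K| + `|a1 / K| * (n%:R * R0 * S) + `|a2 / K| * (n%:R * R0 * S) ^+ 2.
have Cq1 : 1 <= Cq.
  by rewrite /Cq -!addrA lerDl !addr_ge0// ?mulr_ge0 ?sqr_ge0 ?(ltW R00) ?(ltW S0)// ltW.
have cdta : continuous dt.
  rewrite (_ : dt = fun z => (fun x : V => \sum_i Y 0 i * x 0 i) (affine (- r) (r *: y) z)).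
    apply: (@continuous_compR R V V (fun x => \sum_i Y 0 i * x 0 i) (affine (- r) (r *: y))).
      exact: continuous_affine.
    exact: continuous_dot.
  by apply/funext => z; rewrite /dt /affine scalerBr addrC scaleNr.
pose low (z : V) := chi y + - a0 / K + a1 / K * dt z + a2 / K * dt z ^+ 2.
have mlow : measurable_fun setT (low : lebesgueType R n -> R).
  apply: (measurable_continuous measurableT); apply: continuous_addR.
    apply: continuous_addR; first exact: continuous_cstR.
    by apply: continuous_mulR => //; exact: continuous_cstR.
  by apply: continuous_mulR; [exact: continuous_cstR|exact: continuous_mulR].
have blow z : `|r *: (y - z)| < S -> `|low z| <= Cq.
  move=> zS; have dN := dtN z zS.
  apply: le_trans (ler_normD _ _) _; apply: lerD; last first.
    by rewrite normrM normrX ler_wpM2l// ler_sqr ?nnegrE ?(le_trans _ dN).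
  apply: le_trans (ler_normD _ _) _; apply: lerD; last by rewrite normrM ler_wpM2l.
  by rewrite lerDr.
have bchi z (zS : `|r *: (y - z)| < S) := le_trans (chiabs z zS) Cq1.
exact: (@ker_mono r y low chi Cq r0 mlow mchi blow bchi lower).
Qed.

Section Dispersal.
Variable Om : set V.
Hypothesis oOm : open Om.
Hypothesis bOm : bounded_set Om.

Let mOm : measurable (Om : set (lebesgueType R n)).
Proof. exact: measurable_open. Qed.

Lemma integrable_ker_on r y (h : V -> R) (C : R) : 0 < r ->
  measurable_fun (Om : set (lebesgueType R n)) (h : lebesgueType R n -> R) ->
  (forall z, Om z -> `|h z| <= C) ->
  mu.-integrable Om (EFin \o (fun z => ker r y z * h z)).
Proof.
move=> r0 mh hC.
have mk := @measurable_funM _ (lebesgueType R n) R Om (ker r y) h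
    (measurable_ker r y mOm) mh.
apply: (@integrable_bounded _ _ _ _ (r ^+ n * B * `|C|) mOm bOm mk) => z Oz.
rewrite normrM ger0_norm ?ker_ge0 ?(ltW r0)//.
rewrite ler_pM ?ker_ge0 ?ker_le ?(ltW r0)//.
exact: le_trans (hC z Oz) (ler_norm _).
Qed.

Lemma integrable_ker r y : 0 < r -> mu.-integrable setT (EFin \o ker r y).
Proof.
move=> r0; rewrite (_ : _ \o _ = EFin \o (fun z : V => ker r y z * cst 1 z)).
  apply: (@integrable_ker_mul r y _ 1 r0); first exact: measurable_cst.
  by move=> z _; rewrite normr1.
by apply/funext => z /=; rewrite mulr1.
Qed.

Lemma integral_ker_on_le1 r y : 0 < r -> 0 <= \int[mu]_(z in Om) ker r y z <= 1.
Proof.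
move=> r0; apply/andP; split.
  by apply: Rintegral_ge0 => z _; rewrite ker_ge0 ?(ltW r0).
rewrite -(integral_ker1 y r0) Rintegral_mkcond; apply: le_Rintegral => //.
- rewrite -restrict_EFin; apply/(integrable_mkcond _ mOm).
  exact: (integrableS measurableT mOm _ (integrable_ker y r0)).
- exact: integrable_ker.
move=> z _; rewrite /patch; case: ifPn => // _.
by rewrite ker_ge0 ?(ltW r0).
Qed.

(** The lower bound s chi - N on the density is averaged separately: the barrier
    is supported in Om, so its average over Om is the full one, and the mass of
    the kernel in Om is at most 1. *)
Lemma dispersal_ge_barrier r y (h chi : V -> R) (C s N : R) : 0 < r ->
  measurable_fun (Om : set (lebesgueType R n)) (h : lebesgueType R n -> R) ->
  (forall z, Om z -> `|h z| <= C) ->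
  continuous chi -> (forall z, 0 <= chi z <= 1) -> (forall z, chi z != 0 -> Om z) ->
  0 <= s -> 0 <= N -> (forall z, Om z -> s * chi z - N <= h z) ->
  s * (\int[mu]_z (ker r y z * chi z)) - N <= \int[mu]_(z in Om) (ker r y z * h z).
Proof.
move=> r0 mh hC cchi chi01 chiOm s0 N0 hle.
have mchi : measurable_fun (Om : set (lebesgueType R n)) (chi : lebesgueType R n -> R).
  exact: measurable_continuous.
have bchi z : Om z -> `|chi z| <= 1.
  by move=> _; have /andP[? ?] := chi01 z; rewrite ger0_norm.
have ichi := integrable_ker_on y r0 mchi bchi.
have ik : mu.-integrable Om (EFin \o ker r y).
  exact: (integrableS measurableT mOm _ (integrable_ker y r0)).
have isc : mu.-integrable Om (EFin \o (fun z : V => s * (ker r y z * chi z))).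
  rewrite (_ : _ \o _ = (fun z : V => s%:E * (EFin \o (fun z : V => (ker r y z * chi z)%R)) z)%E).
    exact: integrableZl.
  by apply/funext.
have iN : mu.-integrable Om (EFin \o (fun z : V => N * ker r y z)).
  rewrite (_ : _ \o _ = (fun z : V => N%:E * (EFin \o ker r y) z)%E).
    exact: integrableZl.
  by apply/funext.
apply: (@le_trans _ _ (\int[mu]_(z in Om) (s * (ker r y z * chi z) - N * ker r y z))).
  rewrite (RintegralB mOm isc iN) (RintegralZl _ mOm ichi) (RintegralZl _ mOm ik).
  apply: lerB.
    rewrite ler_wpM2l// [leRHS]Rintegral_mkcond le_eqVlt; apply/orP; left; apply/eqP.
    apply: eq_Rintegral => z _; rewrite /patch; case: ifPn => // /negP zO.
    have [->|/chiOm Oz] := eqVneq (chi z) 0; first by rewrite mulr0.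
    by case: zO; exact/mem_set.
  have /andP[_ h1] := integral_ker_on_le1 y r0.
  by rewrite -[leRHS]mulr1 ler_wpM2l.
have idiff : mu.-integrable Om (EFin \o (fun z : V => s * (ker r y z * chi z) - N * ker r y z)).
  rewrite (_ : _ \o _ = (fun z : V => (EFin \o (fun z : V => (s * (ker r y z * chi z))%R)) z -
      (EFin \o (fun z : V => (N * ker r y z)%R)) z)%E).
    exact: integrableB.
  by apply/funext.
apply: (le_Rintegral mOm idiff (integrable_ker_on y r0 mh hC)) => z Oz.
rewrite mulrCA (mulrC N) -mulrBr ler_wpM2l ?ker_ge0 ?(ltW r0)//.
exact: hle.
Qed.

Lemma dispersal_ge r y (h : V -> R) (C N : R) : 0 < r ->
  measurable_fun (Om : set (lebesgueType R n)) (h : lebesgueType R n -> R) ->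
  (forall z, Om z -> `|h z| <= C) -> 0 <= N -> (forall z, Om z -> - N <= h z) ->
  - N <= \int[mu]_(z in Om) (ker r y z * h z).
Proof.
move=> r0 mh hC N0 hN.
have := @dispersal_ge_barrier r y h (cst 0) C 0 N r0 mh hC.
rewrite mul0r sub0r; apply => //.
- exact: continuous_cstR.
- by move=> z; rewrite /= lexx ler01.
- by move=> z; rewrite /= eqxx.
by move=> z Oz; rewrite mul0r sub0r hN.
Qed.

Lemma dispersal_le r y (h : V -> R) (C N : R) : 0 < r ->
  measurable_fun (Om : set (lebesgueType R n)) (h : lebesgueType R n -> R) ->
  (forall z, Om z -> `|h z| <= C) -> 0 <= N -> (forall z, Om z -> h z <= N) ->
  \int[mu]_(z in Om) (ker r y z * h z) <= N.
Proof.
move=> r0 mh hC N0 hN; rewrite -lerN2.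
have mNh : measurable_fun (Om : set (lebesgueType R n)) ((fun z => -1 * h z) : lebesgueType R n -> R).
  exact: (@measurable_funM _ (lebesgueType R n) R Om (cst (-1)) h (measurable_cst _) mh).
have bNh z : Om z -> `|-1 * h z| <= C by rewrite mulN1r normrN; exact: hC.
have le : forall z, Om z -> - N <= -1 * h z by move=> z Oz; rewrite mulN1r lerN2 hN.
have := dispersal_ge y r0 mNh bNh N0 le; move=> /le_trans; apply.
have e : \int[mu]_(z in Om) (-1 * (ker r y z * h z)) =
    - \int[mu]_(z in Om) (ker r y z * h z).
  by rewrite (RintegralZl _ mOm (integrable_ker_on y r0 mh hC)) mulN1r.
rewrite -e le_eqVlt; apply/orP; left; apply/eqP; apply: eq_Rintegral => z _.
by rewrite mulrCA.
Qed.

Lemma dispersal_ge_on r y (h : V -> R) (C c a : R) (E : set V) : 0 < r ->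
  measurable_fun (Om : set (lebesgueType R n)) (h : lebesgueType R n -> R) ->
  (forall z, Om z -> `|h z| <= C) ->
  measurable (E : set (lebesgueType R n)) -> E `<=` Om -> 0 <= c -> 0 <= a ->
  (forall z, Om z -> 0 <= h z) -> (forall z, E z -> c <= ker r y z) ->
  (forall z, E z -> a <= h z) ->
  c * a * fine (mu E) <= \int[mu]_(z in Om) (ker r y z * h z).
Proof.
move=> r0 mh hC mE EOm c0 a0 h0 kc ha.
apply: (Rintegral_ge_on mOm mE EOm _ (integrable_ker_on y r0 mh hC)).
- apply: le_lt_trans (bounded_finite_measure bOm); exact: le_lebesgue_outer.
- by move=> z Oz; rewrite mulr_ge0 ?ker_ge0 ?(ltW r0)// h0.
- by move=> z Ez; rewrite ler_pM// ?kc ?ha.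
Qed.

End Dispersal.

End Kernel.

(** * The comparison principle *)

Section ScalarComparison.
Context (R : realType).

Definition eps_delta_continuous (g : R -> R) (a b : R) :=
  forall t eps, a <= t <= b -> 0 < eps -> exists2 del, 0 < del &
    forall s, a <= s <= b -> `|s - t| < del -> `|g s - g t| <= eps.

Lemma eps_delta_within_continuous g a b : eps_delta_continuous g a b ->
  {within `[a, b], continuous g}.
Proof.
move=> h; apply/subspace_continuousP => t; rewrite /= in_itv/= => tab.
apply/cvgrPdist_le => eps eps0; have [del del0 hd] := h t eps tab eps0.
rewrite near_withinE; apply/nbhs_ballP; exists del => // s /= ts.
by rewrite in_itv/= => sab; rewrite distrC; apply: hd => //; rewrite distrC.
Qed.

Lemma eps_delta_continuousW g a b c d : a <= c -> d <= b ->
  eps_delta_continuous g a b -> eps_delta_continuous g c d.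
Proof.
move=> ac db h t eps /andP[ct td] eps0.
have [|del del0 hd] := h t eps _ eps0.
  by rewrite (le_trans ac ct) (le_trans td db).
exists del => // s /andP[cs sd]; apply: hd.
by rewrite (le_trans ac cs) (le_trans sd db).
Qed.

Lemma nonpos_of_decreasing_where_positive (g : R -> R) (a b : R) : a <= b ->
  eps_delta_continuous g a b -> g a <= 0 ->
  (forall t, a < t < b -> 0 < g t -> exists d, is_derive t (1 : R) g d /\ d <= 0) ->
  g b <= 0.
Proof.
move=> ab cg ga dg; rewrite leNgt; apply/negP => gb.
pose E : set R := [set x | a <= x <= b /\ g x <= 0].
have Ea : E a by split=> //; rewrite lexx.
have Eub : ubound E b by move=> x [/andP[]].
have hE : has_sup E by split; [exists a|exists b].
pose s := sup E.
have as_ : a <= s by apply: ub_le_sup => //; exists b.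
have sb : s <= b by apply: ge_sup => //; exists a.
have sab : a <= s <= b by rewrite as_ sb.
have ubs x : E x -> x <= s by move=> Ex; apply: ub_le_sup => //; exists b.
have above x : s < x <= b -> 0 < g x.
  move=> /andP[sx xb]; rewrite ltNge; apply/negP => gx.
  have : x <= s by apply: ubs; split=> //; rewrite xb (le_trans as_ (ltW sx)).
  by rewrite leNgt sx.
have gs : g s <= 0.
  rewrite leNgt; apply/negP => gs.
  have gs2 : 0 < g s / 2 by rewrite divr_gt0.
  have [d d0 hd] := cg s (g s / 2) sab gs2.
  have [x [/andP[ax xb] gx] sx] := sup_adherent d0 hE.
  have xs : x <= s by apply: ubs; split=> //; rewrite ax xb.
  have := hd x; rewrite ax xb => /(_ isT) h.
  have : `|g x - g s| <= g s / 2.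
    by apply: h; rewrite distrC ger0_norm ?subr_ge0// ltrBlDr -ltrBlDl.
  by rewrite ler_norml => /andP[h1 _]; lra.
have sltb : s < b.
  by rewrite lt_neqAle sb andbT; apply: contraTneq gb => <-; rewrite -leNgt.
have dP x : exists d, s < x < b -> is_derive x (1 : R) g d /\ d <= 0.
  have [/andP[sx xb]|nx] := boolP (s < x < b); last by exists 0.
  have [||d hd] := dg x; first by rewrite (le_lt_trans as_ sx).
    by apply: above; rewrite sx ltW.
  by exists d.
have [dg' hdg'] := choice dP.
have [||x xI e] := @MVT R g dg' s b sltb.
- by move=> x; rewrite in_itv/= => h; have [] := hdg' x h.
- by apply: eps_delta_within_continuous; apply: eps_delta_continuousW cg.
have [_ hd] := hdg' x ltac:(by move: xI; rewrite in_itv).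
have : g b - g s <= 0 by rewrite e mulr_le0_ge0// subr_ge0 ltW.
by lra.
Qed.

Lemma norm_sub_half (a b c d eps : R) : `|a - b| <= eps / 2 -> `|d - c| < eps ->
  `|a - c / 2 - (b - d / 2)| <= eps.
Proof.
rewrite ler_norml ltr_norml => /andP[h1 h2] /andP[h3 h4].
by rewrite ler_norml; apply/andP; split; lra.
Qed.

(** A maximum principle for families of scalar functions, the derivative being
    controlled only where the function is positive and only by the supremum N of
    the whole family, as for bounded nonlocal operators.  Comparing with
    e exp (2 C + 1)(t - a), the family cannot reach this bound for the first
    time: until then N is at most that bound E, and E / 2 grows at a rate larger
    than C E, so the family stays below E / 2.  Since that
    margin is uniform in the index, equicontinuity lets time advance.  Finally e
    tends to 0.  Values N <= 1 suffice, which is why Lipschitz constants on a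
    bounded set will do. *)
Lemma comparison (I : Type) (D : set I) (z : R -> I -> R) (a b C : R) :
  a <= b -> 0 <= C ->
  (forall t eps, a <= t <= b -> 0 < eps -> exists2 del, 0 < del &
    forall s i, a <= s <= b -> D i -> `|s - t| < del -> `|z s i - z t i| <= eps) ->
  (forall i, D i -> z a i <= 0) ->
  (forall t i N, a < t <= b -> D i -> 0 <= N <= 1 -> (forall j, D j -> z t j <= N) ->
    0 < z t i -> exists d, is_derive t (1 : R) (z ^~ i) d /\ d <= C * N) ->
  forall t i, a <= t <= b -> D i -> z t i <= 0.
Proof.
move=> ab C0 eqc za dz.
(* The factor 2 makes E / 2 grow as fast as any member of a family bounded by E. *)
pose K := 2 * C + 1.
have K0 : 0 < K by rewrite ltr_wpDl// mulr_ge0.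
have expm s t : s <= t -> expR (K * (s - a)) <= expR (K * (t - a)).
  by move=> st; rewrite ler_expR ler_pM2l// lerD2r.
have exp1 s : a <= s -> 1 <= expR (K * (s - a)).
  by move=> as_; rewrite -expR0 ler_expR mulr_ge0 ?(ltW K0)// subr_ge0.
pose M := expR (K * (b - a)).
have M0 : 0 < M by exact: expR_gt0.
have main (e : R) : 0 < e -> e * M <= 1 ->
    forall t i, a <= t <= b -> D i -> z t i <= e * expR (K * (t - a)).
  move=> e0 eM.
  pose E s := e * expR (K * (s - a)).
  have E0 s : 0 < E s by rewrite mulr_gt0// expR_gt0.
  have Emono s t : s <= t -> E s <= E t by move=> st; rewrite ler_pM2l// expm.
  have Ele1 s : s <= b -> E s <= 1.
    by move=> sb; apply: le_trans eM; rewrite ler_pM2l// expm.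
  have dE s : is_derive s (1 : R) E (K * E s).
    rewrite /E; apply: is_derive_eq.
    by rewrite /GRing.scale/=; ring.
  have eE s : a <= s -> e <= E s by move=> as_; rewrite -[leLHS]mulr1 ler_pM2l// exp1.
  have half t : a <= t <= b -> (forall s i, a <= s < t -> D i -> z s i <= E s) ->
      forall i, D i -> z t i <= E t / 2.
    move=> /andP[at_ tb] hz i Di; rewrite -subr_le0.
    apply: (@nonpos_of_decreasing_where_positive (fun s => z s i - E s / 2) a t at_).
    - move=> s eps /andP[as_ st] eps0.
      have e20 : 0 < eps / 2 by rewrite divr_gt0.
      have [|d1 d10 hd1] := eqc s _ _ e20; first by rewrite as_ (le_trans st tb).
      have : E x @[x --> s] --> E s.
        by apply: differentiable_continuous; apply/derivable1_diffP; have [] := dE s.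
      move=> /cvgrPdist_lt/(_ _ eps0)/nbhs_ballP[d2 /= d20 hd2].
      exists (Num.min d1 d2); first by rewrite lt_min d10.
      move=> x /andP[ax xt]; rewrite lt_min => /andP[xd1 xd2].
      have h1 : `|z x i - z s i| <= eps / 2.
        by apply: hd1 => //; rewrite ax (le_trans xt tb).
      have h2 : `|E s - E x| < eps by apply: hd2; rewrite /ball/= distrC.
      exact: norm_sub_half h1 h2.
    - have := za i Di; have := E0 a; lra.
    move=> s /andP[as_ st] gs.
    have zs : 0 < z s i by have := E0 s; lra.
    have sb : s <= b := le_trans (ltW st) tb.
    have [|||d [dd dle]] := dz s i (E s) _ Di _ _ zs.
    - by rewrite as_ sb.
    - by rewrite (ltW (E0 s)) Ele1.
    - by move=> j Dj; apply: hz => //; rewrite (ltW as_).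
    exists (d - K * E s / 2); split.
      have dE2 := dE s.
      have -> : (fun s => z s i - E s / 2) = (z ^~ i) \- (E \* cst (2^-1)).
        by apply/funext.
      apply: is_derive_eq; rewrite /GRing.scale/= mulr0 add0r; ring.
    by rewrite subr_le0; apply: (le_trans dle); rewrite /K; have := E0 s; nra.
  pose G : set R := [set t | a <= t <= b /\ forall s i, a <= s <= t -> D i -> z s i <= E s].
  have Ga : G a.
    split=> [|s i]; first by rewrite lexx.
    rewrite -eq_le => /eqP <- Di; apply: le_trans (za i Di) (ltW (E0 a)).
  have Gub : ubound G b by move=> x [/andP[]].
  have hG : has_sup G by split; [exists a|exists b].
  pose T := sup G.
  have ubT x : G x -> x <= T by move=> Ex; apply: ub_le_sup => //; exists b.
  have aT : a <= T by exact: ubT.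
  have Tb : T <= b by apply: ge_sup => //; exists a.
  have Tab : a <= T <= b by rewrite aT Tb.
  have belowT s i : a <= s < T -> D i -> z s i <= E s.
    move=> /andP[as_ sT] Di.
    have [|x [xab hx] sx] := @sup_adherent _ G (T - s) _ hG; first by rewrite subr_gt0.
    by apply: hx => //; rewrite as_/=; rewrite -/T in sx; lra.
  have atT s i : a <= s <= T -> D i -> z s i <= E s / 2.
    move=> /andP[as_ sT] Di; apply: half => //; first by rewrite as_ (le_trans sT Tb).
    by move=> x j /andP[ax xs]; apply: belowT; rewrite ax (lt_le_trans xs sT).
  have TbE : T = b.
    apply/eqP; rewrite eq_le Tb leNgt; apply/negP => Tltb.
    have e4 : 0 < e / 4 by rewrite divr_gt0.
    have [d d0 hd] := eqc T _ Tab e4.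
    pose t1 := Num.min b (T + d / 2).
    have Tt1 : T < t1 by rewrite lt_min Tltb ltrDl divr_gt0.
    suff : G t1 by move=> /ubT; rewrite leNgt Tt1.
    split; first by rewrite (le_trans aT (ltW Tt1))/= ge_min lexx.
    move=> s i /andP[as_ st] Di; have [sT|Ts] := leP s T.
      apply: le_trans (atT s i _ Di) _; first by rewrite as_ sT.
      by have := E0 s; lra.
    have sb : s <= b by apply: (le_trans st); rewrite ge_min lexx.
    have sd : s <= T + d / 2 by apply: (le_trans st); rewrite ge_min lexx orbT.
    have : `|z s i - z T i| <= e / 4.
      apply: hd => //; first by rewrite as_ sb.
      by rewrite ger0_norm ?subr_ge0 ?(ltW Ts)//; lra.
    rewrite ler_norml => /andP[_ h].
    have h2 := atT T i ltac:(by rewrite aT lexx) Di.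
    by have h3 := Emono _ _ (ltW Ts); have h4 := eE T aT; lra.
  move=> t i /andP[at_ tb] Di; apply: le_trans (atT t i _ Di) _.
    by rewrite at_ TbE tb.
  by have := E0 t; rewrite /E; lra.
move=> t i tab Di; rewrite leNgt; apply/negP => zt.
pose e := Num.min (z t i / 2) 1 / M.
have e0 : 0 < e by rewrite divr_gt0// lt_min ltr01 divr_gt0.
have eM : e * M = Num.min (z t i / 2) 1 by rewrite /e divfK// gt_eqF.
have := main e e0 _ t i tab Di; rewrite eM ge_min lexx orbT => /(_ isT) h.
have : e * expR (K * (t - a)) <= e * M.
  by rewrite ler_pM2l// expm//; have /andP[] := tab.
rewrite eM => h2; have : z t i <= z t i / 2.
  by apply: (le_trans h); apply: (le_trans h2); rewrite ge_min lexx.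
by lra.
Qed.

End ScalarComparison.

(** * Differential balances and functions on the half-line *)

Section Balances.
Context (R : realType).
Implicit Types a b N : R.

Lemma min_gap a b N : 0 <= a -> 0 <= b -> 0 <= N -> a <= b + N ->
  [/\ 0 <= Num.min a b, Num.min a b <= a, Num.min a b <= b & a - Num.min a b <= N].
Proof.
by move=> a0 b0 N0 h; rewrite /Order.min; case: ifP => [/ltW|/negbT];
  rewrite -?leNgt => h5; split; lra.
Qed.

Lemma max_gap a b N : 0 <= N -> b - N <= a ->
  [/\ a <= Num.max a b, b <= Num.max a b & Num.max a b - a <= N].
Proof.
by move=> N0 h; rewrite /Order.max; case: ifP => [/ltW|/negbT];
  rewrite -?leNgt => h5; split; lra.
Qed.

(** The balance inequalities add up the terms of the velocity of a solution at a
    point where it crosses a barrier: Y or dl (D - U) is the dispersal term, X or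
    del U the dilution term, F the reaction and F' its value at a nearby vector on
    the barrier; N is the largest distance by which the barrier is crossed. *)
Lemma upper_balance F F' X Y W e N L Cd kap c dm :
  0 < c -> 0 < W -> F' <= e * ((kap - 2 * c) * W) -> `|F - F'| <= L * N ->
  `|X - kap * (e * W)| <= c * (e * W) + Cd * N -> Y <= dm * N ->
  Y - X + F <= - c * (e - 1) * W + (dm + Cd + L) * N.
Proof.
move=> c0 W0 h1; rewrite !ler_norml => /andP[_ h2] /andP[h3 _] h4.
by have h7 := mulr_gt0 c0 W0; lra.
Qed.

Lemma lower_balance F F' X Y Z W a N L Cd kap c dm :
  a * ((kap + 3 * c) * W) <= F' -> `|F - F'| <= L * N ->
  `|X - kap * (a * W)| <= c * (a * W) + Cd * N ->
  - (c * (a * W) + dm * N) <= Y -> Z <= c * (a * W) ->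
  - (Y - X + F) <= - Z + (dm + Cd + L) * N.
Proof.
by move=> h1; rewrite !ler_norml => /andP[h2 _] /andP[_ h3] h4 h5; lra.
Qed.

Lemma barrier_loss (D U W N dl dm eta c : R) : 0 <= dl -> dl <= dm -> 0 <= N ->
  0 <= W -> dl * eta <= c -> (1 - eta) * W - N <= D -> U <= W ->
  - (c * W + dm * N) <= dl * (D - U).
Proof.
move=> dl0 dlm N0 W0 hc hD hU.
have h1 : dl * (- (eta * W) - N) <= dl * (D - U) by rewrite ler_wpM2l//; lra.
have h2 : dl * eta * W <= c * W by rewrite ler_wpM2r.
have h3 : dl * N <= dm * N by rewrite ler_wpM2r.
by lra.
Qed.

Lemma growth_balance F X Y e N L Cd dm :
  `|F| <= L * (e + N) -> `|X| <= Cd * (e + N) -> Y <= dm * N ->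
  Y - X + F <= (Cd + L) * e + (dm + Cd + L) * N.
Proof.
by rewrite !ler_norml => /andP[_ h2] /andP[h3 _] h4; lra.
Qed.

Lemma clamp_top_balance (F F' D U V dl dm Cd L N del sg : R) : 0 <= dl -> dl <= dm ->
  0 <= N -> 0 <= sg -> D <= V + N -> V < U -> U <= V + N -> `|del| <= Cd ->
  F' - del * V <= - sg -> `|F - F'| <= L * N ->
  dl * (D - U) - del * U + F <= (dm + Cd + L) * N.
Proof.
move=> dl0 dlm N0 sg0 hD VU UV hdel hF'.
rewrite ler_norml => /andP[_ hF].
have h1 : dl * (D - U) <= dl * N by rewrite ler_wpM2l//; lra.
have h2 : dl * N <= dm * N by rewrite ler_wpM2r.
have h3 : - del * (U - V) <= Cd * N.
  apply: le_trans (ler_norm _) _; rewrite normrM normrN.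
  by apply: ler_pM => //; rewrite ger0_norm; lra.
by lra.
Qed.

Lemma clamp_bottom_balance (F F' D U dl dm Cd L N del : R) : 0 <= dl -> dl <= dm ->
  0 <= N -> - N <= D -> U < 0 -> - N <= U -> `|del| <= Cd -> 0 <= F' ->
  `|F - F'| <= L * N ->
  - (dl * (D - U) - del * U + F) <= (dm + Cd + L) * N.
Proof.
move=> dl0 dlm N0 hD U0 UN hdel hF'; rewrite ler_norml => /andP[hF _].
have h1 : dl * - N <= dl * (D - U) by rewrite ler_wpM2l//; lra.
have h2 : dl * N <= dm * N by rewrite ler_wpM2r.
have h3 : del * U <= Cd * N.
  apply: le_trans (ler_norm _) _; rewrite normrM.
  by apply: ler_pM => //; rewrite ltr0_norm//; lra.
by lra.
Qed.

Lemma velocity_balance (D U X F dl dm Cd C : R) :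
  dl * U <= dm * U -> X <= Cd * U -> - C * U <= F ->
  dl * D <= dl * (D - U) - X + F + (dm + Cd + C) * U.
Proof. by move=> h1 h2 h3; lra. Qed.

Lemma velocity_balance_coupling (D U W X F dl dm Cd C : R) :
  0 <= dl * D -> dl * U <= dm * U -> X <= Cd * U -> - C * U + W <= F ->
  W <= dl * (D - U) - X + F + (dm + Cd + C) * U.
Proof. by move=> h0 h1 h2 h3; lra. Qed.

End Balances.

Section HalfLineFunctions.
Context (R : realType).
Implicit Types (g : R -> R) (t T : R).

(** A function with a one-sided derivative at 0 is right continuous there; this
    is what bounds rho and its logarithmic derivative on compact time intervals. *)
Lemma half_derivable_continuous g t eps : 0 <= t -> half_derivable g t ->
  0 < eps -> exists2 del, 0 < del &
    forall s, 0 <= s -> `|s - t| < del -> `|g s - g t| <= eps.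
Proof.
move=> t0 /cvg_ex[l hl] eps0; have e1 : 0 < 1 :> R by [].
have := hl; move=> /cvgrPdist_lt/(_ _ e1).
rewrite near_withinE => /nbhs_ballP[d /= d0 hd].
have l0 : 0 < `|l| + 1 by rewrite ltr_wpDl.
exists (Num.min d (eps / (`|l| + 1))); first by rewrite lt_min d0 divr_gt0.
move=> s s0; rewrite lt_min => /andP[sd se].
have [->|st] := eqVneq s t; first by rewrite subrr normr0 ltW.
have st0 : s - t != 0 by rewrite subr_eq0.
have := hd (s - t); rewrite -ball_normE/= sub0r normrN => /(_ sd st0).
rewrite addrC subrK => /(_ s0).
move=> h; have {}h : `|(s - t)^-1 * (g s - g t)| < `|l| + 1.
  rewrite -ltrBlDl; apply: le_lt_trans h.
  by rewrite distrC; exact: lerB_dist.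
rewrite normrM normfV ltr_pdivrMl ?normr_gt0// in h.
apply: (le_trans (ltW h)); move: se; rewrite ltr_pdivlMr// => se.
exact: ltW.
Qed.

Lemma half_derivable_within_continuous g T :
  (forall t, 0 <= t -> half_derivable g t) -> {within `[0, T], continuous g}.
Proof.
move=> hg; apply: eps_delta_within_continuous => t eps /andP[t0 tT] eps0.
have [d d0 hd] := half_derivable_continuous t0 (hg t t0) eps0.
by exists d => // s /andP[s0 _]; exact: hd.
Qed.

Lemma half_derivable_bounded g T : 0 <= T ->
  (forall t, 0 <= t -> half_derivable g t) ->
  exists a b, (exists2 c, 0 <= c <= T & a = g c) /\
    forall t, 0 <= t <= T -> a <= g t <= b.
Proof.
move=> T0 hg; have cg := @half_derivable_within_continuous g T hg.
have [c1 c1T h1] := EVT_min T0 cg; have [c2 c2T h2] := EVT_max T0 cg.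
exists (g c1), (g c2); split; first by exists c1 => //; move: c1T; rewrite in_itv.
by move=> t tT; rewrite h1 ?h2// in_itv.
Qed.

End HalfLineFunctions.

Section MatrixDerivative.
Context (R : realType) (m : nat).

Lemma is_derive_coord (g : R -> 'rV[R]_m) (t : R) (dg : 'rV[R]_m) i :
  is_derive t (1 : R) g dg -> is_derive t (1 : R) (fun s => g s 0 i) (dg 0 i).
Proof.
move=> [dg1 dg2]; have dgc := dg1; move/derivable_mxP in dgc.
split; first exact: dgc.
by rewrite -dg2 derive_mx// mxE.
Qed.

End MatrixDerivative.

Section Auxiliary.
Context (R : realType).

Lemma finite_lower_bound k (c : 'I_k -> R) : (forall i, 0 < c i) ->
  exists2 e : R, 0 < e & forall i, e <= c i.
Proof.
move=> c0; exists (\big[Num.min/1]_i c i).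
  by apply/bigmin_gtP; split => // i _.
by move=> i; exact: bigmin_le.
Qed.

(** A property that spreads to distance e, with e independent of the point, is
    both open and closed in A. *)
Lemma connected_chain (V : pseudoMetricType R) (A P : set V) (e : R) : connected A -> 0 < e ->
  (exists2 x, A x & P x) ->
  (forall x y, A x -> A y -> P x -> ball x e y -> P y) -> A `<=` P.
Proof.
move=> cA e0 [x Ax Px] step; suff <- : A `&` P = A by move=> y [].
apply: cA; first by exists x.
- exists (\bigcup_(x in A `&` P) (ball x e)°).
    by apply: bigcup_open => y _; exact: open_interior.
  apply/seteqP; split=> y [Ay].
    by move=> Py; split => //; exists y => //; exact: nbhsx_ballx.
  by move=> [z [Az Pz] /interior_subset zy]; split => //; exact: step Pz zy.
exists (~` \bigcup_(x in A `\` P) (ball x e)°).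
  by apply: open_closedC; apply: bigcup_open => y _; exact: open_interior.
apply/seteqP; split=> y [Ay].
  move=> Py; split => // -[z [Az nPz] /interior_subset zy].
  by apply: nPz; apply: step Py _ => //; exact: ball_sym.
move=> h; split => //; apply: contrapT => nPy; apply: h; exists y => //.
exact: nbhsx_ballx.
Qed.

Lemma outer_null_negligible n (X : set 'rV[R]_n) :
  lebesgue_outer X = 0%E -> (@lebesgue_Rn R n).-negligible X.
Proof.
move=> X0; exists X; split => //.
apply: le_caratheodory_measurable => Y.
rewrite [X in (X + _)%E](_ : _ = 0%E).
  by rewrite add0e; apply: le_lebesgue_outer; exact: subIsetl.
by apply: outer_subset0 X0; exact: subIsetr.
Qed.

End Auxiliary.

(** * Solutions of the dispersal system *)

Section Solutions.
Context (R : realType) (m n : nat).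
Variables (Om : set 'rV[R]_n) (d : 'rV[R]_m) (rho : R -> R)
  (J : 'rV[R]_n -> R) (f : 'rV[R]_m -> 'rV[R]_m) (v : 'rV[R]_m).
Hypothesis n0 : (0 < n)%N.
Hypothesis oOm : open Om.
Hypothesis bOm : bounded_set Om.
Hypothesis d0 : forall i, 0 < d 0 i.
Hypothesis rho0 : forall t, 0 <= t -> 0 < rho t.
Hypothesis srho : half_smooth rho.
Hypothesis v0 : vll 0 v.
Hypothesis kJ : kernel_assumption J.
Variables (B S : R).
Hypothesis JB : forall x, J x <= B.
Hypothesis S0 : 0 < S.
Hypothesis JS : forall x, J x != 0 -> `|x| < S.
Hypothesis Jcent : centered J.
Hypothesis fR : reaction_assumption n rho f v.

Local Notation mu := (@lebesgue_Rn R n).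
Local Notation M := (order_interval v).
Local Notation dil := (dilution n rho).
Local Notation cl := (closure Om).
Implicit Types (t T : R) (y z : 'rV[R]_n) (w : 'rV[R]_m).

Let cJ : continuous J. Proof. by case: kJ. Qed.
Let J0 x : 0 <= J x. Proof. by case: kJ => _ /(_ x). Qed.
Let J00 : 0 < J 0. Proof. by case: kJ. Qed.
Let J1 : (\int[mu]_x (J x)%:E = 1)%E. Proof. by case: kJ. Qed.
Let fC1 : C1 f. Proof. by case: fR. Qed.
Let fcoop w : M w -> cooperative (Df f w) /\ irreducible_mx (Df f w).
Proof. by case: fR => _ + _ _ _; exact. Qed.
Let f0 : f 0 = 0. Proof. by case: fR. Qed.
Let fsub w (alpha : R) : M w -> vll 0 w ->
  0 < alpha -> alpha < 1 -> vlt (alpha *: f w) (f (alpha *: w)).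
Proof. by case: fR => _ _ _ _; exact. Qed.

Lemma dilution_bounded T : 0 <= T ->
  exists2 C : R, 0 <= C & forall t, 0 <= t <= T -> `|dil t| <= C.
Proof.
move=> T0.
have [a [b [[c /andP[c0 cT] ->] hab]]] := half_derivable_bounded T0 (@srho 0%N).
have [a' [b' [_ hab']]] := half_derivable_bounded T0 (@srho 1%N).
have rc : 0 < rho c by exact: rho0.
exists (n%:R * ((`|a'| + `|b'|) / rho c)).
  by rewrite mulr_ge0// divr_ge0// ?addr_ge0// ltW.
move=> t tT; have /andP[t0 _] := tT.
have /andP[h1 _] := hab t tT; have /andP[h2 h3] := hab' t tT.
rewrite /dilution normrM ger0_norm// ler_wpM2l// normrM normfV.
rewrite (gtr0_norm (rho0 t0)); apply: ler_pM => //.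
- by rewrite invr_ge0 ltW// rho0.
- have n1 := ler_norm b'; have := ler_norm (- a'); rewrite normrN => n2.
  rewrite ler_norml; have p1 := normr_ge0 a'; have p2 := normr_ge0 b'.
  by apply/andP; split; rewrite /= in h2 h3; lra.
- by rewrite lef_pV2 ?posrE// rho0.
Qed.

Lemma rho_bounded T : 0 <= T -> exists a b : R, 0 < a /\
  forall t, 0 <= t <= T -> a <= rho t <= b.
Proof.
move=> T0.
have [a [b [[c /andP[c0 cT] ->] hab]]] := half_derivable_bounded T0 (@srho 0%N).
by exists (rho c), b; split => //; exact: rho0.
Qed.

Lemma Xnorm_ge (psi : 'rV[R]_n -> 'rV[R]_m) (C : R) y :
  (forall x, cl x -> `|psi x| <= C) -> cl y -> `|psi y| <= Xnorm Om psi.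
Proof.
move=> hC cy; apply: ub_le_sup; last by exists y.
by exists C => _ [x cx <-]; exact: hC.
Qed.

Lemma Xnorm_le psi (C : R) : Om !=set0 -> (forall y, cl y -> `|psi y : 'rV[R]_m| <= C) ->
  Xnorm Om psi <= C.
Proof.
move=> [y Oy] h; apply: ge_sup; last by move=> _ [x cx <-]; exact: h.
by exists `|psi y|, y => //; exact: subset_closure.
Qed.

Lemma Xnorm_ge0 psi : 0 <= Xnorm Om (psi : 'rV[R]_n -> 'rV[R]_m).
Proof.
have [hs|hs] := pselect (has_sup [set `|psi x| | x in cl]); last by rewrite /Xnorm sup_out.
have [[_ [x cx _]] hub] := hs.
by apply: le_trans (normr_ge0 (psi x)) _; apply: ub_le_sup => //; exists x.
Qed.

Section OneSolution.
Variables (phi : 'rV[R]_n -> 'rV[R]_m) (u : R -> 'rV[R]_n -> 'rV[R]_m).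
Hypothesis phiv : Xhat_v Om v phi.
Hypothesis usol : solution Om d rho J f phi u.

Lemma solution_equicontinuous t eps : 0 <= t -> 0 < eps ->
  exists2 del : R, 0 < del & forall s, 0 <= s -> `|s - t| < del ->
    forall y i, cl y -> `|u s y 0 i - u t y 0 i| <= eps.
Proof.
move=> t0 eps0; have [uX uc _ _] := usol.
have := uc t t0; move=> /cvgrPdist_lt/(_ _ eps0).
rewrite near_withinE => /nbhs_ballP[del /= del0 hd]; exists del => // s s0 st y i cy.
have := hd s; rewrite -ball_normE/= distrC => /(_ st s0).
rewrite sub0r normrN => h.
have [[Bs hBs] _] := uX s s0; have [[Bt hBt] _] := uX t t0.
have hb x : cl x -> `|u s x - u t x| <= Bs + Bt.
  by move=> cx; apply: le_trans (ler_normB _ _) _; apply: lerD; [exact: hBs|exact: hBt].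
have := Xnorm_ge (psi := fun y => u s y - u t y) hb cy => hX.
apply: le_trans (_ : `|u s y - u t y| <= _).
  by have := coord_le_norm (u s y - u t y) i; rewrite !mxE.
by apply: (le_trans hX); apply: (le_trans (ler_norm _)); exact: ltW.
Qed.

Lemma solution_measurable t i : 0 <= t ->
  measurable_fun (Om : set (lebesgueType R n)) (fun x : lebesgueType R n => u t x 0 i).
Proof.
move=> t0; have [uX _ _ _] := usol; have [_ /(_ i)] := uX t t0.
apply: (@measurable_funS _ _ (lebesgueType R n) _ (cl : set (lebesgueType R n))).
  apply: measurable_closed; exact: closed_closure.
exact: subset_closure.
Qed.

Lemma solution_bounded t : 0 <= t -> exists C : R, forall y i, cl y -> `|u t y 0 i| <= C.
Proof.
move=> t0; have [uX _ _ _] := usol; have [[C hC] _] := uX t t0.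
by exists C => y i cy; apply: le_trans (coord_le_norm _ i) (hC y cy).
Qed.

Definition disp t y i : R := \int[mu]_(z in Om) (ker J (rho t) y z * u t z 0 i).

Lemma solution_derive t y i : 0 < t -> cl y ->
  is_derive t (1 : R) (fun s => u s y 0 i)
    (d 0 i * (disp t y i - u t y 0 i) - dil t * u t y 0 i + f (u t y) 0 i).
Proof.
move=> t0 cy; have [_ _ _ ud] := usol; have := is_derive_coord i (ud t y t0 cy).
rewrite /rhs !(mxE _ _ 0 i) => h; apply: (is_derive_eq h).
have mulE (w : 'rV[R]_m) : (w *m diag_mx d) 0 i = w 0 i * d 0 i.
  rewrite mxE (bigD1 i)//= mxE eqxx mulr1n big1 ?addr0// => j ji.
  by rewrite mxE (negbTE ji) mulr0n mulr0.
have := mulE (dispersal Om rho J t (u t) y); have := mulE (u t y).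
rewrite !(mxE _ _ 0 i) => -> ->; rewrite /disp -/(ker J (rho t) y _).
by rewrite mulrBr [d 0 i * _]mulrC [d 0 i * u t y 0 i]mulrC.
Qed.

Lemma disp_ge t y i (N : R) : 0 <= t -> 0 <= N ->
  (forall z, Om z -> - N <= u t z 0 i) -> - N <= disp t y i.
Proof.
move=> t0 N0 hN; have [C hC] := solution_bounded t0.
rewrite /disp; have hb z (Oz : Om z) := hC z i (subset_closure Oz).
exact: (dispersal_ge (h := fun z => u t z 0 i) cJ J0 J1 JB JS oOm bOm y (rho0 t0)
  (solution_measurable i t0) hb N0 hN).
Qed.

Lemma disp_le t y i (N : R) : 0 <= t -> 0 <= N ->
  (forall z, Om z -> u t z 0 i <= N) -> disp t y i <= N.
Proof.
move=> t0 N0 hN; have [C hC] := solution_bounded t0.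
rewrite /disp; have hb z (Oz : Om z) := hC z i (subset_closure Oz).
exact: (dispersal_le (h := fun z => u t z 0 i) cJ J0 J1 JB JS oOm bOm y (rho0 t0)
  (solution_measurable i t0) hb N0 hN).
Qed.

Lemma disp_ge_barrier t y i (chi : 'rV[R]_n -> R) (s N : R) : 0 <= t ->
  continuous chi -> (forall z, 0 <= chi z <= 1) -> (forall z, chi z != 0 -> Om z) ->
  0 <= s -> 0 <= N -> (forall z, Om z -> s * chi z - N <= u t z 0 i) ->
  s * (\int[mu]_z (ker J (rho t) y z * chi z)) - N <= disp t y i.
Proof.
move=> t0 cchi chi01 chiOm s0 N0 hN; have [C hC] := solution_bounded t0.
rewrite /disp; have hb z (Oz : Om z) := hC z i (subset_closure Oz).
exact: (dispersal_ge_barrier (h := fun z => u t z 0 i) cJ J0 J1 JB JS oOm bOm y (rho0 t0)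
  (solution_measurable i t0) hb cchi chi01 chiOm s0 N0 hN).
Qed.

Lemma disp_ge_on t y i (c a : R) (E : set 'rV[R]_n) : 0 <= t ->
  measurable (E : set (lebesgueType R n)) -> E `<=` Om -> 0 <= c -> 0 <= a ->
  (forall z, Om z -> 0 <= u t z 0 i) -> (forall z, E z -> c <= ker J (rho t) y z) ->
  (forall z, E z -> a <= u t z 0 i) -> c * a * fine (mu E) <= disp t y i.
Proof.
move=> t0 mE EOm c0 a0 h0 kc ha; have [C hC] := solution_bounded t0.
rewrite /disp; have hb z (Oz : Om z) := hC z i (subset_closure Oz).
exact: (dispersal_ge_on (h := fun z => u t z 0 i) cJ J0 JB oOm bOm (rho0 t0)
  (solution_measurable i t0) hb mE EOm c0 a0 h0 kc ha).
Qed.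

Let dm : R := \sum_i d 0 i.

Let d_le i : d 0 i <= dm.
Proof. by rewrite /dm (bigD1 i)//= lerDl sumr_ge0// => j _; rewrite ltW. Qed.

Let dm0 : 0 <= dm. Proof. by rewrite sumr_ge0// => j _; rewrite ltW. Qed.

Let vM : M v.
Proof. by apply/order_intervalP => i; rewrite lexx (ltW ((vll0P _).1 v0 i)). Qed.

Definition clamp w : 'rV[R]_m := \row_i Num.min (v 0 i) (Num.max 0 (w 0 i)).

Lemma clamp_in w : M (clamp w).
Proof.
apply/order_intervalP => i; rewrite mxE ge_min lexx/= andbT le_min le_max lexx/=.
by rewrite andbT (ltW ((vll0P _).1 v0 i)).
Qed.

Lemma clamp_top w i : v 0 i < w 0 i -> clamp w 0 i = v 0 i.
Proof.
move=> h; have vi := (vll0P _).1 v0 i.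
by rewrite mxE max_r ?(ltW (lt_trans vi h))// min_l// ltW.
Qed.

Lemma clamp_bottom w i : w 0 i < 0 -> clamp w 0 i = 0.
Proof. by move=> h; rewrite mxE max_l ?(ltW h)// min_r// ltW ?(vll0P _).1. Qed.

Lemma clamp_dist w (N : R) : 0 <= N -> (forall i, - N <= w 0 i <= v 0 i + N) ->
  `|w - clamp w| <= N.
Proof.
move=> N0 h; apply: norm_le_coord => // i; rewrite !mxE.
have /andP[h1 h2] := h i; have vi := (vll0P _).1 v0 i.
rewrite ler_norml /Order.max /Order.min.
by repeat case: ifPn => //; rewrite -?leNgt => *; apply/andP; split; lra.
Qed.

(** The order interval is invariant: both families u_i - v_i and - u_i satisfy the
    comparison principle.  Where a component leaves [0, v_i], the reaction is
    compared with its value at the clamped vector, which lies on a face of the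
    order interval: at the top face the sign condition on f applies, at the
    bottom one quasi-monotonicity and f 0 = 0. *)
Lemma solution_invariant t y : 0 <= t -> cl y -> M (u t y).
Proof.
move=> t0 cy.
have [Cd Cd0 hCd] := dilution_bounded t0.
have [L L0 hL] := Lipschitz_ball fC1 (`|v| + 1).
have [_ _ _ [sg sg0 hsg] _] := fR.
pose z (s : R) (p : 'rV[R]_n * 'I_m * bool) : R :=
  if p.2 then u s p.1.1 0 p.1.2 - v 0 p.1.2 else - u s p.1.1 0 p.1.2.
have C0 : 0 <= dm + Cd + L by rewrite !addr_ge0// ltW.
have H : forall s p, 0 <= s <= t -> cl p.1.1 -> z s p <= 0.
  apply: (@comparison R _ [set p : 'rV[R]_n * 'I_m * bool | cl p.1.1] z 0 t
    (dm + Cd + L) t0 C0).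
  - move=> s eps /andP[s0 st] eps0.
    have [del del0 hd] := solution_equicontinuous s0 eps0.
    exists del => // s' [[y' i] b] /andP[s'0 _] /= cy' ss'.
    have := hd s' s'0 ss' y' i cy'; rewrite /z/=; case: b => //.
      by rewrite opprD opprK addrACA [- v 0 i + _]addrC subrr addr0.
    by rewrite -opprB normrN opprK addrC -normrN opprD opprK addrC.
  - move=> [[y' i] b] /= cy'; have [_ _ u0 _] := usol.
    have [_ phiM] := phiv; have /order_intervalP/(_ i)/andP[h1 h2] := phiM _ cy'.
    by rewrite /z/= u0//; case: b; rewrite ?subr_le0 ?oppr_le0.
  move=> s [[y' i] b] N /andP[s0 st] /= cy' /andP[N0 N1] hN zpos.
  have bnd x j : cl x -> - N <= u s x 0 j <= v 0 j + N.
    move=> cx; have := hN (x, j, true) cx; have := hN (x, j, false) cx.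
    by rewrite /z/= => h1 h2; apply/andP; split; lra.
  have du := solution_derive i s0 cy'.
  have /andP[U1 U2] := bnd y' i cy'.
  set U := u s y' 0 i in zpos U1 U2 *.
  have cdist : `|u s y' - clamp (u s y')| <= N.
    by apply: clamp_dist => // j; exact: bnd.
  have cM := clamp_in (u s y').
  have cn := norm_order_interval cM.
  have un : `|u s y'| <= `|v| + 1.
    have -> : u s y' = clamp (u s y') + (u s y' - clamp (u s y')) by rewrite addrC subrK.
    by apply: le_trans (ler_normD _ _) _; apply: lerD => //; apply: le_trans cdist N1.
  have vi := (vll0P _).1 v0 i.
  have := hL _ _ un (le_trans cn _) i; rewrite lerDl => /(_ ler01) hf.
  have {}hf : `|f (u s y') 0 i - f (clamp (u s y')) 0 i| <= L * N.
    by apply: (le_trans hf); rewrite ler_pM2l.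
  have hdil := hCd s ltac:(by rewrite ltW).
  case: b zpos => zpos; rewrite /z/= in zpos.
    rewrite subr_gt0 in zpos; have ci := clamp_top zpos.
    exists (d 0 i * (disp s y' i - U) - dil s * U + f (u s y') 0 i); split.
      rewrite /z/=; apply: is_derive_eq; by rewrite subr0.
    have hD : disp s y' i <= v 0 i + N.
      apply: disp_le; rewrite ?(ltW s0)// ?addr_ge0 ?(ltW vi)// => x Ox.
      by have /andP[] := bnd x i (subset_closure Ox).
    have h3 := hsg i s _ (ltW s0) cM ci.
    exact: clamp_top_balance (ltW (d0 i)) (d_le i) N0 (ltW sg0) hD zpos U2 hdil h3 hf.
  rewrite oppr_gt0 in zpos; have ci := clamp_bottom zpos.
  exists (- (d 0 i * (disp s y' i - U) - dil s * U + f (u s y') 0 i)); split.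
    by rewrite /z/=; apply: is_derive_eq.
  have hD : - N <= disp s y' i.
    apply: disp_ge; rewrite ?(ltW s0)// => x Ox.
    by have /andP[] := bnd x i (subset_closure Ox).
  have h3 : f 0 0 i <= f (clamp (u s y')) 0 i.
    apply: (quasi_monotone fC1 fcoop) => //; [exact: order_interval0|exact: cM.1|].
    by rewrite ci mxE.
  rewrite f0 mxE in h3.
  exact: clamp_bottom_balance (ltW (d0 i)) (d_le i) N0 hD zpos U1 hdil h3 hf.
apply/order_intervalP => i.
have := H t (y, i, true) _ cy; have := H t (y, i, false) _ cy.
by rewrite lexx t0 /z/= => /(_ isT) h1 /(_ isT) h2; apply/andP; split; lra.
Qed.

(** Comparison of one solution with barriers of the form E(t) b(y), from above
    (sg = 1) or from below (sg = -1, with b replaced by its opposite). *)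
Lemma solution_comparison (sg T t C B0 : R) (E dE : R -> R)
    (b : 'rV[R]_n -> 'I_m -> R) :
  `|sg| <= 1 -> 0 <= T -> T <= t -> 0 <= C ->
  (forall s, is_derive s (1 : R) E (dE s)) ->
  (forall y i, cl y -> `|b y i| <= B0) ->
  (forall y i, cl y -> sg * u T y 0 i <= E T * b y i) ->
  (forall s y i N, T < s <= t -> cl y -> 0 <= N <= 1 ->
     (forall x j, cl x -> sg * u s x 0 j <= E s * b x j + N) ->
     E s * b y i < sg * u s y 0 i ->
     sg * (d 0 i * (disp s y i - u s y 0 i) - dil s * u s y 0 i + f (u s y) 0 i)
       <= dE s * b y i + C * N) ->
  forall y i, cl y -> sg * u t y 0 i <= E t * b y i.
Proof.
move=> sg1 T0 Tt C0 hE hb init hd.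
pose z (s : R) (p : 'rV[R]_n * 'I_m) : R := sg * u s p.1 0 p.2 - E s * b p.1 p.2.
suff H : forall s p, T <= s <= t -> cl p.1 -> z s p <= 0.
  by move=> y i cy; rewrite -subr_le0; apply: (H t (y, i)) => //; rewrite Tt lexx.
apply: (@comparison R _ [set p : 'rV[R]_n * 'I_m | cl p.1] z T t C Tt C0).
- move=> s eps /andP[Ts st] eps0.
  have s0 : 0 <= s := le_trans T0 Ts.
  have e20 : 0 < eps / 2 by rewrite divr_gt0.
  have [d1 d10 hd1] := solution_equicontinuous s0 e20.
  have B1 : 0 < `|B0| + 1 by rewrite ltr_wpDl.
  have : E x @[x --> s] --> E s.
    by apply: differentiable_continuous; apply/derivable1_diffP; have [] := hE s.
  have e30 : 0 < eps / 2 / (`|B0| + 1) by rewrite divr_gt0.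
  move=> /cvgrPdist_lt/(_ _ e30)/nbhs_ballP[d2 /= d20 hd2].
  exists (Num.min d1 d2); first by rewrite lt_min d10.
  move=> x [y i] /andP[Tx xt] /= cy; rewrite lt_min => /andP[xd1 xd2].
  have h1 := hd1 x (le_trans T0 Tx) xd1 y i cy.
  have h2 : `|E s - E x| < eps / 2 / (`|B0| + 1) by apply: hd2; rewrite /ball/= distrC.
  rewrite /z/=.
  have -> : sg * u x y 0 i - E x * b y i - (sg * u s y 0 i - E s * b y i) =
    sg * (u x y 0 i - u s y 0 i) + (E s - E x) * b y i by ring.
  rewrite [eps]splitr; apply: le_trans (ler_normD _ _) _; rewrite !normrM.
  apply: lerD; first by rewrite -[leRHS]mul1r; apply: ler_pM.
  rewrite ltr_pdivlMr// in h2; apply: le_trans (ltW h2); apply: ler_wpM2l => //.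
  apply: le_trans (hb y i cy) _; apply: le_trans (ler_norm _) _.
  by rewrite lerDl.
- by move=> [y i] /= cy; rewrite /z/= subr_le0; exact: init.
move=> s [y i] N /andP[Ts st] /= cy N01 hN; rewrite /z/= subr_gt0 => zpos.
have s0 : 0 < s := le_lt_trans T0 Ts.
have := hd s y i N; rewrite Ts st => /(_ isT cy N01) h.
have := h _ zpos => {}h.
have du := solution_derive i s0 cy; have dEs := hE s.
set r := _ - _ + _ in du h.
exists (sg * r - dE s * b y i); split; last first.
  rewrite lerBlDl; apply: h => x j cx.
  by have := hN (x, j) cx; rewrite /z/= lerBlDl.
have -> : (z^~ (y, i)) = (sg \*: (fun s => u s y 0 i)) \- (E \* cst (b y i)).
  by apply/funext.
by apply: is_derive_eq; rewrite /GRing.scale/= mulr0 add0r; ring.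
Qed.

Lemma reaction_Lipschitz : exists2 L : R, 0 < L & forall a b (N : R), M a -> M b ->
  (forall j, `|a 0 j - b 0 j| <= N) -> 0 <= N -> forall i,
  `|f a 0 i - f b 0 i| <= L * N.
Proof.
have [L L0 hL] := Lipschitz_ball fC1 `|v|; exists L => // a b N aM bM hab N0 i.
apply: le_trans (hL _ _ (norm_order_interval aM) (norm_order_interval bM) i) _.
by rewrite ler_pM2l//; apply: norm_le_coord => // j; rewrite !mxE.
Qed.

Lemma dilution_term (t N U a kap c Cd : R) : `|dil t - kap| <= c -> `|dil t| <= Cd ->
  0 <= a -> `|U - a| <= N -> 
  `|dil t * U - kap * a| <= c * a + Cd * N.
Proof.
move: (dil t) => D h1 h2 a0 h3.
have -> : D * U - kap * a = (D - kap) * a + D * (U - a) by ring.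
apply: le_trans (ler_normD _ _) _; rewrite !normrM (ger0_norm a0).
by apply: lerD; [rewrite ler_wpM2r|rewrite ler_pM].
Qed.

(** Upper barriers s(t) w with s' = - c (s - 1).  Constants are supersolutions for
    dispersal, whose kernel has mass at most 1 in Om.  Replacing u by
    u' = min (u, s w) costs N; then u' touches s w in the i-th component, and
    subhomogeneity with quasi-monotonicity gives f_i u' <= s f_i w. *)
Lemma solution_upper w (kap c T s0 t : R) : M w -> vll 0 w -> 0 < c -> 0 <= T ->
  (forall t, T <= t -> `|dil t - kap| <= c) -> 1 <= s0 ->
  (forall i, f w 0 i <= (kap - 2 * c) * w 0 i) ->
  (forall y i, cl y -> u T y 0 i <= s0 * w 0 i) ->
  T <= t -> forall y i, cl y ->
  u t y 0 i <= (1 + (s0 - 1) * expR (- c * (t - T))) * w 0 i.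
Proof.
move=> wM /vll0P w0 c0 T0 hdil s01 fw init Tt y i cy.
have t0 := le_trans T0 Tt.
have [Cd Cd0 hCd] := dilution_bounded t0.
have [L L0 hL] := reaction_Lipschitz.
pose E s : R := 1 + (s0 - 1) * expR (- c * (s - T)).
have hE s : is_derive s (1 : R) E (- c * (E s - 1)).
  by rewrite /E; apply: is_derive_eq; rewrite /GRing.scale/=; ring.
have E1 s : 1 <= E s by rewrite lerDl mulr_ge0 ?subr_ge0// ltW// expR_gt0.
have E0 s : 0 < E s by apply: lt_le_trans (E1 s).
have C0 : 0 <= dm + Cd + L by rewrite !addr_ge0// ltW.
have hb y' j : cl y' -> `|w 0 j| <= `|v|.
  by move=> _; apply: le_trans (coord_le_norm w j) (norm_order_interval wM).
have := @solution_comparison 1 T t _ _ E (fun s => - c * (E s - 1))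
  (fun _ j => w 0 j) _ T0 Tt C0 hE hb _ _ y i cy.
rewrite normr1 lexx mul1r; apply => //.
  move=> y' j cy'; rewrite mul1r /E subrr mulr0 expR0 mulr1 addrC subrK; exact: init.
move=> s {}y {}i N /andP[Ts st] {}cy /andP[N0 N1] hN; rewrite !mul1r => zpos.
have sT0 := le_trans T0 (ltW Ts).
have uM := solution_invariant sT0 cy.
pose u' : 'rV[R]_m := \row_j Num.min (u s y 0 j) (E s * w 0 j).
have u'uv j : [/\ 0 <= u' 0 j, u' 0 j <= u s y 0 j, u' 0 j <= E s * w 0 j &
    u s y 0 j - u' 0 j <= N].
  have /order_intervalP/(_ j)/andP[h1 h2] := uM.
  have := hN y j cy; rewrite mul1r => h3.
  have h4 : 0 < E s * w 0 j by rewrite mulr_gt0.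
  by rewrite mxE; apply: min_gap; rewrite // ltW.
have u'M : M u'.
  apply/order_intervalP => j; have [h1 h2 _ _] := u'uv j.
  have /order_intervalP/(_ j)/andP[_ h3] := uM.
  by rewrite h1 (le_trans h2 h3).
have u'i : u' 0 i = E s * w 0 i by rewrite mxE min_r// ltW.
have V01 : 0 <= (E s)^-1 <= 1 by rewrite invr_ge0 (ltW (E0 s)) (invf_le1 (E0 s)) E1.
have h1 : f u' 0 i <= E s * ((kap - 2 * c) * w 0 i).
  have := subhomogeneous_le v0 fC1 f0 fsub u'M V01 i.
  rewrite mxE mulrC ler_pdivrMr// mulrC => h; apply: (le_trans h).
  rewrite ler_pM2l//; apply: le_trans (fw i).
  apply: (quasi_monotone fC1 fcoop) => //; first exact: order_interval_scale.
    move=> j; rewrite mxE mulrC ler_pdivrMr// mulrC; by have [] := u'uv j.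
  by rewrite mxE u'i mulrA mulVf ?mul1r// gt_eqF.
have h2 : `|f (u s y) 0 i - f u' 0 i| <= L * N.
  apply: hL => // j; have [_ a1 _ a2] := u'uv j.
  by rewrite ger0_norm// subr_ge0.
have h3 : `|dil s * u s y 0 i - kap * (E s * w 0 i)| <= c * (E s * w 0 i) + Cd * N.
  apply: dilution_term.
  - by apply: hdil; exact: ltW.
  - by apply: hCd; rewrite sT0.
  - by rewrite mulr_ge0// ltW.
  have := hN y i cy; rewrite mul1r => h3.
  by rewrite ger0_norm ?subr_ge0 ?(ltW zpos)// lerBlDl.
have h4 : d 0 i * (disp s y i - u s y 0 i) <= dm * N.
  apply: le_trans (_ : d 0 i * N <= _); last by rewrite ler_wpM2r.
  rewrite ler_pM2l// lerBlDr.
  apply: le_trans (_ : E s * w 0 i + N <= _); last by rewrite addrC lerD2l ltW.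
  apply: disp_le => //.
    by rewrite addr_ge0// mulr_ge0// ltW.
  by move=> x Ox; have := hN x i (subset_closure Ox); rewrite mul1r.
exact: (upper_balance c0 (w0 i) h1 h2 h3 h4).
Qed.

(** Lower barriers s(t) chi(y) w with s' = c s0 (1 - s).  Constants are not
    subsolutions, since mass is lost through the boundary of Om; the bump chi
    repairs this up to the factor 1 - eta.  The margin 3 c in the reaction pays
    for that factor, for the variation of the dilution rate, and for s'. *)
Lemma solution_lower w (kap c T s0 t : R) (chi : 'rV[R]_n -> R) (eta r0 : R) :
  M w -> vll 0 w -> 0 < c -> 0 <= T ->
  (forall t, T <= t -> `|dil t - kap| <= c) -> 0 < s0 -> s0 <= 1 ->
  (forall i, (kap + 3 * c) * w 0 i <= f w 0 i) ->
  continuous chi -> (forall z, 0 <= chi z <= 1) -> (forall z, chi z != 0 -> Om z) ->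
  0 <= eta -> (forall i, d 0 i * eta <= c) ->
  (forall r y, r0 <= r -> (1 - eta) * chi y <= \int[mu]_z (ker J r y z * chi z)) ->
  (forall t, T <= t -> r0 <= rho t) ->
  (forall y i, cl y -> s0 * (chi y * w 0 i) <= u T y 0 i) ->
  T <= t -> forall y i, cl y ->
  (1 - (1 - s0) * expR (- (c * s0) * (t - T))) * (chi y * w 0 i) <= u t y 0 i.
Proof.
move=> wM /vll0P w0 c0 T0 hdil s00 s01 fw cchi chi01 chiOm eta0 deta bar hrho init Tt y i cy.
have t0 := le_trans T0 Tt.
have [Cd Cd0 hCd] := dilution_bounded t0.
have [L L0 hL] := reaction_Lipschitz.
pose E s : R := 1 - (1 - s0) * expR (- (c * s0) * (s - T)).
have hE s : is_derive s (1 : R) E ((c * s0) * (1 - E s)).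
  by rewrite /E; apply: is_derive_eq; rewrite /GRing.scale/=; ring.
have E1 s : E s <= 1 by rewrite gerBl mulr_ge0 ?subr_ge0// ltW// expR_gt0.
have Es0 s : T <= s -> s0 <= E s.
  move=> Ts; rewrite lerBrDr -lerBrDl -[leRHS]mulr1 ler_wpM2l ?subr_ge0//.
  by rewrite -expR0 ler_expR mulNr oppr_le0 mulr_ge0 ?subr_ge0// mulr_ge0// ?(ltW c0)// ltW.
have C0 : 0 <= dm + Cd + L by rewrite !addr_ge0// ltW.
have hb y' j : cl y' -> `|- (chi y' * w 0 j)| <= `|v|.
  move=> _; rewrite normrN normrM -[leRHS]mul1r; have /andP[x0 x1] := chi01 y'.
  apply: ler_pM => //; first by rewrite ger0_norm.
  by apply: le_trans (coord_le_norm w j) (norm_order_interval wM).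
have := @solution_comparison (-1) T t _ _ E (fun s => (c * s0) * (1 - E s))
  (fun y' j => - (chi y' * w 0 j)) _ T0 Tt C0 hE hb _ _ y i cy.
rewrite normrN1 lexx mulrN mulN1r lerN2; apply => //.
  move=> y' j cy'; rewrite mulN1r mulrN lerN2 /E subrr mulr0 expR0 mulr1 opprB addrC subrK.
  exact: init.
move=> s {}y {}i N /andP[Ts st] {}cy /andP[N0 N1] hN; rewrite !mulN1r mulrN ltrN2 => zpos.
have sT0 := le_trans T0 (ltW Ts).
have E0 : 0 < E s by apply: lt_le_trans s00 (Es0 s (ltW Ts)).
have uM := solution_invariant sT0 cy.
have {}hN x j : cl x -> E s * (chi x * w 0 j) - N <= u s x 0 j.
  by move=> cx; have := hN x j cx; rewrite mulN1r mulrN => h; lra.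
pose a := E s * chi y.
have /andP[chi0 chi1] := chi01 y.
have a0 : 0 <= a by rewrite mulr_ge0// ltW.
have a1 : a <= 1 by rewrite -[leRHS]mulr1 ler_pM// ltW.
have aw j : E s * (chi y * w 0 j) = a * w 0 j by rewrite mulrA.
pose u' : 'rV[R]_m := \row_j Num.max (u s y 0 j) (a * w 0 j).
have u'uv j : [/\ u s y 0 j <= u' 0 j, a * w 0 j <= u' 0 j &
    u' 0 j - u s y 0 j <= N].
  have := hN y j cy; rewrite aw => h3.
  by rewrite mxE; apply: max_gap.
have awM : M (a *: w) by apply: order_interval_scale; rewrite // a0.
have u'M : M u'.
  apply/order_intervalP => j.
  have /order_intervalP/(_ j) := uM; have /order_intervalP/(_ j) := awM.
  by rewrite !mxE le_max ge_max => /andP[-> ->] /andP[-> ->].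
rewrite aw in zpos.
have u'i : u' 0 i = a * w 0 i by rewrite mxE max_r// ltW.
have h1 : a * ((kap + 3 * c) * w 0 i) <= f u' 0 i.
  have a01 : 0 <= a <= 1 by rewrite a0.
  have := subhomogeneous_le v0 fC1 f0 fsub wM a01 i; rewrite mxE => h.
  apply: le_trans (_ : a * f w 0 i <= _); first by rewrite ler_wpM2l.
  apply: (le_trans h); apply: (quasi_monotone fC1 fcoop) => //.
    by move=> j; rewrite mxE; have [] := u'uv j.
  by rewrite mxE u'i.
have h2 : `|f (u s y) 0 i - f u' 0 i| <= L * N.
  apply: hL => // j; have [x1 _ x2] := u'uv j.
  by rewrite distrC ger0_norm// subr_ge0.
have h3 : `|dil s * u s y 0 i - kap * (a * w 0 i)| <= c * (a * w 0 i) + Cd * N.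
  apply: dilution_term.
  - by apply: hdil; exact: ltW.
  - by apply: hCd; rewrite sT0.
  - by rewrite mulr_ge0// ltW.
  have := hN y i cy; rewrite aw => h3.
  by rewrite distrC ger0_norm ?subr_ge0 ?(ltW zpos)// lerBlDl -lerBlDr.
have h4 : - (c * (a * w 0 i) + dm * N) <= d 0 i * (disp s y i - u s y 0 i).
  have h : (1 - eta) * (a * w 0 i) - N <= disp s y i.
    have Ew : 0 <= E s * w 0 i by rewrite mulr_ge0// ltW.
    have := @disp_ge_barrier s y i chi (E s * w 0 i) N sT0 cchi chi01 chiOm Ew N0.
    have hx x : Om x -> E s * w 0 i * chi x - N <= u s x 0 i.
      by move=> Ox; have := hN x i (subset_closure Ox); rewrite [chi x * _]mulrC mulrA.
    move=> /(_ hx); apply: le_trans; rewrite lerD2r.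
    have := bar (rho s) y (hrho s (ltW Ts)) => hbar.
    have := ler_wpM2l Ew hbar; apply: le_trans.
    by rewrite le_eqVlt; apply/orP; left; apply/eqP; rewrite /a; ring.
  have aw0 : 0 <= a * w 0 i by rewrite mulr_ge0// ltW.
  exact: barrier_loss (ltW (d0 i)) (d_le i) N0 aw0 (deta i) h (ltW zpos).
have h7 : c * s0 * (1 - E s) * (chi y * w 0 i) <= c * (a * w 0 i).
  rewrite /a -mulrA -mulrA ler_pM2l// !mulrA ler_pM2r//.
  rewrite ler_wpM2r//; apply: le_trans (Es0 s (ltW Ts)).
  by rewrite -[leRHS]mulr1 ler_pM2l// gerBl ltW.
rewrite mulrN; exact: (lower_balance h1 h2 h3 h4 h7).
Qed.

Lemma solution_growth (T Cd L delta : R) : 0 <= Cd -> 0 <= L ->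
  (forall t, 0 <= t <= T -> `|dil t| <= Cd) ->
  (forall a i, M a -> `|f a 0 i| <= L * `|a|) -> 0 < delta ->
  (forall y i, cl y -> phi y 0 i <= delta) ->
  forall t y i, 0 <= t <= T -> cl y -> u t y 0 i <= delta * expR ((Cd + L) * t).
Proof.
move=> Cd0 L0 hCd hL delta0 hphi t y i /andP[t0 tT] cy.
have C0 : 0 <= dm + Cd + L by rewrite !addr_ge0.
pose E s : R := delta * expR ((Cd + L) * s).
have hE s : is_derive s (1 : R) E ((Cd + L) * E s).
  by rewrite /E; apply: is_derive_eq; rewrite /GRing.scale/=; ring.
have E0 s : 0 < E s by rewrite mulr_gt0// expR_gt0.
have := @solution_comparison 1 0 t _ 1 E (fun s => (Cd + L) * E s)
  (fun _ _ => 1) _ (lexx 0) t0 C0 hE _ _ _ y i cy.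
move=> H; rewrite -/(E t) -[leRHS]mulr1 -[leLHS]mul1r.
apply: H => //; rewrite ?normr1//.
  have [_ _ u0 _] := usol.
  by move=> y' j cy'; rewrite mul1r /E mulr0 expR0 !mulr1 u0//; exact: hphi.
move=> s {}y {}i N /andP[s0 st] {}cy /andP[N0 N1] hN; rewrite !mul1r mulr1 => zpos.
have uM := solution_invariant (ltW s0) cy.
have {}hN x j : cl x -> u s x 0 j <= E s + N.
  by move=> cx; have := hN x j cx; rewrite mul1r mulr1.
have un : `|u s y| <= E s + N.
  apply: norm_le_coord; first by rewrite addr_ge0// ltW.
  move=> j; have /order_intervalP/(_ j)/andP[x1 x2] := uM.
  by rewrite ger0_norm// hN.
have h2 : `|f (u s y) 0 i| <= L * (E s + N).
  by apply: le_trans (hL _ _ uM) _; rewrite ler_wpM2l.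
have h3 : `|dil s * u s y 0 i| <= Cd * (E s + N).
  rewrite normrM; apply: ler_pM => //.
    by apply: hCd; rewrite (ltW s0) (le_trans st tT).
  by apply: le_trans (coord_le_norm _ i) un.
have h4 : d 0 i * (disp s y i - u s y 0 i) <= dm * N.
  apply: le_trans (_ : d 0 i * N <= _); last by rewrite ler_wpM2r.
  rewrite ler_pM2l// lerBlDr.
  apply: le_trans (_ : E s + N <= _); last by rewrite addrC lerD2l ltW.
  apply: disp_le; rewrite ?(ltW s0)//.
    by rewrite addr_ge0// ltW.
  by move=> x Ox; exact: hN (subset_closure Ox).
rewrite mulr1; exact: (growth_balance h2 h3 h4).
Qed.

(** * Positivity of solutions *)

Definition velocity t y i : R :=
  d 0 i * (disp t y i - u t y 0 i) - dil t * u t y 0 i + f (u t y) 0 i.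

(** All negative contributions to the velocity of u_i are bounded by a multiple of
    u_i, which an integrating factor absorbs; what remains is fed by dispersal
    and by the coupling to other components. *)
Lemma velocity_lower_bound T : 0 <= T -> exists Lam kap : R, [/\ 0 <= Lam, 0 < kap,
  forall t y i, 0 < t <= T -> cl y ->
    0 <= d 0 i * disp t y i <= velocity t y i + Lam * u t y 0 i &
  forall t y i j, 0 < t <= T -> cl y -> i != j -> 0 < Df f 0 i j ->
    kap * u t y 0 j <= velocity t y i + Lam * u t y 0 i].
Proof.
move=> T0; have [Cd Cd0 hCd] := dilution_bounded T0.
have [C [kap [C0 kap0 h1 h2]]] := reaction_lower_bound v0 fC1 fcoop f0.
have disp0 t y i : 0 < t <= T -> cl y -> 0 <= d 0 i * disp t y i.
  move=> /andP[t0 tT] cy; rewrite mulr_ge0 ?(ltW (d0 i))// -oppr0; apply: disp_ge => //.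
    exact: ltW.
  move=> z Oz; have /order_intervalP/(_ i)/andP[h _] :=
    solution_invariant (ltW t0) (subset_closure Oz).
  by rewrite oppr0.
have uM t y i : 0 < t <= T -> cl y -> M (u t y) /\ 0 <= u t y 0 i.
  move=> /andP[t0 tT] cy; have UM := solution_invariant (ltW t0) cy.
  by split => //; have /order_intervalP/(_ i)/andP[] := UM.
have du t y i : 0 < t <= T -> cl y -> dil t * u t y 0 i <= Cd * u t y 0 i.
  move=> tT cy; have [_ u0] := uM t y i tT cy; have /andP[t0 tT'] := tT.
  rewrite ler_wpM2r//; apply: le_trans (ler_norm _) (hCd t _).
  by rewrite (ltW t0).
have dmu t y i : 0 < t <= T -> cl y -> d 0 i * u t y 0 i <= dm * u t y 0 i.
  by move=> tT cy; have [_ u0] := uM t y i tT cy; rewrite ler_wpM2r.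
exists (dm + Cd + C), kap; split => //; first by rewrite !addr_ge0.
  move=> t y i tT cy; rewrite disp0//=.
  have [UM u0] := uM t y i tT cy; have := h1 _ i UM.
  have := du t y i tT cy; have := dmu t y i tT cy.
  exact: velocity_balance.
move=> t y i j tT cy ij Dij.
have [UM u0] := uM t y i tT cy; have := h2 _ i j UM ij Dij.
have := du t y i tT cy; have := dmu t y i tT cy; have := disp0 t y i tT cy.
exact: velocity_balance_coupling.
Qed.

Lemma growth_from_source (Lam T s t a : R) y i : 0 <= Lam -> 0 <= s -> s < t -> t <= T ->
  cl y -> 0 <= a ->
  (forall x, s < x < t -> a <= velocity x y i + Lam * u x y 0 i) ->
  expR (- (Lam * T)) * (u s y 0 i + (t - s) * a) <= u t y 0 i.
Proof.
move=> L0 s0 st tT cy a0 ha.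
have uM x : 0 <= x -> 0 <= u x y 0 i.
  by move=> x0; have /order_intervalP/(_ i)/andP[] := solution_invariant x0 cy.
have t0 : 0 <= t by rewrite (le_trans s0)// ltW.
pose g (x : R) := expR (Lam * x) * u x y 0 i.
have dg x : x \in `]s, t[ ->
    is_derive x (1 : R) g (expR (Lam * x) * (velocity x y i + Lam * u x y 0 i)).
  rewrite in_itv/= => /andP[sx xt]; have x0 : 0 < x := le_lt_trans s0 sx.
  have du := solution_derive i x0 cy; rewrite -/(velocity x y i) in du.
  rewrite /g; have -> : (fun x => expR (Lam * x) * u x y 0 i) =
     (fun x => expR (Lam * x)) \* (fun x => u x y 0 i) by apply/funext.
  by apply: is_derive_eq; rewrite /GRing.scale/=; ring.
have cg : {within `[s, t], continuous g}.
  have c1 : {within `[s, t], continuous (fun x : R => expR (Lam * x))}.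
    apply: derivable_within_continuous => x _.
    have : is_derive x (1 : R) (fun x : R => expR (Lam * x)) (Lam * expR (Lam * x)).
      by apply: is_derive_eq; rewrite /GRing.scale/=; ring.
    by case.
  have c2 : {within `[s, t], continuous (fun x : R => u x y 0 i)}.
    apply: eps_delta_within_continuous => x eps /andP[sx xt] eps0.
    have [del del0 hd] := solution_equicontinuous (le_trans s0 sx) eps0.
    by exists del => // x' /andP[sx' _] xx'; exact: hd (le_trans s0 sx') xx' _ _ cy.
  by move=> x; apply: (cvgM (c1 x) (c2 x)).
have [x xst e] := MVT st dg cg.
have h : (t - s) * a <= g t - g s.
  rewrite e mulrC; apply: ler_wpM2r; first by rewrite subr_ge0 ltW.
  have xx : s < x < t by move: xst; rewrite in_itv.
  apply: le_trans (ha x xx) _; rewrite -[leLHS]mul1r ler_wpM2r//.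
    exact: le_trans a0 (ha x xx).
  rewrite -expR0 ler_expR mulr_ge0//; have /andP[sx _] := xx.
  exact: ltW (le_lt_trans s0 sx).
have hs : u s y 0 i <= g s.
  by rewrite /g -[leLHS]mul1r ler_wpM2r ?uM// -expR0 ler_expR mulr_ge0.
rewrite expRN mulrC ler_pdivrMr ?expR_gt0//.
apply: (@le_trans _ _ (g t)); first by lra.
rewrite /g mulrC ler_wpM2l ?uM// ler_expR ler_wpM2l//.
Qed.

Lemma ker_lower_bound T : 0 <= T -> exists del k0 : R, [/\ 0 < del, 0 < k0 &
  forall t y z, 0 <= t <= T -> ball y del z -> k0 <= ker J (rho t) y z].
Proof.
move=> T0; have [a [b [a0 hab]]] := rho_bounded T0.
have b0 : 0 < b.
  by have := hab 0; rewrite lexx T0 => /(_ isT)/andP[h1 h2]; apply: lt_le_trans a0 (le_trans h1 h2).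
have J2 : 0 < J 0 / 2 by rewrite divr_gt0.
have := @cJ 0; move=> /cvgrPdist_lt/(_ _ J2)/nbhs_ballP[dJ /= dJ0 hdJ].
exists (dJ / b), (a ^+ n * (J 0 / 2)); split.
- by rewrite divr_gt0.
- by rewrite mulr_gt0// exprn_gt0.
move=> t y z tT; rewrite -ball_normE/= => yz.
have /andP[h1 h2] := hab t tT; have r0 : 0 < rho t := lt_le_trans a0 h1.
rewrite /ker /scaled_kernel; apply: ler_pM.
- by rewrite exprn_ge0// ltW.
- exact: ltW.
- by rewrite lerXn2r// nnegrE ltW.
have : ball 0 dJ (rho t *: (y - z)).
  rewrite -ball_normE/= sub0r normrN normrZ (gtr0_norm r0).
  apply: le_lt_trans (_ : b * `|y - z| < _); first by rewrite ler_wpM2r.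
  by rewrite mulrC -ltr_pdivlMr.
by move=> /hdJ; rewrite ltr_distlC => /andP[h _]; lra.
Qed.

Let u_ge0 t y i : 0 <= t -> cl y -> 0 <= u t y 0 i.
Proof.
by move=> t0 cy; have /order_intervalP/(_ i)/andP[] := solution_invariant t0 cy.
Qed.

Lemma persistence T : 0 <= T -> exists2 e : R, 0 < e &
  forall s t y i, 0 <= s -> s <= t -> t <= T -> cl y -> e * u s y 0 i <= u t y 0 i.
Proof.
move=> T0; have [Lam [kap [L0 _ hL _]]] := velocity_lower_bound T0.
exists (expR (- (Lam * T))); first exact: expR_gt0.
move=> s t y i s0 st tT cy; have [->|ts] := eqVneq s t.
  rewrite ler_piMl ?u_ge0 ?(le_trans s0 st)// -expR0 ler_expR oppr_le0.
  by rewrite mulr_ge0.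
have {ts}st : s < t by rewrite lt_neqAle ts.
have := @growth_from_source Lam T s t 0 y i L0 s0 st tT cy (lexx _).
rewrite mulr0 addr0; apply => x /andP[sx xt].
have [|a b] := andP (hL x y i _ cy); last exact: le_trans a b.
by rewrite (le_lt_trans s0 sx) (le_trans (ltW xt) tT).
Qed.

(** Positivity around y0 on a ball whose radius does not depend on the time; this
    uniformity is what makes positivity spread in space at any given time. *)
Definition positive_near T i y0 := exists2 r : R, 0 < r & forall t, 0 < t <= T ->
  exists2 c : R, 0 < c & forall y, cl y -> ball y0 r y -> c <= u t y 0 i.

Lemma positive_near_after T i y0 : positive_near T i y0 -> exists2 r : R, 0 < r &
  forall t, 0 < t <= T -> exists2 c : R, 0 < c &
  forall s y, t <= s <= T -> cl y -> ball y0 r y -> c <= u s y 0 i.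
Proof.
move=> [r r0 h]; exists r => // t /andP[t0 tT].
have [e e0 he] := persistence (le_trans (ltW t0) tT).
have [|c c0 hc] := h t; first by rewrite t0.
exists (e * c); first exact: mulr_gt0.
move=> s y /andP[ts sT] cy yr; apply: le_trans (he t s y i (ltW t0) ts sT cy).
by rewrite ler_pM2l//; exact: hc.
Qed.

(** Within the radius del, on which the kernel has a positive lower bound for all
    times up to T, any set of positive measure carrying mass is a source. *)
Lemma positive_near_of_mass T : 0 < T -> exists2 del : R, 0 < del &
  forall i y0 (E : set 'rV[R]_n), measurable (E : set (lebesgueType R n)) ->
    E `<=` Om -> mu E != 0%E -> (forall z, E z -> ball y0 del z) ->
    (forall t, 0 < t <= T -> exists2 c : R, 0 < c &
       forall s z, t <= s <= T -> E z -> c <= u s z 0 i) ->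
    positive_near T i y0.
Proof.
move=> T0; have [del [k0 [del0 k00 hk]]] := ker_lower_bound (ltW T0).
have [Lam [kap [L0 _ hL _]]] := velocity_lower_bound (ltW T0).
have del2 : 0 < del / 2 by rewrite divr_gt0.
exists (del / 2) => // i y0 E mE EOm E0 Eb Ec; exists (del / 2) => // t /andP[t0 tT].
have t2 : 0 < t / 2 by rewrite divr_gt0.
have t2t : t / 2 < t by lra.
have [|c c0 hc] := Ec (t / 2); first by rewrite t2; lra.
pose a := d 0 i * (k0 * c * fine (mu E)).
have muE : 0 < fine (mu E).
  rewrite fine_gt0// lt_neqAle eq_sym E0 lebesgue_outer_ge0/=.
  apply: le_lt_trans (bounded_finite_measure bOm); exact: le_lebesgue_outer.
have a0 : 0 < a by rewrite !mulr_gt0.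
exists (expR (- (Lam * T)) * ((t - t / 2) * a)).
  by rewrite mulr_gt0 ?expR_gt0// mulr_gt0// subr_gt0.
move=> y cy yb.
apply: le_trans (_ : expR (- (Lam * T)) * (u (t / 2) y 0 i + (t - t / 2) * a) <= _).
  by rewrite ler_pM2l ?expR_gt0// lerDr u_ge0// ltW.
apply: growth_from_source => //; rewrite ?(ltW t2) ?(ltW a0)//.
move=> x /andP[x1 x2]; have x0 := lt_trans t2 x1; have xT := le_trans (ltW x2) tT.
have [|_ h] := andP (hL x y i _ cy); first by rewrite x0.
apply: le_trans h; rewrite ler_pM2l//.
apply: disp_ge_on => //; rewrite ?(ltW x0) ?(ltW k00) ?(ltW c0)//.
- by move=> z Oz; rewrite u_ge0 ?(ltW x0)//; exact: subset_closure.
- move=> z Ez; apply: hk; first by rewrite (ltW x0).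
  by apply: (@ball_splitr _ _ y0) => //; exact: Eb.
by move=> z Ez; apply: hc => //; rewrite (ltW x1).
Qed.

Lemma positive_near_step T i : 0 < T -> connected Om ->
  (exists2 y, Om y & positive_near T i y) -> forall y, Om y -> positive_near T i y.
Proof.
move=> T0 cO ne; have [del del0 hdel] := positive_near_of_mass T0.
have del2 : 0 < del / 2 by rewrite divr_gt0.
apply: (connected_chain (e := del / 2) cO del2 ne) => x y Ox Oy px xy.
have [r r0 hr] := positive_near_after px.
pose e := Num.min (del / 2) r.
have e0 : 0 < e by rewrite lt_min del2.
have [/= s s0 sO] : exists2 s : R, 0 < s & ball x s `<=` Om.
  by have /nbhs_ballP[s s0 sO] := open_nbhs_nbhs (conj oOm Ox); exists s.
pose e' := Num.min e s.
have e'0 : 0 < e' by rewrite lt_min e0.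
have bx z : ball x e' z -> [/\ Om z, ball x r z & ball x (del / 2) z].
  move=> xz; split.
  - by apply: sO; apply: le_ball xz; rewrite ge_min lexx orbT.
  - by apply: le_ball xz; rewrite ge_min/= ge_min lexx orbT.
  - by apply: le_ball xz; rewrite ge_min/= ge_min lexx.
apply: (hdel i y (ball x e')).
- exact: measurable_rVball.
- by move=> z /bx[].
- by have := ball_measure_gt0 x kJ e'0; rewrite lt0e => /andP[].
- move=> z /bx[_ _ xz]; apply: (@ball_splitr _ _ x) => //.
move=> t tT; have [c c0 hc] := hr t tT; exists c => // s' z ts /bx[Oz zr _].
by apply: hc => //; exact: subset_closure.
Qed.

Lemma positive_near_coupling T i j y : 0 < T -> i != j -> 0 < Df f 0 i j ->
  positive_near T j y -> positive_near T i y.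
Proof.
move=> T0 ij Dij /positive_near_after[r r0 hr]; exists r => // t /andP[t0 tT].
have [Lam [kap [L0 kap0 _ hL]]] := velocity_lower_bound (ltW T0).
have t2 : 0 < t / 2 by rewrite divr_gt0.
have t2t : t / 2 < t by lra.
have [|c c0 hc] := hr (t / 2); first by rewrite t2; lra.
have a0 : 0 < kap * c by rewrite mulr_gt0.
exists (expR (- (Lam * T)) * ((t - t / 2) * (kap * c))).
  by rewrite mulr_gt0 ?expR_gt0// mulr_gt0// subr_gt0.
move=> z cz zb.
apply: le_trans (_ : expR (- (Lam * T)) * (u (t / 2) z 0 i + (t - t / 2) * (kap * c)) <= _).
  by rewrite ler_pM2l ?expR_gt0// lerDr u_ge0// ltW.
apply: growth_from_source => //; rewrite ?(ltW t2) ?(ltW a0)//.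
move=> x /andP[x1 x2]; have x0 := lt_trans t2 x1; have xT := le_trans (ltW x2) tT.
apply: le_trans (hL x z i j _ cz ij Dij); last by rewrite x0.
by rewrite ler_pM2l//; apply: hc => //; rewrite (ltW x1).
Qed.

(** A datum that is not almost everywhere 0 exceeds some 1/(k+1) on a nonnull
    subset of Om, the boundary being null. *)
Lemma positive_near_initial T : 0 < T -> convex_set Om -> ~ ae_zero Om phi ->
  exists i y, Om y /\ positive_near T i y.
Proof.
move=> T0 cvO nz; have [del del0 hdel] := positive_near_of_mass T0.
have [[phiB phim] phiM] := phiv; have [_ _ u0 _] := usol.
have mOm : measurable (Om : set (lebesgueType R n)) by exact: measurable_open.
pose X i (k : nat) : set 'rV[R]_n := Om `&` (fun z => phi z 0 i) @^-1` `[k.+1%:R^-1, +oo[.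
have mX i k : measurable (X i k : set (lebesgueType R n)).
  have mphi : measurable_fun (Om : set (lebesgueType R n)) (fun x : lebesgueType R n => phi x 0 i).
    apply: (@measurable_funS _ _ (lebesgueType R n) _ (cl : set (lebesgueType R n))).
    - by apply: measurable_closed; exact: closed_closure.
    - exact: subset_closure.
    - exact: phim.
  exact: mphi mOm _ (measurable_itv _).
have [[i [k Xik]]|h] := pselect (exists i k, lebesgue_outer (X i k) != 0%E); last first.
  case: nz; apply: outer_null_negligible.
  pose Y k : set 'rV[R]_n := \bigcup_(i in [set: 'I_m]) X i k.
  apply: (@outer_subset0 _ _ _ ((closure Om `\` Om) `|` \bigcup_k \bigcup_l
    (if insub l is Some i then X i k else set0))).
    move=> z /= /not_implyP[cz pz]; have [Oz|nOz] := pselect (Om z); last by left.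
    right; have [i pi] : exists i, phi z 0 i != 0.
      apply: contrapT => /forallNP hi; apply: pz; apply/rowP => i.
      by rewrite mxE; apply/eqP; apply: contrapT => /negP; exact: hi.
    have pi0 : 0 < phi z 0 i.
      rewrite lt_neqAle eq_sym pi/=; have /order_intervalP/(_ i)/andP[] // := phiM z cz.
    have [k kz] := exists_natSinv_lt pi0.
    exists k => //; exists (val i) => //; rewrite valK; split => //.
    by rewrite /= in_itv/= andbT ltW.
  rewrite (_ : _ `|` _ = \bigcup_k (if k is k'.+1 then \bigcup_l
    (if insub l is Some i then X i k' else set0) else closure Om `\` Om)); last first.
    apply/seteqP; split=> z.
      by move=> [h1|[k _ h1]]; [exists 0%N|exists k.+1].
    by move=> [[|k] _ h1]; [left|right; exists k].
  apply: outer_bigcup0 => -[|k]; first exact: convex_boundary_null.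
  apply: outer_bigcup0 => l; case: insubP => [i _ _|_]; last exact: lebesgue_outer0.
  by apply/eqP; apply: contrapT => /negP hh; apply: h; exists i, k.
have [y [Oy _] yX] := nonnull_local del0 Xik.
exists i, y; split => //.
apply: (hdel i y (X i k `&` ball y del)).
- by apply: measurableI => //; exact: measurable_rVball.
- by move=> z [[]].
- exact: yX.
- by move=> z [].
move=> t /andP[t0 tT]; have [e e0 he] := persistence (ltW T0).
exists (e * k.+1%:R^-1); first by rewrite mulr_gt0// invr_gt0.
move=> s z /andP[ts sT] [[Oz +] _]; rewrite /= in_itv/= andbT => hz.
have cz := subset_closure Oz.
apply: le_trans (he 0 s z i (lexx _) (le_trans (ltW t0) ts) sT cz).
by rewrite ler_pM2l// u0.
Qed.

(** Positivity spreads through Om by connectedness and through the components by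
    irreducibility of the Jacobian at 0: the set of components positive
    everywhere is nonempty, and no component outside it is coupled to it. *)
Lemma solution_positive T y0 : 0 < T -> connected Om -> convex_set Om ->
  ~ ae_zero Om phi -> Om y0 -> exists r c : R, [/\ 0 < r, 0 < c &
    forall y i, cl y -> ball y0 r y -> c <= u T y 0 i].
Proof.
move=> T0 cO cvO nz Oy0.
pose P i := forall y, Om y -> positive_near T i y.
pose I : {set 'I_m} := finset (fun i => `[< P i >]).
have [i1 [y1 [Oy1 p1]]] := positive_near_initial T0 cvO nz.
have allP : I = [set: 'I_m]%SET.
  apply/eqP; apply: contrapT => /negP IT.
  have [cD iD] := fcoop (order_interval0 v0).
  have I0 : I != finset.set0.
    apply/finset.set0Pn; exists i1; rewrite inE; apply/asboolP.
    by apply: positive_near_step => //; exists y1.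
  have [i [j [iI jI Dij]]] := irreducible_entry cD iD I0 IT.
  have ij : i != j by apply: contraNneq iI => ->.
  move: iI; rewrite inE => /asboolP; apply => y Oy.
  apply: positive_near_coupling T0 ij Dij _.
  by move: jI; rewrite inE => /asboolP; exact.
have PP i : positive_near T i y0.
  have iI : i \in I by rewrite allP inE.
  by move: iI; rewrite inE => /asboolP; exact.
have H i : exists rc : R * R, [/\ 0 < rc.1, 0 < rc.2 &
    forall y, cl y -> ball y0 rc.1 y -> rc.2 <= u T y 0 i].
  have [r r0 hr] := PP i; have [|c c0 hc] := hr T; first by rewrite T0 lexx.
  by exists (r, c).
have [rc hrc] := choice H.
have [|r r0 hr] := @finite_lower_bound R m (fun i => (rc i).1).
  by move=> i; have [] := hrc i.
have [|c c0 hc] := @finite_lower_bound R m (fun i => (rc i).2).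
  by move=> i; have [] := hrc i.
exists r, c; split => // y i cy yb; have [_ _ h] := hrc i.
by apply: le_trans (hc i) _; apply: h => //; apply: le_ball yb.
Qed.

End OneSolution.

(** * Long-time behaviour *)

Section LongTime.
Variable kap : R.
Hypothesis hdil : forall c, 0 < c ->
  exists2 T : R, 0 <= T & forall t, T <= t -> `|dil t - kap| <= c.
Hypothesis hrho : forall r0 : R, exists2 T : R, 0 <= T & forall t, T <= t -> r0 <= rho t.

Lemma exp_decay (C c eps T : R) : 0 <= C -> 0 < c -> 0 < eps ->
  exists2 T', T <= T' & forall t, T' <= t -> C * expR (- c * (t - T)) <= eps.
Proof.
move=> C0 c0 e0; exists (T + C / (c * eps)).
  by rewrite lerDl divr_ge0// mulr_ge0// ltW.
move=> t; rewrite -lerBrDl ler_pdivrMr ?mulr_gt0// => h.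
have h1 := expR_ge1Dx (c * (t - T)).
rewrite mulNr expRN ler_pdivrMr ?expR_gt0//; nra.
Qed.

(** The sign condition on the faces passes to the limiting dilution rate with a
    strict inequality, thanks to the margin sigma. *)
Lemma dilution_limit_face i w : M w -> w 0 i = v 0 i -> f w 0 i < kap * v 0 i.
Proof.
move=> wM wi; have [_ _ _ [sg sg0 hsg] _] := fR.
have vi := (vll0P _).1 v0 i.
have [|T T0 hT] := hdil (_ : 0 < sg / 2 / v 0 i); first by rewrite !divr_gt0.
have := hsg i T w T0 wM wi; have := hT T (lexx _).
rewrite ler_norml => /andP[_]; rewrite ler_pdivlMr// => h1 h2.
by lra.
Qed.

Lemma upper_rate w : vll 0 w -> (forall i, f w 0 i < kap * w 0 i) ->
  exists2 c : R, 0 < c & forall i, f w 0 i <= (kap - 2 * c) * w 0 i.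
Proof.
move=> /vll0P w0 fw.
have [|c c0 hc] := @finite_lower_bound R m (fun i => (kap * w 0 i - f w 0 i) / (2 * w 0 i)).
  by move=> i; rewrite divr_gt0 ?subr_gt0// mulr_gt0.
exists c => // i; have := hc i; rewrite ler_pdivlMr ?mulr_gt0//; lra.
Qed.

Lemma lower_rate w : vll 0 w -> (forall i, kap * w 0 i < f w 0 i) ->
  exists2 c : R, 0 < c & forall i, (kap + 3 * c) * w 0 i <= f w 0 i.
Proof.
move=> /vll0P w0 fw.
have [|c c0 hc] := @finite_lower_bound R m (fun i => (f w 0 i - kap * w 0 i) / (3 * w 0 i)).
  by move=> i; rewrite divr_gt0 ?subr_gt0// mulr_gt0.
exists c => // i; have := hc i; rewrite ler_pdivlMr ?mulr_gt0//; lra.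
Qed.

Lemma eventually_below w (eps : R) phi u : M w -> vll 0 w ->
  (forall i, f w 0 i < kap * w 0 i) -> 0 < eps -> Xhat_v Om v phi ->
  solution Om d rho J f phi u ->
  exists2 T, 0 <= T & forall t y i, T <= t -> cl y -> u t y 0 i <= w 0 i + eps.
Proof.
move=> wM w0 fw eps0 phiv usol; have [c c0 hc] := upper_rate w0 fw.
have [T T0 hT] := hdil c0.
have [|b b0 hb] := @finite_lower_bound R m (fun i => w 0 i) _.
  by move=> i; exact: (vll0P _).1 w0 i.
pose s0 := 1 + `|v| / b.
have s01 : 1 <= s0 by rewrite lerDl divr_ge0// ltW.
have [|T' TT' hT'] := @exp_decay (`|v| / b * `|v|) c eps T _ c0 eps0.
  by rewrite !mulr_ge0// invr_ge0 ltW.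
exists T'; first exact: le_trans TT'.
move=> t y i T't cy; have Tt := le_trans TT' T't.
apply: le_trans (solution_upper phiv usol wM w0 c0 T0 hT s01 hc _ Tt i cy) _.
  move=> x j cx; have uM := solution_invariant phiv usol T0 cx.
  have /order_intervalP/(_ j)/andP[_ h] := uM; apply: (le_trans h).
  rewrite /s0 mulrDl mul1r.
  apply: le_trans (_ : `|v| / b * b <= _).
    by rewrite divfK ?gt_eqF//; apply: le_trans (ler_norm _) (coord_le_norm _ j).
  apply: le_trans (_ : `|v| / b * w 0 j <= _).
    by rewrite ler_wpM2l ?hb// divr_ge0// ltW.
  by rewrite lerDr ltW//; exact: (vll0P _).1 w0 j.
rewrite mulrDl mul1r lerD2l; apply: le_trans (hT' t T't).
rewrite /s0 [1 + _]addrC addrK -mulrA [expR _ * _]mulrC mulrA ler_wpM2r ?expR_ge0//.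
rewrite ler_wpM2l// ?divr_ge0// ?(ltW b0)//.
apply: le_trans (ler_norm _) _; apply: le_trans (coord_le_norm _ i) _.
exact: norm_order_interval.
Qed.

(** Positivity is established at time 1 on a ball, which determines the bump chi
    and hence how large rho must be; persistence then carries positivity to the
    time T from which the barrier is valid. *)
Lemma eventually_above w (eps : R) phi u y0 : M w -> vll 0 w ->
  (forall i, kap * w 0 i < f w 0 i) -> 0 < eps -> Xhat_v Om v phi ->
  solution Om d rho J f phi u -> connected Om -> convex_set Om -> ~ ae_zero Om phi ->
  Om y0 ->
  exists r T : R, [/\ 0 < r, 0 <= T & forall t y i, T <= t -> ball y0 r y ->
    w 0 i - eps <= u t y 0 i].
Proof.
move=> wM w0 fw eps0 phiv usol cO cvO nz Oy0; have [c c0 hc] := lower_rate w0 fw.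
have [r1 [c1 [r10 c10 hpos]]] := solution_positive phiv usol ltr01 cO cvO nz Oy0.
have [/= r2 r20 r2O] : exists2 s : R, 0 < s & ball y0 s `<=` Om.
  by have /nbhs_ballP[s s0 sO] := open_nbhs_nbhs (conj oOm Oy0); exists s.
pose R0 := Num.min r1 r2; have R00 : 0 < R0 by rewrite lt_min r10.
have [chi [cchi chi01 chib [r3 r30 chi1] chiE]] :=
  barrier cJ J0 J1 JB S0 JS Jcent J00 n0 y0 R00.
have chiOm z : chi z != 0 -> Om z.
  by move=> /chib zb; apply: r2O; apply: le_ball zb; rewrite ge_min lexx orbT.
have [|eta eta0 heta] := @finite_lower_bound R m (fun i => c / d 0 i).
  by move=> i; rewrite divr_gt0.
have deta i : d 0 i * eta <= c by rewrite mulrC -ler_pdivlMr.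
have [r0 r00 hbar] := chiE eta eta0.
have [T1 T10 hT1] := hdil c0; have [T2 T20 hT2] := hrho r0.
pose T := 1 + T1 + T2.
have T0 : 0 <= T by rewrite !addr_ge0.
have TT1 t : T <= t -> T1 <= t by rewrite /T; lra.
have TT2 t : T <= t -> T2 <= t by rewrite /T; lra.
have [e e0 he] := persistence phiv usol T0.
pose s0 := Num.min 1 (e * c1 / (`|v| + 1)).
have v1 : 0 < `|v| + 1 by rewrite ltr_wpDl.
have s00 : 0 < s0 by rewrite lt_min ltr01 !mulr_gt0// invr_gt0.
have s01 : s0 <= 1 by rewrite ge_min lexx.
have w_le i : w 0 i <= `|v|.
  apply: le_trans (ler_norm _) _; apply: le_trans (coord_le_norm _ i) _.
  exact: norm_order_interval.
have init y i : cl y -> s0 * (chi y * w 0 i) <= u T y 0 i.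
  move=> cy; have /andP[x0 x1] := chi01 y.
  have wi : 0 < w 0 i by exact: (vll0P _).1 w0 i.
  have [->|x] := eqVneq (chi y) 0.
    rewrite mul0r mulr0; have uM := solution_invariant phiv usol T0 cy.
    by have /order_intervalP/(_ i)/andP[] := uM.
  have yb : ball y0 r1 y by apply: le_ball (chib _ x); rewrite ge_min lexx.
  have h1 := hpos y i cy yb.
  have h2 := he 1 T y i ler01 ltac:(by rewrite /T; lra) (lexx _) cy.
  apply: le_trans h2; apply: le_trans (_ : e * c1 <= _); last by rewrite ler_pM2l.
  apply: le_trans (_ : e * c1 / (`|v| + 1) * (`|v| + 1) <= _); last first.
    by rewrite divfK// gt_eqF.
  apply: ler_pM; rewrite ?(ltW s00) ?mulr_ge0 ?(ltW wi)//.
    by rewrite ge_min lexx orbT.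
  apply: le_trans (_ : 1 * `|v| <= _); last by rewrite mul1r lerDl.
  by apply: ler_pM; rewrite ?(ltW wi).
have cs0 : 0 < c * s0 by rewrite mulr_gt0.
have [T' TT' hT'] := exp_decay T (normr_ge0 v) cs0 eps0.
exists (Num.min r2 r3), T'; split; first by rewrite lt_min r20.
  exact: le_trans TT'.
move=> t y i T't yb; have Tt := le_trans TT' T't.
have Oy : Om y by apply: r2O; apply: le_ball yb; rewrite ge_min lexx.
have cy := subset_closure Oy.
have := solution_lower phiv usol wM w0 c0 T0 (fun t Tt => hT1 t (TT1 t Tt)) s00 s01 hc
  cchi chi01 chiOm (ltW eta0) deta hbar (fun t Tt => hT2 t (TT2 t Tt)) init Tt i cy.
apply: le_trans; rewrite chi1; last by apply: le_ball yb; rewrite ge_min lexx orbT.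
rewrite mul1r mulrBl mul1r lerD2l lerN2; apply: le_trans (hT' t T't).
rewrite mulrAC ler_pM2r ?expR_gt0//; apply: le_trans (w_le i).
by rewrite ler_piMl ?gerBl ?(ltW s00)// ltW//; exact: (vll0P _).1 w0 i.
Qed.

Hypothesis m0 : (0 < m)%N.
Local Notation A := (Df f 0 + (- kap)%:M).

Lemma solution_norm_le phi u t (e : R) : Xhat_v Om v phi ->
  solution Om d rho J f phi u -> 0 <= t -> 0 <= e -> Om !=set0 ->
  (forall y i, cl y -> u t y 0 i <= e) -> Xnorm Om (u t) <= e.
Proof.
move=> phiv usol t0 e0 ne h; apply: Xnorm_le => // y cy.
apply: norm_le_coord => // i; have uM := solution_invariant phiv usol t0 cy.
by have /order_intervalP/(_ i)/andP[u0 _] := uM; rewrite ger0_norm// h.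
Qed.

Lemma extinction phi u : Om !=set0 -> spectral_bound A <= 0 -> Xhat_v Om v phi ->
  solution Om d rho J f phi u -> Xnorm Om (u t) @[t --> +oo] --> (0 : R).
Proof.
move=> ne sA phiv usol; apply/cvgrPdist_le => eps eps0.
have e2 : 0 < eps / 2 by rewrite divr_gt0.
have [w [wM w0 weps fw]] :=
  small_supersolution v0 fC1 fcoop f0 fsub m0 e2 sA.
have [T T0 hT] := eventually_below wM w0 fw e2 phiv usol.
exists T; split; first exact: num_real.
move=> t /ltW Tt; rewrite sub0r normrN ger0_norm ?Xnorm_ge0//.
apply: (solution_norm_le phiv usol _ (ltW eps0) ne); first exact: le_trans Tt.
by move=> y i cy; have := hT t y i Tt cy; have := weps i; lra.
Qed.

(** On [0, T] solutions grow at most exponentially, so a small datum is below the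
    small supersolution w at time T; from then on w is an upper barrier. *)
Lemma extinction_stable (eps : R) : Om !=set0 -> spectral_bound A <= 0 -> 0 < eps ->
  exists2 delta : R, 0 < delta & forall phi u, Xhat_v Om v phi ->
    Xnorm Om phi < delta -> solution Om d rho J f phi u ->
    forall t, 0 <= t -> Xnorm Om (u t) < eps.
Proof.
move=> ne sA eps0; have e2 : 0 < eps / 2 by rewrite divr_gt0.
have [w [wM w0 weps fw]] :=
  small_supersolution v0 fC1 fcoop f0 fsub m0 e2 sA.
have [c c0 hc] := upper_rate w0 fw; have [T T0 hT] := hdil c0.
have [Cd Cd0 hCd] := dilution_bounded T0.
have [L L0 hL] := Lipschitz_ball fC1 `|v|.
have hL0 a i : M a -> `|f a 0 i| <= L * `|a|.
  move=> aM; have := hL a 0 (norm_order_interval aM).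
  by rewrite normr0 => /(_ (normr_ge0 _) i); rewrite f0 mxE !subr0.
have [|b b0 hb] := @finite_lower_bound R m (fun i => w 0 i) _.
  by move=> i; exact: (vll0P _).1 w0 i.
pose e := Num.min b (eps / 2); have e0 : 0 < e by rewrite lt_min b0.
pose delta := e * expR (- ((Cd + L) * T)).
have delta0 : 0 < delta by rewrite mulr_gt0// expR_gt0.
exists delta => // phi u phiv phid usol t t0.
have hphi y i : cl y -> phi y 0 i <= delta.
  move=> cy; have [[[C hC] _] _] := phiv.
  apply: le_trans (ler_norm _) _; apply: le_trans (coord_le_norm _ i) _.
  exact: le_trans (Xnorm_ge hC cy) (ltW phid).
have small s y i : 0 <= s <= T -> cl y -> u s y 0 i <= e.
  move=> /andP[s0 sT] cy.
  have sT' : 0 <= s <= T by rewrite s0.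
  apply: le_trans (solution_growth phiv usol Cd0 (ltW L0) hCd hL0 delta0 hphi i sT' cy) _.
  rewrite /delta -mulrA ler_piMr ?(ltW e0)// -expRD -expR0 ler_expR.
  by rewrite addrC subr_le0 ler_wpM2l// addr_ge0// (ltW L0).
apply: (@le_lt_trans _ _ (eps / 2)); last by lra.
apply: (solution_norm_le phiv usol t0 (ltW e2) ne) => y i cy.
have [tT|Tt] := leP t T.
  apply: le_trans (small t y i _ cy) _; first by rewrite t0.
  by rewrite ge_min lexx orbT.
have init x j : cl x -> u T x 0 j <= 1 * w 0 j.
  move=> cx; rewrite mul1r; apply: le_trans (hb j).
  apply: le_trans (small T x j _ cx) _; first by rewrite T0 lexx.
  by rewrite ge_min lexx.
have := solution_upper phiv usol wM w0 c0 T0 hT (lexx 1) hc init (ltW Tt) i cy.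
by rewrite subrr mul0r addr0 mul1r => /le_trans; apply.
Qed.

(** Squeeze between barriers converging to vectors close to w.  The lower barrier
    is local in space; compactness of K makes its time uniform. *)
Lemma persistence_cvg w phi u (K : set 'rV[R]_n) : M w -> vll 0 w ->
  (forall i, f w 0 i = kap * w 0 i) -> Xhat_v Om v phi ->
  solution Om d rho J f phi u -> connected Om -> convex_set Om -> ~ ae_zero Om phi ->
  compact K -> K `<=` Om -> {uniform K, u @ +oo --> (fun=> w)}.
Proof.
move=> wM w0 fw phiv usol cO cvO nz cK KOm P /uniform_nbhs[E [entE EP]].
have [eps eps0 hE] : exists2 eps : R, 0 < eps & forall a b : 'rV[R]_m, `|a - b| < eps -> E (a, b).
  move: entE; rewrite -entourage_ballE => -[e /= e0 he]; exists e => // a b ab.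
  by apply: he; rewrite /= -ball_normE.
have e2 : 0 < eps / 2 by rewrite divr_gt0.
have e4 : 0 < eps / 4 by rewrite divr_gt0.
have face := dilution_limit_face.
have [wl [wlM wl0 wle fwl]] := strict_sub_near fC1 fcoop fsub e4 wM w0 fw.
have [wu [wuM wu0 wue fwu]] := strict_super_near fC1 fcoop fsub face e4 wM w0 fw.
have [T T0 hT] := eventually_below wuM wu0 fwu e4 phiv usol.
have cover : \forall t \near +oo, K `<=` (fun y => `|w - u t y| < eps).
  apply: ((compact_near_coveringP K).1 cK R +oo (fun t y => `|w - u t y| < eps) _).
  move=> y0 Ky0; have Oy0 := KOm y0 Ky0.
  have [r [T' [r0 T'0 hT']]] :=
    eventually_above wlM wl0 fwl e4 phiv usol cO cvO nz Oy0.
  have [s s0 sO] : exists2 s : R, 0 < s & ball y0 s `<=` Om.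
    by have /nbhs_ballP[s s0 sO] := open_nbhs_nbhs (conj oOm Oy0); exists s.
  exists (ball y0 (Num.min r s), [set t | T + T' < t]); first split => /=.
  - by apply: nbhsx_ballx; rewrite lt_min r0.
  - by exists (T + T'); split; [exact: num_real|].
  move=> [y t] [/= yb tT].
  have cy : cl y.
    apply: subset_closure; apply: sO; apply: le_ball yb.
    by rewrite ge_min lexx orbT.
  have yr : ball y0 r y by apply: le_ball yb; rewrite ge_min lexx.
  apply: (@le_lt_trans _ _ (eps / 2)); last by lra.
  apply: norm_le_coord => [|i]; first exact: ltW.
  rewrite !mxE ler_norml.
  have := hT t y i ltac:(lra) cy; have := hT' t y i ltac:(lra) yr.
  have := wle i; have := wue i => h1 h2 h3 h4.
  by apply/andP; split; lra.
move: cover; apply: filterS => t Kt; apply: EP => y Ky /=.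
by apply: hE; exact: Kt.
Qed.

End LongTime.

End Solutions.

(** * Extinction and persistence *)

Lemma compactly_supported_bounds (R : realType) (n : nat) (J : 'rV[R]_n -> R) :
  continuous J -> compactly_supported J -> exists B S : R,
  [/\ forall x, J x <= B, 0 < S & forall x, J x != 0 -> `|x| < S].
Proof.
move=> cJ cpt; pose C := closure [set x | J x != 0].
have sub x : J x != 0 -> C x by move=> Jx; exact: (@subset_closure _ [set x | J x != 0]).
have [S [_ hS]] := compact_bounded cpt.
have cptJ : compact (J @` C).
  by apply: continuous_compact => //; apply: continuous_subspaceT.
have [B [_ hB]] := compact_bounded cptJ.
have S1 : `|S| < `|S| + 1 by rewrite ltrDl.
have B1 : `|B| < `|B| + 1 by rewrite ltrDl.
exists (`|B| + 1), (`|S| + 2); split.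
- move=> x; have [->|Jx] := eqVneq (J x) 0; first by rewrite addr_ge0.
  apply: le_trans (ler_norm _) _.
  by apply: (hB _ (le_lt_trans (ler_norm _) B1)); exists x => //; exact: sub.
- by rewrite ltr_wpDl.
move=> x /sub Cx; apply: le_lt_trans (hS _ (le_lt_trans (ler_norm _) S1) x Cx) _.
by rewrite ltrD2l ltrDr.
Qed.

Lemma eventually_close (R : realType) (g : R -> R) (l c : R) : g t @[t --> +oo] --> l ->
  0 < c -> exists2 T : R, 0 <= T & forall t, T <= t -> `|g t - l| <= c.
Proof.
move=> gl c0; have := gl; move=> /cvgrPdist_le/(_ _ c0)[T [_ hT]].
exists (`|T| + 1); first by rewrite addr_ge0.
move=> t Tt; rewrite distrC; apply: hT; apply: lt_le_trans Tt.
by rewrite (le_lt_trans (ler_norm T))// ltrDl.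
Qed.

Lemma eventually_large (R : realType) (g : R -> R) (a : R) : g t @[t --> +oo] --> +oo ->
  exists2 T : R, 0 <= T & forall t, T <= t -> a <= g t.
Proof.
move=> /cvgryPge/(_ a)[T [_ hT]]; exists (`|T| + 1); first by rewrite addr_ge0.
move=> t Tt; apply: hT; apply: lt_le_trans Tt.
by rewrite (le_lt_trans (ler_norm T))// ltrDl.
Qed.

Theorem theorem5p10 (R : realType) (m n : nat) (hm : (0 < m)%N) (hn : (0 < n)%N)
  (Om : set 'rV[R]_n) (hOm : smooth_bounded_simply_connected_domain Om)
  (d : 'rV[R]_m) (hd : forall i, 0 < d 0 i)
  (rho : R -> R) (hrho_pos : forall t : R, 0 <= t -> 0 < rho t)
  (hrho_smooth : half_smooth rho) (hrho0 : rho 0 = 1)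
  (v : 'rV[R]_m) (hv : vll 0 v)
  (J : 'rV[R]_n -> R) (hJ : kernel_assumption J)
  (f : 'rV[R]_m -> 'rV[R]_m) (hf : reaction_assumption n rho f v)
  (hrho_infty : rho t @[t --> +oo] --> +oo)
  (k : R) (hk : 0 <= k)
  (hrho_rate : half_derive rho t / rho t @[t --> +oo] --> k)
  (hconvex : convex_set Om)
  (hJ_compact : compactly_supported J) (hJ_centered : centered J) :
  let A : 'M[R]_m := - (n%:R * k) *: 1%:M + Df f 0 in
  (spectral_bound A <= 0 ->
     globally_asymptotically_stable0 Om d rho J f (Xhat_v Om v)) /\
  (0 < spectral_bound A ->
     exists we : 'rV[R]_m,
       [/\ positive_equilibrium n f v k we,
           forall w, positive_equilibrium n f v k w -> w = we &
           forall u0 u, Xhat_v Om v u0 -> ~ ae_zero Om u0 ->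
             solution Om d rho J f u0 u ->
             forall K : set 'rV[R]_n, compact K -> K `<=` Om ->
               {uniform K, u @ +oo --> (fun=> we)}]).
Proof.
move=> A; have [[oOm neOm cOm] [bOm _ _]] := hOm.
have [cJ _ _ _] := hJ; have [B [S [JB S0 JS]]] := compactly_supported_bounds cJ hJ_compact.
pose kap := n%:R * k.
have dil_cvg : dilution n rho t @[t --> +oo] --> kap by exact: cvgMr.
have hdil c : 0 < c -> exists2 T : R, 0 <= T &
    forall t, T <= t -> `|dilution n rho t - kap| <= c.
  by move=> c0; exact: eventually_close dil_cvg c0.
have hrho r0 : exists2 T : R, 0 <= T & forall t, T <= t -> r0 <= rho t.
  exact: eventually_large hrho_infty.
have AE : A = Df f 0 + (- kap)%:M.
  by rewrite /A addrC -scaleNr scalemx1.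
have [fC1 fcoop f0 _ fsub] := hf.
have face := dilution_limit_face hv hf hdil.
have equil w : positive_equilibrium n f v k w <->
    [/\ order_interval v w, vlt 0 w & forall i, f w 0 i = kap * w 0 i].
  split=> -[wM w0 fw]; split => //.
    move=> i; have := congr1 (fun x : 'rV[R]_m => x 0 i) fw.
    by rewrite !(mxE _ _ 0 i) => /eqP; rewrite mulNr addrC subr_eq0 => /eqP.
  by apply/rowP => i; rewrite !(mxE _ _ 0 i) fw mulNr addNr.
rewrite AE; split=> [sA|sA].
  split=> [phi u phiv usol|eps eps0].
    exact: (extinction oOm bOm hd hrho_pos hrho_smooth hv hJ JB JS hf hdil hm neOm sA phiv usol).
  exact: (extinction_stable oOm bOm hd hrho_pos hrho_smooth hv hJ JB JS hf hdil hm neOm sA eps0).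
have [we [weM we0 fwe]] := equilibrium_exists hv fC1 fcoop f0 face hm sA.
have we1 : vlt 0 we.
  split; first by have [] := weM.
  by move=> e; have := (vll0P _).1 we0 (Ordinal hm); rewrite -e mxE ltxx.
exists we; split.
- by apply/equil.
- move=> w /equil[wM w0 fw].
  exact: (equilibrium_unique hv fC1 fcoop f0 fsub hm wM weM w0 we1 fw fwe).
move=> u0 u u0v nz usol K cK KOm.
exact: (persistence_cvg hn oOm bOm hd hrho_pos hrho_smooth hv hJ JB S0 JS hJ_centered
  hf hdil hrho weM we0 fwe u0v usol cOm hconvex nz cK KOm).
Qed.
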